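(* Let $Q$ be a forest whose connected components are barren trees and let $R$ be a Gorenstein ring. A representation $\mathcal{M}\in(Q,R\text{-Mod})$ is Gorenstein flat if and only if for each vertex $v$ of $Q$, $\mathcal{M}(v)$ is a Gorenstein flat left $R$-module, the sequence $$0\to\bigoplus_{t(a)=v}\mathcal{M}(s(a))\xrightarrow{f_v}\mathcal{M}(v)\to\mathcal{C}(v)\to0$$ is exact and $\mathcal{C}(v)$ is a Gorenstein flat left $R$-module, where $f_v$ is the morphism induced by the maps $\mathcal{M}(a):\mathcal{M}(s(a))\to\mathcal{M}(v)$ and $\mathcal{C}(v)$ is the cokernel of $f_v$.
   Context: Rings are associative with identity, not necessarily commutative. A quiver $Q$ consists of a set $V$ of vertices, a set $\Gamma$ of arrows and source and target maps $s,t:\Gamma\to V$; both sets may be infinite. $(Q,R\text{-Mod})$ is the category of representations of $Q$ by left $R$-modules: a representation $\mathcal{X}$ assigns a left $R$-module $\mathcal{X}(v)$ to each vertex $v$ and a homomorphism $\mathcal{X}(a):\mathcal{X}(s(a))\to\mathcal{X}(t(a))$ to each arrow $a$; morphisms are natural transformations. It is equivalent to the category of (unitary) left modules over the path algebra $RQ$, a ring with enough idempotents. $Q^{op}$ is the quiver with the same vertices and all arrows reversed; $(Q^{op},\text{Mod-}R)$, the category of representations of $Q^{op}$ by right $R$-modules, is equivalent to right $RQ$-modules. A tree is a quiver $T$ with a vertex $v_0$ (the root) such that for every vertex $w$ of $T$ there is a unique path from $v_0$ to $w$ (vertices being trivial paths). A forest is a quiver every connected component of which is a tree. For a tree $T$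 with root $v_0$, let $V_1=\{v_0\}$, $V_{i+1}=\{w:\ \text{there is an arrow } v\to w \text{ with } v\in V_i\}$ and $n_i=|V_i|$. $T$ is barren if all $n_i$ are finite and the sequence $(n_i)$ stabilizes, i.e. there is $k$ with $n_{k+i}=n_k$ for all $i\ge0$. A Gorenstein ring (in the sense of Iwanaga) is a left and right noetherian ring having finite injective dimension both as a left and as a right module over itself. A representation is flat if it is flat as a left $RQ$-module (equivalently, a direct limit of projective representations). A representation $\mathcal{M}\in(Q,R\text{-Mod})$ is Gorenstein flat if there is an exact sequence $\cdots\to\mathcal{F}_{-1}\to\mathcal{F}_0\to\mathcal{F}_1\to\cdots$ of flat representations with $\mathcal{M}=\ker(\mathcal{F}_0\to\mathcal{F}_1)$ which remains exact after applying $\mathcal{E}\otimes_{RQ}-$ for every injective right $RQ$-module (i.e. injective object of $(Q^{op},\text{Mod-}R)$) $\mathcal{E}$. Gorenstein flat left $R$-modules are defined in the same way, with flat left $R$-modules and $E\otimes_R-$ for injective right $R$-modules $E$. *)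

(* Defs.v *)
From HB Require Import structures.
From Stdlib Require Import Relation_Operators.
From mathcomp Require Import all_boot all_algebra.
From mathcomp Require Import ring_quotient generic_quotient.
From mathcomp Require Import boolp classical_sets functions cardinality fsbigop.
From mathcomp Require Import freeg.

Set Implicit Arguments.
Unset Strict Implicit.
Unset Printing Implicit Defensive.

Import GRing.Theory.

Local Open Scope classical_set_scope.
Local Open Scope quotient_scope.
Local Open Scope ring_scope.

(* Left [R]-modules are [lmodType R]; right [R]-modules are [lmodType R^c],
   [r *: x] being then [x r].  Rings may be trivial ([pzRingType]). *)

Definition exact_at (R : pzRingType) (A B C : lmodType R)
    (f : A -> B) (g : B -> C) : Prop :=
  forall y : B, g y = 0 <-> exists x : A, f x = y.

Definition short_exact (R : pzRingType) (A B C : lmodType R)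
    (f : A -> B) (g : B -> C) : Prop :=
  [/\ injective f, exact_at f g & forall z : C, exists y : B, g y = z].

Section QuotientModule.
Variables (R : pzRingType) (V : lmodType R).

Inductive submod_gen (P : V -> Prop) : V -> Prop :=
| submod_gen0 : submod_gen P 0
| submod_gen_lin a u v : P u -> submod_gen P v -> submod_gen P (a *: u + v).

Variable P : V -> Prop.

Lemma submod_genD u v :
  submod_gen P u -> submod_gen P v -> submod_gen P (u + v).
Proof.
elim=> [|a x y Px _ IH] hv; first by rewrite add0r.
by rewrite -addrA; apply: submod_gen_lin => //; exact: IH.
Qed.

Lemma submod_genZ a u : submod_gen P u -> submod_gen P (a *: u).
Proof.
elim=> [|b x y Px _ IH]; first by rewrite scaler0; left.
by rewrite scalerDr scalerA; apply: submod_gen_lin.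
Qed.

Lemma submod_gen1 u : P u -> submod_gen P u.
Proof. by move=> Pu; rewrite -[u]addr0 -[u]scale1r; right=> //; left. Qed.

Definition submod_genb : V -> bool := fun x => `[< submod_gen P x >].

Lemma submod_genb_closed : submod_closed submod_genb.
Proof.
split=> [|a u v]; rewrite !unfold_in; first by apply/asboolP; left.
move=> /asboolP hu /asboolP hv; apply/asboolP.
by apply: submod_genD => //; apply: submod_genZ.
Qed.

HB.instance Definition _ :=
  GRing.isSubmodClosed.Build R V submod_genb submod_genb_closed.

Definition submod_gen_closed : zmodClosed V := GRing.ZmodClosed.clone V submod_genb _.

Definition quotmod : Type := Quotient.quot submod_gen_closed.

HB.instance Definition _ := Quotient.on quotmod.
HB.instance Definition _ := GRing.Zmodule.on quotmod.

Definition quotmod_proj : V -> quotmod := fun x => \pi_(Quotient.quot submod_gen_closed) x.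

Lemma quotmod_projP x y :
  quotmod_proj x = quotmod_proj y <-> submod_gen P (x - y).
Proof.
rewrite /quotmod_proj; split=> [/eqP|h].
  by rewrite -Quotient.idealrBE unfold_in => /asboolP.
by apply/eqP; rewrite -Quotient.idealrBE unfold_in; apply/asboolP.
Qed.

Lemma quotmod_projD x y : quotmod_proj (x + y) = quotmod_proj x + quotmod_proj y.
Proof. exact: (raddfD \pi_(Quotient.quot submod_gen_closed)). Qed.

Lemma quotmod_surj (z : quotmod) : exists x, quotmod_proj x = z.
Proof. by exists (repr z); exact: reprK. Qed.

Definition quotmod_scale (a : R) (z : quotmod) : quotmod :=
  quotmod_proj (a *: repr z).

Lemma quotmod_scaleE a x :
  quotmod_scale a (quotmod_proj x) = quotmod_proj (a *: x).
Proof.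
apply/quotmod_projP; rewrite -scalerBr; apply: submod_genZ.
by apply/quotmod_projP; exact: reprK.
Qed.

Lemma quotmod_scaleA a b z :
  quotmod_scale a (quotmod_scale b z) = quotmod_scale (a * b) z.
Proof. by have [x <-] := quotmod_surj z; rewrite !quotmod_scaleE scalerA. Qed.

Lemma quotmod_scale1 : left_id 1 quotmod_scale.
Proof.
by move=> z; have [x <-] := quotmod_surj z; rewrite quotmod_scaleE scale1r.
Qed.

Lemma quotmod_scaleDr : right_distributive quotmod_scale +%R.
Proof.
move=> a z t; have [x <-] := quotmod_surj z; have [y <-] := quotmod_surj t.
by rewrite -quotmod_projD !quotmod_scaleE scalerDr quotmod_projD.
Qed.

Lemma quotmod_scaleDl z : {morph quotmod_scale^~ z : a b / a + b}.
Proof.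
move=> a b; have [x <-] := quotmod_surj z.
by rewrite !quotmod_scaleE scalerDl quotmod_projD.
Qed.

HB.instance Definition _ := GRing.Zmodule_isLmodule.Build R quotmod
  quotmod_scaleA quotmod_scale1 quotmod_scaleDr quotmod_scaleDl.

Lemma quotmod_proj_is_linear : linear quotmod_proj.
Proof. by move=> a x y; rewrite quotmod_projD -quotmod_scaleE. Qed.

HB.instance Definition _ :=
  GRing.isLinear.Build R V quotmod _ quotmod_proj quotmod_proj_is_linear.

End QuotientModule.

Section QuotientMap.
Variables (R : pzRingType) (V W : lmodType R) (P : V -> Prop) (S : W -> Prop).
Variable h : {linear V -> W}.
Hypothesis hPS : forall x, P x -> submod_gen S (h x).

Definition quotmod_map : quotmod P -> quotmod S :=
  fun z => quotmod_proj S (h (repr z)).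

Lemma quotmod_mapE x :
  quotmod_map (quotmod_proj P x) = quotmod_proj S (h x).
Proof.
apply/quotmod_projP; rewrite -linearB.
have: submod_gen P (repr (quotmod_proj P x) - x).
  by apply/quotmod_projP; exact: reprK.
elim=> [|a u v Pu _ IH]; first by rewrite raddf0; left.
by rewrite linearP; apply: submod_genD => //; apply/submod_genZ/hPS.
Qed.

Lemma quotmod_map_is_linear : linear quotmod_map.
Proof.
move=> a z t; have [x <-] := quotmod_surj z; have [y <-] := quotmod_surj t.
by rewrite -linearP !quotmod_mapE 2!linearP.
Qed.

Definition quotmod_lin : {linear quotmod P -> quotmod S} :=
  HB.pack quotmod_map
    (GRing.isLinear.Build R (quotmod P) (quotmod S) _ quotmod_map
       quotmod_map_is_linear).

End QuotientMap.

Definition coker (R : pzRingType) (A B : lmodType R) (f : A -> B) : lmodType R :=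
  quotmod (range f).

Definition coker_proj (R : pzRingType) (A B : lmodType R) (f : A -> B) :
  {linear B -> coker f} := quotmod_proj (range f).

Section DirectSum.
Variables (R : pzRingType) (I : choiceType) (F : I -> lmodType R).

Definition dsum : Type :=
  {x : forall i, F i | `[< finite_set [set i | x i <> 0] >]}.

HB.instance Definition _ := gen_eqMixin dsum.
HB.instance Definition _ := gen_choiceMixin dsum.

Definition dsum_coef (x : dsum) : forall i, F i := sval x.

Lemma dsum_fin (x : dsum) : finite_set [set i | dsum_coef x i <> 0].
Proof. by apply/asboolP; exact: (svalP x). Qed.

Lemma dsumP (x y : dsum) :
  (forall i, dsum_coef x i = dsum_coef y i) -> x = y.
Proof. by move=> e; apply: val_inj; apply: functional_extensionality_dep. Qed.

Lemma dsum0_subproof : `[< finite_set [set i | (0 : F i) <> 0] >].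
Proof.
by apply/asboolP; rewrite (_ : [set i | _] = set0) // -subset0 => i.
Qed.

Lemma dsumN_subproof (x : dsum) :
  `[< finite_set [set i | - dsum_coef x i <> 0] >].
Proof.
apply/asboolP; apply: sub_finite_set (dsum_fin x) => i /= h e.
by apply: h; rewrite e oppr0.
Qed.

Lemma dsumD_subproof (x y : dsum) :
  `[< finite_set [set i | dsum_coef x i + dsum_coef y i <> 0] >].
Proof.
apply/asboolP; have h : finite_set ([set i | dsum_coef x i <> 0]
    `|` [set i | dsum_coef y i <> 0]).
  by rewrite finite_setU; split; exact: dsum_fin.
apply: sub_finite_set h => i /= h.
have [ex|nx] := pselect (dsum_coef x i = 0); last by left.
by right=> ey; apply: h; rewrite ex ey addr0.
Qed.

Lemma dsumZ_subproof a (x : dsum) :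
  `[< finite_set [set i | a *: dsum_coef x i <> 0] >].
Proof.
apply/asboolP; apply: sub_finite_set (dsum_fin x) => i /= h e.
by apply: h; rewrite e scaler0.
Qed.

Definition dsum0 : dsum := exist _ (fun i => 0) dsum0_subproof.
Definition dsumN x : dsum := exist _ (fun i => - dsum_coef x i) (dsumN_subproof x).
Definition dsumD x y : dsum :=
  exist _ (fun i => dsum_coef x i + dsum_coef y i) (dsumD_subproof x y).
Definition dsumZ a x : dsum :=
  exist _ (fun i => a *: dsum_coef x i) (dsumZ_subproof a x).

Lemma dsum_addA : associative dsumD.
Proof. by move=> x y z; apply: dsumP => i /=; exact: addrA. Qed.
Lemma dsum_addC : commutative dsumD.
Proof. by move=> x y; apply: dsumP => i /=; exact: addrC. Qed.
Lemma dsum_add0 : left_id dsum0 dsumD.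
Proof. by move=> x; apply: dsumP => i /=; exact: add0r. Qed.
Lemma dsum_addN : left_inverse dsum0 dsumN dsumD.
Proof. by move=> x; apply: dsumP => i /=; exact: addNr. Qed.

HB.instance Definition _ :=
  GRing.isZmodule.Build dsum dsum_addA dsum_addC dsum_add0 dsum_addN.

Lemma dsum_scaleA a b x : dsumZ a (dsumZ b x) = dsumZ (a * b) x.
Proof. by apply: dsumP => i /=; exact: scalerA. Qed.
Lemma dsum_scale1 : left_id 1 dsumZ.
Proof. by move=> x; apply: dsumP => i /=; exact: scale1r. Qed.
Lemma dsum_scaleDr : right_distributive dsumZ +%R.
Proof. by move=> a x y; apply: dsumP => i /=; exact: scalerDr. Qed.
Lemma dsum_scaleDl x : {morph dsumZ^~ x : a b / a + b}.
Proof. by move=> a b; apply: dsumP => i /=; exact: scalerDl. Qed.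

HB.instance Definition _ := GRing.Zmodule_isLmodule.Build R dsum
  dsum_scaleA dsum_scale1 dsum_scaleDr dsum_scaleDl.

Variables (N : lmodType R) (f : forall i, {linear F i -> N}).

Definition dsum_desc (x : dsum) : N := \sum_(i \in setT) f i (dsum_coef x i).

Lemma dsum_descE (s : seq I) (x : dsum) : uniq s ->
  (forall i, dsum_coef x i <> 0 -> i \in s) ->
  dsum_desc x = \sum_(i <- s) f i (dsum_coef x i).
Proof.
move=> us hs; rewrite [RHS]fsbig_seq //.
apply/esym/fsbig_widen => // i /= [_ his].
have [->|/hs /his //] := pselect (dsum_coef x i = 0).
by rewrite linear0.
Qed.

Lemma dsum_desc_is_linear : linear dsum_desc.
Proof.
move=> a x y; have /finite_seqP[s hs] : finite_set
    ([set i | dsum_coef x i <> 0] `|` [set i | dsum_coef y i <> 0]).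
  by rewrite finite_setU; split; exact: dsum_fin.
have sx i : dsum_coef x i <> 0 -> i \in undup s.
  move=> h; rewrite mem_undup.
  by move: (f_equal (fun A : set I => A i) hs) => /= <-; left.
have sy i : dsum_coef y i <> 0 -> i \in undup s.
  move=> h; rewrite mem_undup.
  by move: (f_equal (fun A : set I => A i) hs) => /= <-; right.
have sxy i : dsum_coef (a *: x + y) i <> 0 -> i \in undup s.
  move=> h; have [ex|/sx //] := pselect (dsum_coef x i = 0).
  have [ey|/sy //] := pselect (dsum_coef y i = 0).
  by exfalso; apply: h => /=; rewrite ex ey scaler0 addr0.
rewrite !(@dsum_descE (undup s)) ?undup_uniq // scaler_sumr -big_split /=.
by apply: eq_bigr => i _; exact: linearP.
Qed.

HB.instance Definition _ :=
  GRing.isLinear.Build R dsum N _ dsum_desc dsum_desc_is_linear.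

End DirectSum.

Section FreegLift.
Variables (K : choiceType) (M : lmodType int) (f : K -> M).

Lemma fglift_is_linear : linear (fglift (R := int) f : {freeg K} -> M).
Proof.
pose A : {additive {freeg K} -> M} := HB.pack (fglift (R := int) f)
  (GRing.isZmodMorphism.Build _ _ (fglift (R := int) f) (lift_is_additive f)).
move=> a u v; rewrite -[fglift _]/(A : _ -> _) raddfD; congr (_ + _).
by rewrite -[in LHS](intz a) -[in RHS](intz a) !scaler_int raddfMz.
Qed.

Definition fglift_lin : {linear {freeg K} -> M} :=
  HB.pack (fglift (R := int) f : {freeg K} -> M)
    (GRing.isLinear.Build int _ _ _ (fglift (R := int) f) fglift_is_linear).

Lemma fglift_linE x : fglift_lin << x >> = f x.
Proof. by rewrite /= liftU scale1r. Qed.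
End FreegLift.

Section TensorProduct.
Variable R : pzRingType.

Inductive tensor_rel (E : lmodType R^c) (M : lmodType R) :
    {freeg (E * M)%type} -> Prop :=
| tensor_addl x x' y : tensor_rel (<< (x + x', y) >> - << (x, y) >> - << (x', y) >>)
| tensor_addr x y y' : tensor_rel (<< (x, y + y') >> - << (x, y) >> - << (x, y') >>)
| tensor_bal (r : R) x y :
    tensor_rel (<< ((r : R^c) *: x, y) >> - << (x, r *: y) >>).

(* the abelian group (i.e. [int]-module) [E (x)_R M] *)
Definition tensor (E : lmodType R^c) (M : lmodType R) : lmodType int :=
  quotmod (@tensor_rel E M).

Section Map.
Variables (E E' : lmodType R^c) (M M' : lmodType R).
Variables (f : {linear E -> E'}) (g : {linear M -> M'}).

Definition tensor_gen_map : {linear {freeg (E * M)%type} -> {freeg (E' * M')%type}} :=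
  fglift_lin (fun z : (E * M)%type => << (f z.1, g z.2) >> : {freeg (E' * M')%type}).

Lemma tensor_gen_mapP u :
  tensor_rel u -> submod_gen (@tensor_rel E' M') (tensor_gen_map u).
Proof.
case=> [x x' y|x y y'|r x y]; rewrite !linearB !fglift_linE /=;
  apply: submod_gen1.
- by rewrite linearD; exact: tensor_addl.
- by rewrite linearD; exact: tensor_addr.
- by rewrite !linearZ_LR; exact: tensor_bal.
Qed.

Definition tensor_map : {linear tensor E M -> tensor E' M'} :=
  quotmod_lin tensor_gen_mapP.
End Map.

End TensorProduct.

Definition injective_module (R : pzRingType) (E : lmodType R) : Prop :=
  forall (A B : lmodType R) (i : {linear A -> B}) (g : {linear A -> E}),
    injective i -> exists h : {linear B -> E}, forall x, h (i x) = g x.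

Definition flat_module (R : pzRingType) (M : lmodType R) : Prop :=
  forall (A B : lmodType R^c) (i : {linear A -> B}),
    injective i -> injective (tensor_map i (@idfun M)).

(* [k] identifies [M] with the kernel of [d 0 : F 0 -> F 1]. *)
Definition gorenstein_flat_module (R : pzRingType) (M : lmodType R) : Prop :=
  exists (F : int -> lmodType R) (d : forall n, {linear F n -> F (n + 1)})
         (k : {linear M -> F 0}),
    [/\ forall n, flat_module (F n),
        forall n, exact_at (d n) (d (n + 1)),
        injective k /\ exact_at k (d 0)
      & forall E : lmodType R^c, injective_module E -> forall n,
          exact_at (tensor_map (@idfun E) (d n)) (tensor_map (@idfun E) (d (n + 1)))].

Definition finite_injective_dim (R : pzRingType) (M : lmodType R) : Prop :=
  exists (n : nat) (I : nat -> lmodType R)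
         (e : {linear M -> I 0%N}) (d : forall i, {linear I i -> I i.+1}),
    [/\ forall i, injective_module (I i),
        injective e /\ exact_at e (d 0%N),
        forall i, exact_at (d i) (d i.+1)
      & forall i (x : I i), (n < i)%N -> x = 0].

Definition left_ideal (R : pzRingType) (I : set R) : Prop :=
  [/\ I 0, forall x y, I x -> I y -> I (x + y) & forall r x, I x -> I (r * x)].

Definition left_noetherian (R : pzRingType) : Prop :=
  forall I : nat -> set R,
    (forall n, left_ideal (I n)) -> (forall n, I n `<=` I n.+1) ->
    exists n, forall m, (n <= m)%N -> I m = I n.

Definition gorenstein_ring (R : pzRingType) : Prop :=
  [/\ left_noetherian R, left_noetherian R^c,
      finite_injective_dim (R^o : lmodType R)
    & finite_injective_dim ((R^c)^o : lmodType R^c)].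

Record quiver := Quiver {
  vertex : choiceType;
  arrow : choiceType;
  source : arrow -> vertex;
  target : arrow -> vertex }.

Definition opposite (Q : quiver) : quiver := Quiver (@target Q) (@source Q).

Inductive qpath (Q : quiver) (v : vertex Q) : vertex Q -> Type :=
| qpath_nil : qpath v v
| qpath_snoc (a : arrow Q) : qpath v (source a) -> qpath v (target a).

Definition is_root (T : quiver) (v0 : vertex T) : Prop :=
  forall w, exists p : qpath v0 w, forall q : qpath v0 w, q = p.

Definition is_tree (T : quiver) : Prop := exists v0 : vertex T, is_root v0.

Section Components.
Variable Q : quiver.

Definition linked : vertex Q -> vertex Q -> Prop :=
  clos_refl_sym_trans (vertex Q)
    (fun v w => exists a : arrow Q, source a = v /\ target a = w).

Lemma linked_target v (a : arrow Q) : linked v (source a) -> linked v (target a).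
Proof. by move=> h; apply: rst_trans h _; apply: rst_step; exists a. Qed.

Variable v : vertex Q.

Definition comp_vertex : choiceType := {w : vertex Q | `[< linked v w >]}.
Definition comp_arrow : choiceType := {a : arrow Q | `[< linked v (source a) >]}.

Definition comp_source (a : comp_arrow) : comp_vertex :=
  exist _ (source (val a)) (valP a).
Definition comp_target (a : comp_arrow) : comp_vertex :=
  exist _ (target (val a)) (asboolT (linked_target (asboolW (valP a)))).

Definition component : quiver := Quiver comp_source comp_target.

End Components.

Definition is_forest (Q : quiver) : Prop :=
  forall v : vertex Q, is_tree (component v).

Fixpoint level (T : quiver) (v0 : vertex T) (i : nat) : set (vertex T) :=
  if i is j.+1 then
    [set w | exists a : arrow T, level v0 j (source a) /\ target a = w]
  else [set v0].

(* [level v0 i] is the set V_(i+1), and [n i] its cardinality *)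
Definition barren_tree (T : quiver) : Prop :=
  exists (v0 : vertex T) (n : nat -> nat),
    [/\ is_root v0,
        forall i, (level v0 i #= `I_(n i))%card
      & exists k, forall i, n (k + i)%N = n k].

Section Representations.
Variables (Q : quiver) (R : pzRingType).

Record rep := Rep {
  rep_obj :> vertex Q -> lmodType R;
  rep_map : forall a : arrow Q, {linear rep_obj (source a) -> rep_obj (target a)} }.

Record rep_hom (X Y : rep) := RepHom {
  rep_comp :> forall v, {linear X v -> Y v};
  rep_natural : forall (a : arrow Q) (x : X (source a)),
    rep_comp (target a) (rep_map X a x) = rep_map Y a (rep_comp (source a) x) }.

Fixpoint rep_path (X : rep) (v w : vertex Q) (p : qpath v w) : X v -> X w :=
  match p in qpath _ w return X v -> X w with
  | qpath_nil => fun x => x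
  | qpath_snoc a q => fun x => rep_map X a (@rep_path X _ _ q x)
  end.

Arguments rep_path X {v w} p x.

Lemma rep_hom_path (X Y : rep) (f : rep_hom X Y) v w (p : qpath v w) (x : X v) :
  f w (rep_path X p x) = rep_path Y p (f v x).
Proof. by elim: p => //= a q <-; rewrite rep_natural. Qed.

Program Definition rep_id (X : rep) : rep_hom X X :=
  @RepHom X X (fun v => idfun) _.

Definition rep_mono (X Y : rep) (f : rep_hom X Y) : Prop :=
  forall v, injective (f v).

Definition rep_exact_at (X Y Z : rep) (f : rep_hom X Y) (g : rep_hom Y Z) : Prop :=
  forall v, exact_at (f v) (g v).

Definition injective_rep (E : rep) : Prop :=
  forall (A B : rep) (i : rep_hom A B) (g : rep_hom A E), rep_mono i ->
    exists h : rep_hom B E, forall v x, h v (i v x) = g v x.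

End Representations.

Arguments rep_path {Q R} X {v w} p x.
Arguments rep_id {Q R} X.

Section PathTensor.
Variables (Q : quiver) (R : pzRingType).

(* A right [RQ]-module is a representation of [opposite Q] by right
   [R]-modules; a path from [v] to [w] in [Q] acts on it from [w] to [v]. *)
Local Notation rrep := (rep (opposite Q) R^c).

Fixpoint rrep_path (E : rrep) (v w : vertex Q) (p : qpath v w) : E w -> E v :=
  match p in qpath _ w return E w -> E v with
  | qpath_nil => fun x => x
  | qpath_snoc a q => fun x => @rrep_path E _ _ q (rep_map E a x)
  end.

Arguments rrep_path E {v w} p x.

Lemma rrep_hom_path (E E' : rrep) (f : rep_hom E E') (v w : vertex Q)
    (p : qpath v w) (x : E w) :
  f v (rrep_path E p x) = rrep_path E' p (f w x).
Proof.
elim: p x => //= a q IH x.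
by rewrite IH; congr (rrep_path _ _ _); exact: (rep_natural f (a := a)).
Qed.

(* [E (x)_RQ M] is presented on the symbols [x (x) y] with [x], [y] living at
   the same vertex [v]: with [e_v] the idempotent of [v], [x e_v (x) e_w y] is
   zero for [v <> w], and unitary [RQ]-modules are direct sums of the [e_v y]. *)
Definition path_tensor_gen (E : rrep) (M : rep Q R) : choiceType :=
  {v : vertex Q & (E v * M v)%type}.

Definition pgen (E : rrep) (M : rep Q R) v (x : E v) (y : M v) :
  {freeg (path_tensor_gen E M)} :=
  << (existT _ v (x, y) : path_tensor_gen E M) >>.

(* [path_tensor_bal] ranges over the elements [r p] ([r] a scalar, [p] a path),
   which span the path algebra [RQ] additively: [x (r p) (x) y = x (x) (r p) y]. *)
Inductive path_tensor_rel (E : rrep) (M : rep Q R) :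
    {freeg (path_tensor_gen E M)} -> Prop :=
| path_tensor_addl v (x x' : E v) (y : M v) :
    path_tensor_rel (pgen (x + x') y - pgen x y - pgen x' y)
| path_tensor_addr v (x : E v) (y y' : M v) :
    path_tensor_rel (pgen x (y + y') - pgen x y - pgen x y')
| path_tensor_bal (r : R) (v w : vertex Q) (p : qpath v w) (x : E w) (y : M v) :
    path_tensor_rel (pgen (rrep_path E p ((r : R^c) *: x)) y
                     - pgen x (r *: rep_path M p y)).

Definition path_tensor (E : rrep) (M : rep Q R) : lmodType int :=
  quotmod (@path_tensor_rel E M).

Section Map.
Variables (E E' : rrep) (M M' : rep Q R).
Variables (f : rep_hom E E') (g : rep_hom M M').

Definition path_tensor_gen_map :
    {linear {freeg (path_tensor_gen E M)} -> {freeg (path_tensor_gen E' M')}} :=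
  fglift_lin (fun z : path_tensor_gen E M =>
    pgen (f (tag z) (tagged z).1) (g (tag z) (tagged z).2)).

Lemma path_tensor_gen_mapE v (x : E v) (y : M v) :
  path_tensor_gen_map (pgen x y) = pgen (f v x) (g v y).
Proof. exact: fglift_linE. Qed.

Lemma path_tensor_gen_mapP u :
  path_tensor_rel u -> submod_gen (@path_tensor_rel E' M') (path_tensor_gen_map u).
Proof.
case=> [v x x' y|v x y y'|r v w p x y];
  rewrite !linearB !path_tensor_gen_mapE; apply: submod_gen1.
- by rewrite linearD; exact: path_tensor_addl.
- by rewrite linearD; exact: path_tensor_addr.
- by rewrite rrep_hom_path !linearZ_LR rep_hom_path; exact: path_tensor_bal.
Qed.

Definition path_tensor_map : {linear path_tensor E M -> path_tensor E' M'} :=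
  quotmod_lin path_tensor_gen_mapP.
End Map.

Definition flat_rep (M : rep Q R) : Prop :=
  forall (A B : rrep) (i : rep_hom A B),
    rep_mono i -> injective (path_tensor_map i (rep_id M)).

Definition gorenstein_flat_rep (M : rep Q R) : Prop :=
  exists (F : int -> rep Q R) (d : forall n, rep_hom (F n) (F (n + 1)))
         (k : rep_hom M (F 0)),
    [/\ forall n, flat_rep (F n),
        forall n, rep_exact_at (d n) (d (n + 1)),
        rep_mono k /\ rep_exact_at k (d 0)
      & forall E : rrep, injective_rep E -> forall n,
          exact_at (path_tensor_map (rep_id E) (d n))
                   (path_tensor_map (rep_id E) (d (n + 1)))].

Section Incoming.
Variables (M : rep Q R) (v : vertex Q).

Definition incoming : choiceType := {a : arrow Q | target a == v}.

Definition incoming_sum : lmodType R :=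
  dsum (fun a : incoming => M (source (val a))).

Definition incoming_map (a : incoming) : {linear M (source (val a)) -> M v} :=
  ecast w {linear M (source (val a)) -> M w} (eqP (valP a)) (rep_map M (val a)).

Definition rep_f : {linear incoming_sum -> M v} := dsum_desc incoming_map.

Definition rep_C : lmodType R := coker rep_f.

End Incoming.

End PathTensor.

Arguments rrep_path {Q R} E {v w} p x.

(* Main.v *)
From HB Require Import structures.
From Stdlib Require Import Relation_Operators.
From mathcomp Require Import all_boot all_algebra.
From mathcomp Require Import boolp classical_sets cardinality.
From mathcomp Require Import freeg.
Require Import Defs.

(* Write [X^+] for the character module Hom_Z(X, Q/Z).  Since Hom_Z(E (x) M, Q/Z) is
   Hom(M, E^+) and also Hom(E, M^+), a module or representation is flat iff its dual is
   injective, and [E (x) -] keeps a complex exact iff Hom(-, E^+) does: all conditions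
   become extension problems for maps into duals.

   Let F be a complete flat resolution of M.  Tensoring with F(v), resp. with the
   cokernel C(v) of F, amounts to tensoring F with a right representation that is constant
   on the ancestors of v, resp. concentrated at v.  Such a representation is the kernel of
   an epimorphism between two injective ones, constant on sets of vertices closed under
   descendants, and as F is flat the long exact sequence gives the exactness.

   Conversely, let all f_v be injective with Gorenstein flat cokernels C(v).  As
   Ext^1(C(v), E^+) = 0 for E injective, maps into E^+ extend along every arrow, hence
   from the root to the whole tree.  Embedding each C(v) in some flat X(v) = E(v)^+
   (R is right noetherian) one thus embeds M in the flat representation that is
   the sum of the X(w), w ancestor of v, at v; the quotient is of the same kind.  Iterating,
   and resolving M by free representations on the other side, gives a complete flat
   resolution.  Its exactness under [E (x) -] is again Ext^1(M, E^+) = 0. *)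

Set Implicit Arguments.
Unset Strict Implicit.
Unset Printing Implicit Defensive.

(** The flat module containing C(v) has to be a dual E^+ with E injective, because only maps into
    such modules are known to extend along the arrows. A complete resolution supplies just some flat
    module Y, so Y is replaced by its bidual (Y^+)^+: here Y^+ is injective because Y is flat, and
    the bidual is flat because R is right noetherian. The price is that the new cokernel is no
    longer a cycle of a complete flat resolution, but an extension of the flat module Y^++/Y by such
    a cycle. The iteration to the right therefore keeps this larger class as its invariant, and a
    pushout turns such an extension into a submodule of a flat module again.

    To the left, kernels of free covers require the vanishing of higher Ext groups. No Ext group is
    constructed: the invariant is the vanishing of Ext^1 against the duals of all iterated syzygies
    of injective modules, which is stable under passing to kernels. The two invariants meet only at
    M, where both hold. *)

Import GRing.Theory Num.Theory.

Local Open Scope ring_scope.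

(** * Linear maps, submodules and kernels *)

Definition linear_pack (R : pzRingType) (A B : lmodType R) (f : A -> B)
    (hf : linear f) : {linear A -> B} :=
  HB.pack f (GRing.isLinear.Build R A B _ f hf).

(** Choice turns a linear graph into a map. As the graph is closed under linear combinations,
    single-valuedness need only be checked at [0]. *)
Lemma linear_of_rel (R : pzRingType) (A B : lmodType R) (G : A -> B -> Prop) :
    (forall a x x' y y', G x y -> G x' y' -> G (a *: x + x') (a *: y + y')) ->
    (forall y, G 0 y -> y = 0) -> (forall x, exists y, G x y) ->
  exists f : {linear A -> B}, forall x, G x (f x).
Proof.
move=> Glin G0 Gtot; have [f fP] := choice Gtot.
have Guniq x y y' : G x y -> G x y' -> y = y'.
  move=> h h'; have := Glin (-1) _ _ _ _ h h'.
  rewrite !scaleN1r addNr => /G0 /eqP; rewrite addrC subr_eq0 => /eqP -> //.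
have flin : linear f by move=> a x y; apply: Guniq (fP _) _; exact: Glin.
by exists (linear_pack flin).
Qed.

Lemma linear_inj (R : pzRingType) (A B : lmodType R) (f : {linear A -> B}) :
  (forall x, f x = 0 -> x = 0) -> injective f.
Proof. exact: raddf_inj. Qed.

Lemma inj_eq0 (R : pzRingType) (A B : lmodType R) (f : {linear A -> B}) x :
  injective f -> f x = 0 -> x = 0.
Proof. by move=> finj; rewrite -(linear0 f) => /finj. Qed.

Lemma factor_surj (R : pzRingType) (A B C : lmodType R) (q : {linear A -> B})
    (g : {linear A -> C}) :
    (forall y, exists x, q x = y) -> (forall x, q x = 0 -> g x = 0) ->
  exists h : {linear B -> C}, forall x, h (q x) = g x.
Proof.
move=> qs qg.
have [|y [x [q0 <-]]|y|h hP] := @linear_of_rel R B C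
  (fun y z => exists x, q x = y /\ g x = z).
- move=> a _ _ _ _ [x [<- <-]] [x' [<- <-]].
  by exists (a *: x + x'); rewrite !linearP.
- exact: qg.
- by have [x <-] := qs y; exists (g x), x.
exists h => x; have [x' [e <-]] := hP (q x).
by apply/eqP; rewrite -subr_eq0 -linearB; apply/eqP/qg; rewrite linearB e subrr.
Qed.

Lemma factor_inj (R : pzRingType) (A B C : lmodType R) (i : {linear A -> B})
    (g : {linear C -> B}) :
    injective i -> (forall x, exists y, i y = g x) ->
  exists h : {linear C -> A}, forall x, i (h x) = g x.
Proof.
move=> ii ig; apply: (@linear_of_rel R C A (fun x y => i y = g x)) => //.
- by move=> a x x' y y' e e'; rewrite !linearP e e'.
- by move=> y; rewrite linear0; exact: inj_eq0.
Qed.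

Section SubmoduleType.
Variables (R : pzRingType) (V : lmodType R) (P : V -> Prop).

Definition submod : Type := {x : V | x \in submod_genb P}.

HB.instance Definition _ := [isSub of submod for @sval _ _].
HB.instance Definition _ := [Choice of submod by <:].
HB.instance Definition _ := [SubChoice_isSubZmodule of submod by <:].
HB.instance Definition _ := [SubZmodule_isSubLmodule of submod by <:].

Definition submod_val : submod -> V := \val.
HB.instance Definition _ := GRing.Linear.on submod_val.

Lemma submod_valP (x : submod) : submod_gen P (submod_val x).
Proof. by have := valP x; rewrite unfold_in => /asboolP. Qed.

Lemma submod_ex (x : V) : submod_gen P x -> exists y, submod_val y = x.
Proof. by move=> /asboolP h; exists (exist _ x h). Qed.
End SubmoduleType.

Lemma submod_gen_min (R : pzRingType) (V : lmodType R) (P : V -> Prop) x :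
    P 0 -> (forall a u v, P u -> P v -> P (a *: u + v)) ->
  submod_gen P x -> P x.
Proof. by move=> P0 PD; elim=> // a u v Pu _ Pv; apply: PD. Qed.

Lemma submod_gen_mono (R : pzRingType) (V : lmodType R) (P P' : V -> Prop) x :
  (forall y, P y -> submod_gen P' y) -> submod_gen P x -> submod_gen P' x.
Proof.
move=> PP'; elim=> [|a u v Pu _ h]; first by left.
by apply: submod_genD => //; apply/submod_genZ/PP'.
Qed.

Section Kernel.
Variables (R : pzRingType) (A B : lmodType R) (f : {linear A -> B}).

Definition kernel : lmodType R := submod (fun x => f x = 0).
Definition kernel_val : {linear kernel -> A} := @submod_val _ _ _.

Lemma kernel_valP x : f (kernel_val x) = 0.
Proof.
have := submod_valP x; apply: (@submod_gen_min _ _ (fun y => f y = 0)).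
  exact: linear0.
by move=> a u v fu fv; rewrite linearP fu fv scaler0 addr0.
Qed.

Lemma kernel_val_inj : injective kernel_val. Proof. exact: val_inj. Qed.

Lemma kernel_exact : exact_at kernel_val f.
Proof.
move=> y; split=> [fy|[x <-]]; last exact: kernel_valP.
by apply: submod_ex; apply: submod_gen1.
Qed.
End Kernel.

Lemma quotmod_desc (R : pzRingType) (V W : lmodType R) (P : V -> Prop)
    (f : {linear V -> W}) : (forall x, P x -> f x = 0) ->
  exists h : {linear quotmod P -> W}, forall x, h (quotmod_proj P x) = f x.
Proof.
move=> Pf; apply: factor_surj; first exact: quotmod_surj.
move=> x; rewrite -(linear0 (quotmod_proj P)) => /quotmod_projP; rewrite subr0.
elim=> [|a u v Pu _ IH]; first exact: linear0.
by rewrite linearP IH Pf // scaler0 addr0.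
Qed.

Lemma quotmod_proj0 (R : pzRingType) (V : lmodType R) (P : V -> Prop) x :
  quotmod_proj P x = 0 <-> submod_gen P x.
Proof.
by rewrite -[in _ = 0](linear0 (quotmod_proj P)) quotmod_projP subr0.
Qed.

Lemma submod_gen_range (R : pzRingType) (A B : lmodType R) (f : {linear A -> B}) y :
  submod_gen (range f) y <-> exists x, f x = y.
Proof.
split=> [|[x <-]]; last by apply: submod_gen1; exists x.
elim=> [|a u v [x _ <-] _ [z <-]]; first by exists 0; rewrite linear0.
by exists (a *: x + z); rewrite linearP.
Qed.

Lemma coker_exact (R : pzRingType) (A B : lmodType R) (f : {linear A -> B}) :
  exact_at f (coker_proj f).
Proof.
move=> y; rewrite /coker_proj /=; apply: iff_trans (quotmod_proj0 _ _) _.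
exact: submod_gen_range.
Qed.

(** * The group Q/Z *)

Definition additive_pack (A B : zmodType) (f : A -> B) (hf : zmod_morphism f) :
    {additive A -> B} := HB.pack f (GRing.isZmodMorphism.Build A B f hf).

(** Euclidean division by the least positive element; [m = 0] covers the zero subgroup. It will be
    applied to the multiples of an element lying in a given domain, and to annihilators. *)
Lemma int_subgroup_principal (I : int -> Prop) :
    I 0 -> (forall m n, I m -> I n -> I (m - n)) ->
  exists m, I m /\ forall n, I n -> exists q, n = q * m.
Proof.
move=> I0 IB; have IN n : I n -> I (- n) by move=> /(IB _ _ I0); rewrite sub0r.
have IM n q : I n -> I (q * n).
  move=> In; have Ik (k : nat) : I (k%:Z * n).
    elim: k => [|k IH]; first by rewrite mul0r.
    by have := IB _ _ IH (IN _ In); rewrite opprK -addn1 PoszD mulrDl mul1r.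
  case: q => k; first exact: Ik.
  by rewrite NegzE mulNr; apply/IN/Ik.
have [[n [In n0]]|none] := pselect (exists n, I n /\ n != 0); last first.
  exists 0; split=> // n In; exists 0; rewrite mul0r.
  by apply/eqP; apply/negP => n0; apply: none; exists n; split=> //; exact/negP.
have ex : exists k : nat, `[< I k.+1%:Z >].
  case: n In n0 => [[|k]|k] In // _; first by exists k; apply/asboolP.
  by exists k; apply/asboolP; have := IN _ In; rewrite NegzE opprK.
case: (ex_minnP ex) => m /asboolP Im min.
exists m.+1%:Z; split=> // l Il; exists (l %/ m.+1)%Z.
have Ir : I (l %% m.+1)%Z by rewrite /modz; apply: IB => //; exact: IM.
have r0 : (0 <= l %% m.+1)%Z by apply: modz_ge0.
have rm : (l %% m.+1 < m.+1)%Z by apply: ltz_pmod.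
rewrite [LHS](divz_eq l m.+1).
case: (l %% m.+1)%Z Ir r0 rm => [[|k]|//] Ir _ rm; first by rewrite addr0.
have /min : `[< I k.+1%:Z >] by apply/asboolP.
by move: rm; rewrite ltz_nat ltnS => h /(leq_trans h); rewrite ltnn.
Qed.

Section CircleGroup.

Definition rat_int (x : zmodule rat) : Prop := exists n : int, x = n%:~R.

Definition circ : zmodType := quotmod rat_int.
Definition to_circ : {additive zmodule rat -> circ} := quotmod_proj rat_int.

Lemma to_circ_surj (d : circ) : exists x, to_circ x = d.
Proof. exact: quotmod_surj. Qed.

Lemma to_circ0 x : to_circ x = 0 <-> exists n : int, x = n%:~R.
Proof.
apply: iff_trans (quotmod_proj0 _ _) _; split; last exact: submod_gen1.
apply: (@submod_gen_min _ _ rat_int); first by exists 0.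
move=> a _ _ [m ->] [n ->]; exists (a * m + n).
by rewrite rmorphD /= rmorphM /= scalezrE mulrzl.
Qed.

Lemma circ_divisible (d : circ) (n : int) : n != 0 -> exists e : circ, e *~ n = d.
Proof.
move=> n0; have [x <-] := to_circ_surj d.
exists (to_circ (x / n%:~R : rat)); rewrite -raddfMz; congr (to_circ _).
by rewrite -[LHS](@mulrzr rat) mulfVK // intr_eq0.
Qed.

(** Baer's argument: a maximal partial graph extending [g] is total, since divisibility of Q/Z
    allows one more point. The condition on kernels replaces injectivity of [i]. *)
Lemma circ_injective (A B : zmodType) (i : {additive A -> B}) (g : {additive A -> circ}) :
    (forall x, i x = 0 -> g x = 0) ->
  exists h : {additive B -> circ}, forall x, h (i x) = g x.
Proof.
(* The last clause is conditional so that the empty set, which is the union of the empty chain, is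
   admissible. *)
move=> ig; pose P (G : set (B * circ)) := [/\ forall p q, G p -> G q -> G (p - q),
  forall y, G (0, y) -> y = 0 & forall p, G p -> forall a, G (i a, g a)].
have [F FP Ftot|G [[GB G0 Gb] Gmax]] := @Zorn_bigcup _ P.
  split.
  - move=> p q [X FX Xp] [Y FY Yq].
    have [XY|YX] := Ftot _ _ FX FY.
      by exists Y => //; have [+ _ _] := FP _ FY; apply=> //; exact: XY.
    by exists X => //; have [+ _ _] := FP _ FX; apply=> //; exact: YX.
  - by move=> y [X FX]; have [_ + _] := FP _ FX; apply.
  - by move=> p [X FX Xp] a; exists X => //; have [_ _ h] := FP _ FX; exact: h Xp a.
pose base : set (B * circ) := fun p => exists a, p = (i a, g a).
have Pbase : P base.
  split; first by move=> _ _ [a ->] [b ->]; exists (a - b); rewrite !raddfB.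
    by move=> y [a [/esym/ig ga ->]].
  by move=> _ _ a; exists a.
have Gig a : G (i a, g a).
  have [[p /Gb //]|none] := pselect (exists p, G p).
  exfalso; apply: (Gmax base) => //; split.
    by move=> p Gp; case: none; exists p.
  by move=> /(_ (i 0, g 0)) h; apply: none; exists (i 0, g 0); apply: h; exists 0.
have G00 : G (0, 0) by have := Gig 0; rewrite !raddf0.
have GN p : G p -> G (- p) by move=> /(GB _ _ G00); rewrite sub0r.
have GD p q : G p -> G q -> G (p + q).
  by move=> Gp /GN Gq; have := GB _ _ Gp Gq; rewrite opprK.
have GZ p n : G p -> G (p *~ n).
  move=> Gp; have Gk (k : nat) : G (p *+ k).
    by elim: k => [//|k IH]; rewrite mulrSr; exact: GD.
  case: n => k; first by rewrite -pmulrn.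
  by rewrite NegzE mulrNz -pmulrn; exact/GN/Gk.
have pairMz (x : B) (y : circ) n : (x, y) *~ n = (x *~ n, y *~ n).
  have e (k : nat) : (x, y) *+ k = (x *+ k, y *+ k).
    by elim: k => [|k IH]; rewrite ?mulr0n // !mulrS IH.
  by case: n => k; rewrite ?NegzE ?mulrNz -!pmulrn e.
have Gfun x y y' : G (x, y) -> G (x, y') -> y = y'.
  move=> h h'; apply/eqP; rewrite -subr_eq0; apply/eqP/G0.
  by have := GB _ _ h h'; rewrite -[(x, y) - _]/(x - x, y - y') subrr.
have Gtot b : exists y, G (b, y).
  have [//|nb] := pselect (exists y, G (b, y)); exfalso.
  (* The value at the new point [b] must agree with [G] on the multiples of [b] in its domain. These
     are the multiples of a single [b *~ m], so [d] is the value there divided by [m], or [0] if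
     [m = 0]. *)
  have [d dP] : exists d, forall n y, G (b *~ n, y) -> y = d *~ n.
    have [|m n [y Gy] [z Gz]|m [[y Gy] mP]] :=
      @int_subgroup_principal (fun n => exists y, G (b *~ n, y)).
    - by exists 0; rewrite mulr0z.
    - by exists (y - z); rewrite mulrzBr; exact: (GB _ _ Gy Gz).
    have [m0|m0] := eqVneq m 0.
      exists 0 => n z Gz; have [|q e] := mP n; first by exists z.
      by rewrite mul0rz; apply: G0; move: Gz; rewrite e m0 mulr0 mulr0z.
    have [d dy] := circ_divisible y m0.
    exists d => n z Gz; have [|q e] := mP n; first by exists z.
    move: Gz; rewrite e mulrC !mulrzA dy => Gz; apply: Gfun Gz _.
    by have := GZ _ q Gy; rewrite pairMz.
  pose G' : set (B * circ) := fun p => exists q n, G q /\ p = q + (b, d) *~ n.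
  apply: (Gmax G').
    split; first by move=> p Gp; exists p, 0; rewrite mulr0z addr0.
    move=> /(_ (b, d)) h; apply: nb; exists d; apply: h.
    by exists 0, 1; split=> //; rewrite add0r.
  split.
  - move=> _ _ [p [m [Gp ->]]] [q [n [Gq ->]]]; exists (p - q), (m - n).
    by split; [exact: GB|rewrite mulrzBr opprD addrACA].
  - move=> y [[p z] [n [Gp]]]; rewrite pairMz => -[/esym e ->].
    move/eqP: e; rewrite addrC addr_eq0 => /eqP e.
    have := GN _ Gp; rewrite -[- (p, z)]/(- p, - z) -e => /dP <-.
    by rewrite subrr.
  - by move=> _ _ a; exists (i a, g a), 0; rewrite mulr0z addr0.
have [h hP] := choice Gtot.
have hB : zmod_morphism h.
  by move=> x y; apply: Gfun (hP _) _; exact: (GB _ _ (hP x) (hP y)).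
exists (additive_pack hB) => x /=.
exact: Gfun (hP _) (Gig x).
Qed.

Lemma circ_cogenerator (A : zmodType) (z : A) :
  z <> 0 -> exists h : {additive A -> circ}, h z <> 0.
Proof.
move=> z0.
have [||m [zm mP]] := @int_subgroup_principal (fun n => z *~ n = 0).
- exact: mulr0z.
- by move=> k l ek el; rewrite mulrzBr ek el subrr.
pose i (n : zmodule int) : A := z *~ n.
have iB : zmod_morphism i by move=> k l; rewrite /i mulrzBr.
pose iA : {additive zmodule int -> A} := additive_pack iB.
(* The annihilator of [z] is generated by [m]. If [m = 0], the cyclic group of [z] is infinite and
   any non-integral value is allowed at [z]; otherwise [1/m] is killed by [m], and it is not an
   integer because [z] is nonzero. *)
pose u : rat := if m == 0 then 2%:R^-1 else m%:~R^-1.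
pose g (n : zmodule int) : circ := to_circ u *~ n.
have gB : zmod_morphism g by move=> k l; rewrite /g mulrzBr.
pose gA : {additive zmodule int -> circ} := additive_pack gB.
have [n /mP [q ->]|h hP] := @circ_injective _ _ iA gA.
  rewrite /= /g /u; have [->|m0] := eqVneq m 0; first by rewrite mulr0 mulr0z.
  rewrite -raddfMz; apply/to_circ0; exists q.
  by rewrite -[LHS](@mulrzl rat) rmorphM /= mulfK // intr_eq0.
exists h; have := hP 1; rewrite /= /i /g !mulr1z => ->.
move=> /to_circ0[n]; rewrite /u; have [m0|m0] := eqVneq m 0.
  move=> e; have : (1 : rat) = (n * 2)%:~R by rewrite rmorphM /= -e mulVf.
  move=> /(@intr_inj rat 1) e1; have : (2 %| 1)%Z by apply/dvdzP; exists n.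
  by [].
move=> e; have : (1 : rat) = (n * m)%:~R by rewrite rmorphM /= -e mulVf // intr_eq0.
move=> /(@intr_inj rat 1) e1; apply: z0.
by rewrite -[z]mulr1z e1 mulrC mulrzA zm mul0rz.
Qed.

End CircleGroup.

(** * Character modules *)

(** Dualising exchanges left and right modules. With an anti-homomorphism as parameter, one
    construction serves both directions; its instances [opc] and [opv] are identity maps, and
    [(R^c)^c] need not be identified with [R]. *)
Record antihom (S R : pzRingType) := AntiHom {
  anti_fun :> S -> R;
  antiD : forall a b, anti_fun (a + b) = anti_fun a + anti_fun b;
  antiM : forall a b, anti_fun (a * b) = anti_fun b * anti_fun a;
  anti1 : anti_fun 1 = 1 }.

Section CharacterModule.
Variables (S R : pzRingType) (c : antihom S R) (M : lmodType R).

(* Hom_Z(M, Q/Z); [c] is recorded because it determines the scalar action. *)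
Definition cdual : Type :=
  let _ := c in {f : M -> circ | `[< zmod_morphism f >]}.
Local Notation D := cdual.

HB.instance Definition _ := gen_eqMixin D.
HB.instance Definition _ := gen_choiceMixin D.

Definition cdual_fun (f : D) : M -> circ := sval f.

Lemma cdual_fun_zmod (f : D) : zmod_morphism (cdual_fun f).
Proof. by case: f => f /= /asboolP. Qed.

HB.instance Definition _ (f : D) :=
  GRing.isZmodMorphism.Build M circ (cdual_fun f) (cdual_fun_zmod f).

Lemma cdualP (f g : D) : (forall x, cdual_fun f x = cdual_fun g x) -> f = g.
Proof. by move=> e; apply: val_inj; apply: funext. Qed.

Definition to_cdual (f : {additive M -> circ}) : D :=
  exist _ (f : M -> circ) (asboolT (fun x y => raddfB f x y)).

Definition cdual0 : D := to_cdual \0.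
Definition cdualN (f : D) : D := to_cdual (\- cdual_fun f).
Definition cdualD (f g : D) : D := to_cdual (cdual_fun f \+ cdual_fun g).

Lemma cdualZ_subproof (a : S) (f : D) : zmod_morphism (fun x => cdual_fun f (c a *: x)).
Proof. by move=> x y; rewrite scalerBr raddfB. Qed.
Definition cdualZ (a : S) (f : D) : D :=
  to_cdual (additive_pack (cdualZ_subproof a f)).

Lemma cdual_addA : associative cdualD.
Proof. by move=> x y z; apply: cdualP => i /=; exact: addrA. Qed.
Lemma cdual_addC : commutative cdualD.
Proof. by move=> x y; apply: cdualP => i /=; exact: addrC. Qed.
Lemma cdual_add0 : left_id cdual0 cdualD.
Proof. by move=> x; apply: cdualP => i /=; exact: add0r. Qed.
Lemma cdual_addN : left_inverse cdual0 cdualN cdualD.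
Proof. by move=> x; apply: cdualP => i /=; exact: addNr. Qed.

HB.instance Definition _ :=
  GRing.isZmodule.Build D cdual_addA cdual_addC cdual_add0 cdual_addN.

Lemma cdual_scaleA a b x : cdualZ a (cdualZ b x) = cdualZ (a * b) x.
Proof. by apply: cdualP => i /=; rewrite /cdual_fun /= scalerA antiM. Qed.
Lemma cdual_scale1 : left_id 1 cdualZ.
Proof. by move=> x; apply: cdualP => i /=; rewrite {1}/cdual_fun /= anti1 scale1r. Qed.
Lemma cdual_scaleDr : right_distributive cdualZ +%R.
Proof. by move=> a x y; apply: cdualP. Qed.
Lemma cdual_scaleDl x : {morph cdualZ^~ x : a b / a + b}.
Proof.
by move=> a b; apply: cdualP => i; rewrite {1}/cdual_fun /= antiD scalerDl raddfD.
Qed.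

HB.instance Definition _ := GRing.Zmodule_isLmodule.Build S D
  cdual_scaleA cdual_scale1 cdual_scaleDr cdual_scaleDl.
End CharacterModule.

Section CharacterMap.
Variables (S R : pzRingType) (c : antihom S R).

Lemma cdualZE (M : lmodType R) a (f : cdual c M) x :
  cdual_fun (a *: f) x = cdual_fun f (c a *: x).
Proof. by []. Qed.

Lemma cdualPE (M : lmodType R) a (f g : cdual c M) x :
  cdual_fun (a *: f + g) x = cdual_fun f (c a *: x) + cdual_fun g x.
Proof. by []. Qed.

Section Map.
Variables (A B : lmodType R) (f : {linear A -> B}).

Definition cdual_map_fun (h : cdual c B) : cdual c A :=
  to_cdual c (cdual_fun h \o f).

Lemma cdual_map_linear : linear cdual_map_fun.
Proof. by move=> a g h; apply: cdualP => x; rewrite cdualPE /= -linearZ. Qed.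

Definition cdual_map : {linear cdual c B -> cdual c A} := linear_pack cdual_map_linear.

Lemma cdual_mapE h x : cdual_fun (cdual_map h) x = cdual_fun h (f x).
Proof. by []. Qed.

Lemma cdual_extend (g : cdual c A) :
    (forall x, f x = 0 -> cdual_fun g x = 0) ->
  exists h : cdual c B, cdual_map h = g.
Proof.
move=> fg; have [h hP] := @circ_injective _ _ f (cdual_fun g) fg.
by exists (to_cdual c h); apply: cdualP => x; exact: hP.
Qed.
End Map.

Lemma cdual_eq0 (A : lmodType R) (z : A) :
  (forall g : cdual c A, cdual_fun g z = 0) -> z = 0.
Proof.
move=> h; apply: contrapT => /circ_cogenerator[g]; apply.
exact: (h (to_cdual c g)).
Qed.

End CharacterMap.

Section Swap.
Variables (S R : pzRingType) (c : antihom S R) (c' : antihom R S).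
Hypothesis cK : cancel c c'.
Variables (M : lmodType R) (N : lmodType S) (f : {linear M -> cdual c' N}).

Lemma swap_subproof n : zmod_morphism (fun x => cdual_fun (f x) n).
Proof. by move=> x y; rewrite raddfB. Qed.

Definition swap_fun n : cdual c M := to_cdual c (additive_pack (swap_subproof n)).

Lemma swap_linear : linear swap_fun.
Proof.
move=> a m n; apply: cdualP => x; rewrite cdualPE.
rewrite -[LHS]/(cdual_fun (f x) (a *: m + n)) raddfD; congr (_ + _).
by rewrite -[RHS]/(cdual_fun (f (c a *: x)) m) linearZ_LR cdualZE cK.
Qed.

(** One direction of the adjunction Hom(M, N^+) = Hom(N, M^+): both sides are the balanced pairings
    of M and N with values in Q/Z. *)
Definition swap : {linear N -> cdual c M} := linear_pack swap_linear.

Lemma swapE n x : cdual_fun (swap n) x = cdual_fun (f x) n.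
Proof. by []. Qed.
End Swap.

(** * Injective and projective modules *)

Lemma injective_extend (R : pzRingType) (E A B : lmodType R) (i : {linear A -> B})
    (g : {linear A -> E}) : injective_module E -> (forall x, i x = 0 -> g x = 0) ->
  exists h : {linear B -> E}, forall x, h (i x) = g x.
Proof.
move=> injE ig; pose Q := quotmod (fun x => i x = 0).
have [i' i'P] : exists h : {linear Q -> B}, forall x, h (quotmod_proj _ x) = i x.
  exact: quotmod_desc.
have [g' g'P] : exists h : {linear Q -> E}, forall x, h (quotmod_proj _ x) = g x.
  exact: quotmod_desc.
have i'inj : injective i'.
  apply: linear_inj => z; have [x <-] := quotmod_surj z; rewrite i'P => ix.
  by apply/quotmod_proj0/submod_gen1.
have [h hP] := injE _ _ i' g' i'inj.
by exists h => x; rewrite -i'P hP g'P.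
Qed.

Lemma injective_retract (R : pzRingType) (E A : lmodType R) (i : {linear E -> A}) :
  injective_module E -> injective i ->
  exists r : {linear A -> E}, forall x, r (i x) = x.
Proof. by move=> injE; exact: injE _ _ i idfun. Qed.

Lemma injective_retractW (R : pzRingType) (E A : lmodType R) (i : {linear A -> E})
    (r : {linear E -> A}) :
  injective_module E -> (forall x, r (i x) = x) -> injective_module A.
Proof.
move=> injE ri B C j g jinj.
have [h hP] := injE _ _ j (i \o g) jinj.
by exists (r \o h) => x /=; rewrite hP /= ri.
Qed.

(** The sequence splits: [r] retracts [i], and [s] is the section of [p] with values in the kernel
    of [r]. Maps into [B] are then extended component by component. *)
Lemma injective_extension (R : pzRingType) (I B J : lmodType R)
    (i : {linear I -> B}) (p : {linear B -> J}) :
    injective i -> exact_at i p -> (forall z, exists y, p y = z) ->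
    injective_module I -> injective_module J -> injective_module B.
Proof.
move=> ii ip ps injI injJ.
have [r rP] := injective_retract injI ii.
have [s [ps' rs]] : exists s : {linear J -> B}, (forall z, p (s z) = z) /\
    (forall z, r (s z) = 0).
  have [||z|s sP] := @linear_of_rel R J B (fun z y => p y = z /\ r y = 0).
  - move=> a x x' y y' [e1 e2] [e1' e2']; rewrite !linearP e1 e1' e2 e2'.
    by rewrite scaler0 addr0.
  - by move=> y [/ip[x <-]]; rewrite rP => ->; exact: linear0.
  - have [y <-] := ps z; exists (y - i (r y)).
    rewrite !linearB rP subrr; split=> //.
    by rewrite (iffRL (ip (i (r y)))) ?subr0 //; exists (r y).
  by exists s; split=> z; have [] := sP z.
move=> X Y j g jinj.
have [h1 h1P] := injI _ _ j (r \o g) jinj.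
have [h2 h2P] := injJ _ _ j (p \o g) jinj.
exists ((i \o h1) \+ (s \o h2)) => x /=; rewrite h1P h2P /=.
apply/esym/eqP; rewrite -subr_eq0; apply/eqP.
set w := _ - _; have /ip[u uw] : p w = 0.
  rewrite /w linearB linearD ps' (iffRL (ip (i (r (g x))))); last by exists (r (g x)).
  by rewrite add0r subrr.
have : r w = 0 by rewrite /w linearB linearD rs rP addr0 subrr.
by rewrite -uw rP => ->; exact: linear0.
Qed.

Definition projective_module (R : pzRingType) (P : lmodType R) : Prop :=
  forall (A B : lmodType R) (q : {linear A -> B}) (f : {linear P -> B}),
    (forall y, exists x, q x = y) -> exists h : {linear P -> A}, forall x, q (h x) = f x.

(** Extending a map from [A] to [P^+] along [i] amounts to lifting its transpose from [P] to [A^+]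
    along the surjection from [B^+] to [A^+]. *)
Lemma projective_dual (S R : pzRingType) (c : antihom S R) (c' : antihom R S)
    (P : lmodType R) : cancel c c' -> cancel c' c ->
  projective_module P -> injective_module (cdual c P).
Proof.
move=> cK c'K projP A B i g ii.
have [|h hP] := projP _ _ (cdual_map c' i) (swap c'K g).
  by move=> f; apply: cdual_extend => x /(inj_eq0 ii) ->; rewrite raddf0.
exists (swap cK h) => a; apply: cdualP => x; rewrite swapE.
by rewrite -(cdual_mapE i) hP.
Qed.

(** * Direct sums and free modules *)

Section DirectSumTheory.
Variables (R : pzRingType) (I : choiceType) (F : I -> lmodType R).

Definition single_coef (i : I) (y : F i) (j : I) : F j :=
  if pselect (i = j) is left e then ecast k (F k) e y else 0.

Lemma single_coefE i y : @single_coef i y i = y.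
Proof.
by rewrite /single_coef; case: pselect => // e; rewrite (eq_axiomK e).
Qed.

Lemma single_coef0 i y j : i <> j -> @single_coef i y j = 0.
Proof. by rewrite /single_coef; case: pselect. Qed.

Lemma single_finite i (y : F i) :
  `[< finite_set [set j | single_coef y j <> 0] >].
Proof.
apply/asboolP; apply: sub_finite_set (finite_set1 i) => j /= h.
by apply: contrapT => ji; apply: h; apply: single_coef0 => e; apply: ji.
Qed.

Definition single i (y : F i) : dsum F := exist _ (single_coef y) (single_finite y).

Lemma single_linear i : linear (@single i).
Proof.
move=> a x y; apply: dsumP => j /=; rewrite /single_coef; case: pselect => [e|_].
  by case: _ / e.
by rewrite scaler0 addr0.
Qed.
HB.instance Definition _ i :=
  GRing.isLinear.Build R (F i) (dsum F) _ (@single i) (@single_linear i).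

Lemma singleZ i a (y : F i) : single (a *: y) = a *: single y.
Proof. exact: linearZ_LR. Qed.

Lemma coef_linear i : linear (fun x : dsum F => dsum_coef x i).
Proof. by []. Qed.
Definition coef i : {linear dsum F -> F i} := linear_pack (coef_linear i).

Lemma coefE i x : coef i x = dsum_coef x i. Proof. by []. Qed.

Lemma dsum_singleE (x : dsum F) : exists2 s : seq I,
  forall i, dsum_coef x i <> 0 -> i \in s & x = \sum_(i <- s) single (dsum_coef x i).
Proof.
have /finite_seqP[s hs] := dsum_fin x.
have sx i : dsum_coef x i <> 0 -> i \in undup s.
  by move=> h; rewrite mem_undup; move: (f_equal (fun A : set I => A i) hs) => /= <-.
exists (undup s) => //; apply: dsumP => j.
rewrite -[RHS](coefE j) raddf_sum /=.
have [js|js] := boolP (j \in undup s).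
  rewrite (big_rem j) //= single_coefE big_seq big1 ?addr0 // => i.
  rewrite mem_rem_uniq ?undup_uniq // inE => /andP[/eqP ij _].
  exact: single_coef0.
rewrite big_seq big1 => [|i si].
  by apply: contrapT => /sx h; move/negP: js.
by apply: single_coef0 => ij; move: js; rewrite -ij si.
Qed.

Lemma dsum_linear_ext (N : lmodType R) (f g : {linear dsum F -> N}) :
  (forall i y, f (single y) = g (single (y : F i))) -> forall x, f x = g x.
Proof.
by move=> fg x; have [s _ ->] := dsum_singleE x; rewrite !linear_sum; apply: eq_bigr.
Qed.

Lemma dsum_desc_single (N : lmodType R) (f : forall i, {linear F i -> N}) i (y : F i) :
  dsum_desc f (single y) = f i y.
Proof.
rewrite (@dsum_descE _ _ _ _ _ [:: i]) // => [|j] /=.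
  by rewrite big_seq1 single_coefE.
by rewrite inE => h; apply: contrapT => ji; apply: h; apply: single_coef0 => e;
  apply: ji; rewrite e.
Qed.

End DirectSumTheory.

Section FreeModule.
Variables (R : pzRingType) (X : choiceType).

Definition free_module : lmodType R := dsum (fun _ : X => R^o : lmodType R).

Lemma smul_linear (M : lmodType R) (x : M) : linear (fun r : R^o => (r : R) *: x).
Proof. by move=> a r s; rewrite scalerDl scalerA. Qed.
Definition smul (M : lmodType R) (x : M) : {linear R^o -> M} :=
  linear_pack (smul_linear x).

Lemma free_projective : projective_module free_module.
Proof.
move=> A B q f qs.
have [a aP] := choice (fun x : X => qs (f (single (F := fun=> R^o) (i := x) 1))).
exists (dsum_desc (fun x => smul (a x))) => z.
apply: (@dsum_linear_ext _ _ _ _ (q \o dsum_desc (fun x => smul (a x))) f) => x r /=.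
rewrite dsum_desc_single /= linearZ_LR aP -linearZ_LR; congr (f _).
rewrite -(@singleZ R X (fun=> R^o) x); congr (single _).
by rewrite -[LHS]/(r * 1) mulr1.
Qed.
End FreeModule.

Definition free_cover (R : pzRingType) (M : lmodType R) :
    {linear free_module R M -> M} :=
  dsum_desc (fun x : M => smul x).

Lemma free_cover_surj (R : pzRingType) (M : lmodType R) (y : M) :
  exists x, free_cover M x = y.
Proof.
exists (single (F := fun _ : M => R^o) (i := y) 1).
exact: etrans (dsum_desc_single (fun x : M => smul x) _) (scale1r _).
Qed.

(** * Characters of tensor products *)

Section CircleDetects.
Variables (A B C : lmodType int) (f : {linear A -> B}) (g : {linear B -> C}).

(** As Q/Z is an injective cogenerator, characters detect injectivity, and likewise exactness in
    [circ_exact]. Questions on tensor products thus become extension problems for maps out of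
    them. *)
Lemma circ_inj :
  injective f <-> forall h : {additive A -> circ}, exists h' : {additive B -> circ},
                  forall x, h' (f x) = h x.
Proof.
split=> [fi h|fh].
  by apply: circ_injective => x /(inj_eq0 fi) ->; rewrite raddf0.
apply: linear_inj => x fx; apply: contrapT => /circ_cogenerator[h]; apply.
by have [h' <-] := fh h; rewrite fx raddf0.
Qed.

Lemma circ_exact : (forall x, g (f x) = 0) ->
  exact_at f g <-> forall h : {additive B -> circ}, (forall x, h (f x) = 0) ->
     exists h' : {additive C -> circ}, forall y, h' (g y) = h y.
Proof.
move=> gf; split=> [fg h hf|fg y].
  by apply: circ_injective => y /fg[x <-].
split=> [gy|[x <-]//]; apply/submod_gen_range/quotmod_proj0.
apply: contrapT => /circ_cogenerator[h]; apply.
have [|h' h'P] := fg (h \o quotmod_proj (range f)).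
  move=> x /=; rewrite (_ : quotmod_proj _ _ = 0) ?raddf0 //.
  by apply/quotmod_proj0/submod_gen_range; exists x.
by rewrite -[LHS]/((h \o quotmod_proj (range f)) y) -h'P gy raddf0.
Qed.
End CircleDetects.

Lemma freeg_additive_ext (K : choiceType) (G : zmodType)
    (f g : {additive {freeg K} -> G}) :
  (forall z, f << z >> = g << z >>) -> forall D, f D = g D.
Proof.
move=> fg D; rewrite -(freeg_sumE D) !raddf_sum; apply: eq_bigr => z _.
by rewrite -[coeff z D]intz -freegU_mulz !raddfMz fg.
Qed.

Lemma quotmod_additive_ext (K : choiceType) (G : zmodType) (P : {freeg K} -> Prop)
    (f g : {additive quotmod P -> G}) :
  (forall z, f (quotmod_proj P << z >>) = g (quotmod_proj P << z >>)) ->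
  forall t, f t = g t.
Proof.
move=> fg t; have [D <-] := quotmod_surj t.
exact: (@freeg_additive_ext _ _ (f \o quotmod_proj P) (g \o quotmod_proj P)).
Qed.

Lemma freeg_quot_desc (K : choiceType) (P : {freeg K} -> Prop) (b : K -> circ) :
    (forall u, P u -> fglift_lin (b : K -> zmodule circ) u = 0) ->
  exists h : {additive quotmod P -> circ}, forall z, h (quotmod_proj P << z >>) = b z.
Proof.
move=> Pb; have [h hP] := quotmod_desc Pb.
have hB : zmod_morphism (h : quotmod P -> circ) by move=> x y; exact: linearB.
by exists (additive_pack hB) => z; rewrite /= hP fglift_linE.
Qed.

Definition opc (R : pzRingType) : antihom R R^c :=
  @AntiHom R R^c (fun x => x) (fun _ _ => erefl) (fun _ _ => erefl) erefl.
Definition opv (R : pzRingType) : antihom R^c R :=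
  @AntiHom R^c R (fun x => x) (fun _ _ => erefl) (fun _ _ => erefl) erefl.

Lemma opcK (R : pzRingType) : cancel (opc R) (opv R). Proof. by []. Qed.
Lemma opvK (R : pzRingType) : cancel (opv R) (opc R). Proof. by []. Qed.

Section TensorCharacters.
Variable R : pzRingType.

Definition pure (E : lmodType R^c) (M : lmodType R) (x : E) (y : M) : tensor E M :=
  quotmod_proj (@tensor_rel R E M) << (x, y) >>.

Lemma tensor_mapE (E E' : lmodType R^c) (M M' : lmodType R)
    (f : {linear E -> E'}) (g : {linear M -> M'}) x y :
  tensor_map f g (pure x y) = pure (f x) (g y).
Proof.
refine (etrans (quotmod_mapE (@tensor_gen_mapP _ _ _ _ _ f g) _) _).
refine (congr1 (quotmod_proj (@tensor_rel R E' M')) _); exact: fglift_linE.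
Qed.

Section Pure.
Variables (E : lmodType R^c) (M : lmodType R).

Lemma pureDl (x x' : E) (y : M) : pure (x + x') y = pure x y + pure x' y.
Proof.
apply/eqP; rewrite -subr_eq0 opprD addrA /pure -!(linearB (quotmod_proj _)).
by apply/eqP/quotmod_proj0/submod_gen1; exact: tensor_addl.
Qed.

Lemma pureDr (x : E) (y y' : M) : pure x (y + y') = pure x y + pure x y'.
Proof.
apply/eqP; rewrite -subr_eq0 opprD addrA /pure -!(linearB (quotmod_proj _)).
by apply/eqP/quotmod_proj0/submod_gen1; exact: tensor_addr.
Qed.

Lemma pure0r (x : E) : pure x (0 : M) = 0.
Proof. by apply/(addrI (pure x 0)); rewrite -pureDr !addr0. Qed.

Lemma pureZ (r : R) (x : E) (y : M) : pure ((r : R^c) *: x) y = pure x (r *: y).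
Proof.
apply/eqP; rewrite -subr_eq0 /pure -!(linearB (quotmod_proj _)).
by apply/eqP/quotmod_proj0/submod_gen1; exact: tensor_bal.
Qed.

Lemma tensor_uncurry (f : {linear M -> cdual (opc R) E}) :
  exists h : {additive tensor E M -> circ}, forall x y, h (pure x y) = cdual_fun (f y) x.
Proof.
have [_ [x x' y|x y y'|r x y]|h hP] :=
    @freeg_quot_desc _ (@tensor_rel R E M) (fun z => cdual_fun (f z.2) z.1).
- by rewrite !linearB !fglift_linE /= raddfD -addrA -opprD subrr.
- by rewrite !linearB !fglift_linE /= linearD -addrA -opprD subrr.
- by rewrite !linearB !fglift_linE /= linearZ_LR cdualZE subrr.
by exists h => x y; rewrite hP.
Qed.

Lemma tensor_curry (h : {additive tensor E M -> circ}) :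
  exists f : {linear M -> cdual (opc R) E}, forall x y, h (pure x y) = cdual_fun (f y) x.
Proof.
have pB y : zmod_morphism (fun x : E => h (pure x y)).
  move=> x x'; apply/eqP; rewrite -subr_eq opprK -raddfD -pureDl.
  by rewrite subrK.
have fL : linear (fun y => to_cdual (opc R) (additive_pack (pB y))).
  move=> a y y'; apply: cdualP => x; rewrite cdualPE.
  by rewrite -[RHS]/(h (pure ((a : R^c) *: x) y) + h (pure x y')) pureZ -raddfD -pureDr.
by exists (linear_pack fL).
Qed.

Lemma tensor_additive_ext (G : zmodType) (f g : {additive tensor E M -> G}) :
  (forall x y, f (pure x y) = g (pure x y)) -> forall t, f t = g t.
Proof. by move=> fg; apply: quotmod_additive_ext => -[x y]; exact: fg. Qed.

End Pure.

Lemma flat_dual (M : lmodType R) :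
  flat_module M <-> injective_module (cdual (opv R) M).
Proof.
split=> [flatM A B i g ii|injM A B i ii].
  have [h hP] := tensor_uncurry (swap (@opcK R) g).
  have [h' h'P] := iffLR (circ_inj _) (flatM _ _ i ii) h.
  have [k kP] := tensor_curry h'.
  exists (swap (@opvK R) k) => x; apply: cdualP => y.
  by rewrite swapE -kP -[y in pure _ y]/(idfun y) -tensor_mapE h'P hP swapE.
apply/circ_inj => h; have [k kP] := tensor_curry h.
have [g gP] := injM _ _ i (swap (@opvK R) k) ii.
have [h' h'P] := tensor_uncurry (swap (@opcK R) g).
exists h' => t; apply: (@tensor_additive_ext _ _ _ (h' \o tensor_map i idfun)) => x y.
by rewrite -[LHS]/(h' (tensor_map i idfun (pure x y))) tensor_mapE h'P swapE gP swapE kP.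
Qed.

Lemma tensor_exact (E : lmodType R^c) (M M' M'' : lmodType R)
    (f : {linear M -> M'}) (g : {linear M' -> M''}) : (forall x, g (f x) = 0) ->
  exact_at (tensor_map (@idfun E) f) (tensor_map (@idfun E) g) <->
  forall h : {linear M' -> cdual (opc R) E}, (forall x, h (f x) = 0) ->
    exists h' : {linear M'' -> cdual (opc R) E}, forall y, h' (g y) = h y.
Proof.
move=> gf; apply: iff_trans (circ_exact _) _ => [t|].
  apply: (@tensor_additive_ext _ _ _ (tensor_map idfun g \o tensor_map idfun f) \0).
  move=> x y; rewrite -[LHS]/(tensor_map idfun g (tensor_map idfun f (pure x y))).
  by rewrite !tensor_mapE gf pure0r.
split=> [ex h hf|ex h hf].
  have [k kP] := tensor_uncurry h.
  have [|k' k'P] := ex k.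
    move=> t; apply: (@tensor_additive_ext _ _ _ (k \o tensor_map idfun f) \0).
    by move=> x y; rewrite -[LHS]/(k (tensor_map idfun f (pure x y))) tensor_mapE kP hf.
  have [h' h'P] := tensor_curry k'.
  exists h' => y; apply: cdualP => x.
  by rewrite -h'P -kP -k'P tensor_mapE.
have [k kP] := tensor_curry h.
have [|k' k'P] := ex k.
  by move=> x; apply: cdualP => y; rewrite -kP -[y in pure y _]/(idfun y) -tensor_mapE hf.
have [h' h'P] := tensor_uncurry k'.
exists h' => t; apply: (@tensor_additive_ext _ _ _ (h' \o tensor_map idfun g)) => x y.
by rewrite -[LHS]/(h' (tensor_map idfun g (pure x y))) tensor_mapE h'P k'P kP.
Qed.

End TensorCharacters.

Section PathTensorCharacters.
Variables (Q : quiver) (R : pzRingType).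
Local Notation rrep := (rep (opposite Q) R^c).

Definition drepc (E : rrep) : rep Q R :=
  @Rep Q R (fun v => cdual (opc R) (E v)) (fun a => cdual_map (opc R) (rep_map E a)).

Definition drepv (M : rep Q R) : rrep :=
  @Rep (opposite Q) R^c (fun v => cdual (opv R) (M v))
    (fun a => cdual_map (opv R) (rep_map M a)).

Lemma rep_swap_subproof (M : rep Q R) (E : rrep) (f : rep_hom M (drepc E))
    (a : arrow (opposite Q)) (x : E (source a)) :
  swap (@opvK R) (f (target a)) (rep_map E a x) =
  rep_map (drepv M) a (swap (@opvK R) (f (source a)) x).
Proof.
apply: cdualP => y; rewrite -[RHS]/(cdual_fun (f _ (@rep_map Q R M a y)) x).
by rewrite (@rep_natural _ _ _ _ f a).
Qed.

Definition rep_swap (M : rep Q R) (E : rrep) (f : rep_hom M (drepc E)) :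
    rep_hom E (drepv M) :=
  @RepHom _ _ E (drepv M) (fun v => swap (@opvK R) (f v)) (rep_swap_subproof f).

Lemma rep_unswap_subproof (M : rep Q R) (E : rrep) (f : rep_hom E (drepv M))
    (a : arrow Q) (x : M (source a)) :
  swap (@opcK R) (f (target a)) (rep_map M a x) =
  rep_map (drepc E) a (swap (@opcK R) (f (source a)) x).
Proof.
apply: cdualP => y.
rewrite -[RHS]/(cdual_fun (f _ (@rep_map (opposite Q) R^c E a y)) x).
by rewrite (@rep_natural _ _ _ _ f a).
Qed.

Definition rep_unswap (M : rep Q R) (E : rrep) (f : rep_hom E (drepv M)) :
    rep_hom M (drepc E) :=
  @RepHom _ _ M (drepc E) (fun v => swap (@opcK R) (f v)) (rep_unswap_subproof f).

Definition ppure (E : rrep) (M : rep Q R) v (x : E v) (y : M v) : path_tensor E M :=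
  quotmod_proj (@path_tensor_rel Q R E M) (pgen x y).

Lemma path_tensor_mapE (E E' : rrep) (M M' : rep Q R)
    (f : rep_hom E E') (g : rep_hom M M') v (x : E v) (y : M v) :
  path_tensor_map f g (ppure x y) = ppure (f v x) (g v y).
Proof.
refine (etrans (quotmod_mapE (@path_tensor_gen_mapP _ _ _ _ _ _ f g) _) _).
refine (congr1 (quotmod_proj (@path_tensor_rel Q R E' M')) _).
exact: path_tensor_gen_mapE.
Qed.

Section Pure.
Variables (E : rrep) (M : rep Q R).

Lemma ppureDl (v : vertex Q) (x x' : E v) (y : M v) : ppure (x + x') y = ppure x y + ppure x' y.
Proof.
apply/eqP; rewrite -subr_eq0 opprD addrA /ppure -!(linearB (quotmod_proj _)).
by apply/eqP/quotmod_proj0/submod_gen1; exact: path_tensor_addl.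
Qed.

Lemma ppureDr (v : vertex Q) (x : E v) (y y' : M v) : ppure x (y + y') = ppure x y + ppure x y'.
Proof.
apply/eqP; rewrite -subr_eq0 opprD addrA /ppure -!(linearB (quotmod_proj _)).
by apply/eqP/quotmod_proj0/submod_gen1; exact: path_tensor_addr.
Qed.

Lemma ppure0r (v : vertex Q) (x : E v) : ppure x (0 : M v) = 0.
Proof. by apply/(addrI (ppure x 0)); rewrite -ppureDr !addr0. Qed.

Lemma ppureP (r : R) (v w : vertex Q) (p : qpath v w) (x : E w) (y : M v) :
  ppure (rrep_path E p ((r : R^c) *: x)) y = ppure x (r *: rep_path M p y).
Proof.
apply/eqP; rewrite -subr_eq0 /ppure -!(linearB (quotmod_proj _)).
by apply/eqP/quotmod_proj0/submod_gen1; exact: path_tensor_bal.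
Qed.

Lemma ppureZ (r : R) (v : vertex Q) (x : E v) (y : M v) :
  ppure ((r : R^c) *: x) y = ppure x (r *: y).
Proof. exact: (ppureP r (qpath_nil v)). Qed.

Lemma ppure_arrow (a : arrow Q) (x : E (target a)) (y : M (source a)) :
  ppure (rep_map E a x : E (source a)) y = ppure x (rep_map M a y).
Proof.
have := ppureP 1 (qpath_snoc (qpath_nil (source a))) x y.
by rewrite !scale1r.
Qed.

Lemma drepc_path (v w : vertex Q) (p : qpath v w) (f : drepc E v) (x : E w) :
  cdual_fun (rep_path (drepc E) p f) x = cdual_fun f (rrep_path E p x).
Proof. by elim: p x => //= a q IH x; rewrite -IH. Qed.

Lemma path_tensor_uncurry (f : rep_hom M (drepc E)) :
  exists h : {additive path_tensor E M -> circ},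
    forall (v : vertex Q) (x : E v) (y : M v), h (ppure x y) = cdual_fun (f v y) x.
Proof.
have [_ [v x x' y|v x y y'|r v w p x y]|h hP] :=
    @freeg_quot_desc _ (@path_tensor_rel Q R E M)
      (fun z => cdual_fun (f (tag z) (tagged z).2) (tagged z).1).
- by rewrite !linearB !fglift_linE /= raddfD -addrA -opprD subrr.
- by rewrite !linearB !fglift_linE /= linearD -addrA -opprD subrr.
- rewrite !linearB !fglift_linE /= linearZ_LR cdualZE rep_hom_path drepc_path.
  by rewrite subrr.
by exists h => v x y; rewrite hP.
Qed.

Lemma path_tensor_curry (h : {additive path_tensor E M -> circ}) :
  exists f : rep_hom M (drepc E),
    forall (v : vertex Q) (x : E v) (y : M v), h (ppure x y) = cdual_fun (f v y) x.
Proof.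
have pB v (y : M v) : zmod_morphism (fun x : E v => h (ppure x y)).
  move=> x x'; apply/eqP; rewrite -subr_eq opprK -raddfD -ppureDl.
  by rewrite subrK.
have fL v : linear (fun y : M v => to_cdual (opc R) (additive_pack (pB v y))).
  move=> a y y'; apply: cdualP => x; rewrite cdualPE.
  rewrite -[RHS]/(h (ppure ((a : R^c) *: x) y) + h (ppure x y')).
  by rewrite ppureZ -raddfD -ppureDr.
have fN (a : arrow Q) (y : M (source a)) : linear_pack (fL (target a)) (rep_map M a y) =
    rep_map (drepc E) a (linear_pack (fL (source a)) y).
  apply: cdualP => x; rewrite -[LHS]/(h (ppure x (rep_map M a y))).
  by rewrite -ppure_arrow.
by exists (@RepHom _ _ M (drepc E) (fun v => linear_pack (fL v)) fN).
Qed.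

Lemma path_tensor_additive_ext (G : zmodType) (f g : {additive path_tensor E M -> G}) :
  (forall (v : vertex Q) (x : E v) (y : M v), f (ppure x y) = g (ppure x y)) -> forall t, f t = g t.
Proof. by move=> fg; apply: quotmod_additive_ext => -[v [x y]]; exact: fg. Qed.

End Pure.

Lemma flat_rep_dual (M : rep Q R) : flat_rep M <-> injective_rep (drepv M).
Proof.
split=> [flatM A B i g ii|injM A B i ii].
  have [h hP] := path_tensor_uncurry (rep_unswap g).
  have [h' h'P] := iffLR (circ_inj _) (flatM _ _ i ii) h.
  have [k kP] := path_tensor_curry h'.
  exists (rep_swap k) => v x; apply: cdualP => y.
  rewrite -[LHS]/(cdual_fun (k v y) (i v x)) -kP -[y in ppure _ y]/(rep_id M v y).
  by rewrite -path_tensor_mapE h'P hP.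
apply/circ_inj => h; have [k kP] := path_tensor_curry h.
have [g gP] := injM _ _ i (rep_swap k) ii.
have [h' h'P] := path_tensor_uncurry (rep_unswap g).
exists h' => t.
apply: (@path_tensor_additive_ext _ _ _ (h' \o path_tensor_map i (rep_id M))) => v x y.
rewrite -[LHS]/(h' (path_tensor_map i (rep_id M) (ppure x y))) path_tensor_mapE h'P.
by rewrite -[LHS]/(cdual_fun (g v (i v x)) y) gP kP.
Qed.

Lemma path_tensor_exact (E : rrep) (M M' M'' : rep Q R)
    (f : rep_hom M M') (g : rep_hom M' M'') : (forall v x, g v (f v x) = 0) ->
  exact_at (path_tensor_map (rep_id E) f) (path_tensor_map (rep_id E) g) <->
  forall h : rep_hom M' (drepc E), (forall v x, h v (f v x) = 0) ->
    exists h' : rep_hom M'' (drepc E), forall v y, h' v (g v y) = h v y.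
Proof.
move=> gf; apply: iff_trans (circ_exact _) _ => [t|].
  apply: (@path_tensor_additive_ext _ _ _
    (path_tensor_map (rep_id E) g \o path_tensor_map (rep_id E) f) \0).
  move=> v x y.
  rewrite -[LHS]/(path_tensor_map (rep_id E) g (path_tensor_map (rep_id E) f (ppure x y))).
  by rewrite !path_tensor_mapE gf ppure0r.
split=> [ex h hf|ex h hf].
  have [k kP] := path_tensor_uncurry h.
  have [|k' k'P] := ex k.
    move=> t; apply: (@path_tensor_additive_ext _ _ _ (k \o path_tensor_map (rep_id E) f) \0).
    move=> v x y; rewrite -[LHS]/(k (path_tensor_map (rep_id E) f (ppure x y))).
    by rewrite path_tensor_mapE kP hf.
  have [h' h'P] := path_tensor_curry k'.
  exists h' => v y; apply: cdualP => x.
  by rewrite -h'P -kP -k'P path_tensor_mapE.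
have [k kP] := path_tensor_curry h.
have [|k' k'P] := ex k.
  move=> v x; apply: cdualP => y; rewrite -kP -[y in ppure y _]/(rep_id E v y).
  by rewrite -path_tensor_mapE hf.
have [h' h'P] := path_tensor_uncurry k'.
exists h' => t.
apply: (@path_tensor_additive_ext _ _ _ (h' \o path_tensor_map (rep_id E) g)) => v x y.
rewrite -[LHS]/(h' (path_tensor_map (rep_id E) g (ppure x y))).
by rewrite path_tensor_mapE h'P k'P kP.
Qed.

End PathTensorCharacters.

(** * Vanishing of Ext *)

Section DualExact.
Variables (S R : pzRingType) (c : antihom S R) (A B : lmodType R).

Lemma cdual_map_inj (f : {linear A -> B}) :
  (forall y, exists x, f x = y) -> injective (cdual_map c f).
Proof.
move=> fs; apply: linear_inj => h e; apply: cdualP => y; have [x <-] := fs y.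
by rewrite -[LHS]/(cdual_fun (cdual_map c f h) x) e.
Qed.

Lemma cdual_map_surj (f : {linear A -> B}) (g : cdual c A) :
  injective f -> exists h, cdual_map c f h = g.
Proof. by move=> fi; apply: cdual_extend => x /(inj_eq0 fi) ->; rewrite raddf0. Qed.

Lemma cdual_exact (C : lmodType R) (f : {linear A -> B}) (g : {linear B -> C}) :
  exact_at f g -> exact_at (cdual_map c g) (cdual_map c f).
Proof.
move=> fg h; split=> [hf|[k <-]].
  apply: cdual_extend => y /fg[x <-].
  by rewrite -[LHS]/(cdual_fun (cdual_map c f h) x) hf.
apply: cdualP => x; rewrite -[LHS]/(cdual_fun k (g (f x))).
by rewrite (iffRL (fg (f x))) ?raddf0 //; exists x.
Qed.
End DualExact.

(* [ext_zero C Y] says [Ext^1(C, Y) = 0]; [j] need not be injective *)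
Definition ext_zero (R : pzRingType) (C Y : lmodType R) : Prop :=
  forall (A B : lmodType R) (j : {linear A -> B}) (q : {linear B -> C})
    (g : {linear A -> Y}),
    (forall z, exists y, q y = z) -> exact_at j q ->
    (forall x, j x = 0 -> g x = 0) ->
  exists h : {linear B -> Y}, forall x, h (j x) = g x.

Lemma exact_comp0 (R : pzRingType) (A B C : lmodType R) (f : {linear A -> B})
    (g : {linear B -> C}) x :
  exact_at f g -> g (f x) = 0.
Proof. by move=> fg; apply/fg; exists x. Qed.

Section ExtZero.
Variable R : pzRingType.

(** The map is extended in two stages: from [A] to the preimage of [C1] in [B], which is the kernel
    of [p \o q], and from there to [B]. The successive quotients are [C1] and [C2]. *)
Lemma ext_zero_extension (C1 C C2 Y : lmodType R) (u : {linear C1 -> C})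
    (p : {linear C -> C2}) :
  short_exact u p -> ext_zero C1 Y -> ext_zero C2 Y -> ext_zero C Y.
Proof.
move=> [ui up ps] e1 e2 A B j q g qs jq jg.
pose k := kernel_val (p \o q).
have [j1 j1P] : exists h : {linear A -> kernel (p \o q)}, forall x, k (h x) = j x.
  apply: factor_inj; first exact: kernel_val_inj.
  by move=> x; apply/kernel_exact; rewrite /= (exact_comp0 _ jq) linear0.
have [q1 q1P] : exists h : {linear kernel (p \o q) -> C1}, forall x, u (h x) = q (k x).
  by apply: (@factor_inj _ _ _ _ _ (q \o k)) => // x; apply/up; exact: (kernel_valP x).
have [|z|x jx|h1 h1P] := e1 _ _ j1 q1 g.
- move=> z; have [y qy] := qs (u z).
  have /kernel_exact[y' yy'] : (p \o q) y = 0 by rewrite /= qy (exact_comp0 _ up).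
  by exists y'; apply: ui; rewrite q1P /k yy'.
- split=> [e|[x <-]].
    have /jq[x jx] : q (k z) = 0 by rewrite -q1P e linear0.
    by exists x; apply: (@kernel_val_inj _ _ _ (p \o q)); rewrite -/k j1P.
  by apply: ui; rewrite q1P j1P linear0 (exact_comp0 _ jq).
- by apply: jg; rewrite -j1P jx linear0.
have [z|x kx|h hP] := e2 _ _ k (p \o q) h1 _ (@kernel_exact _ _ _ _).
- have [y <-] := ps z; have [x <-] := qs y; by exists x.
- by rewrite (inj_eq0 (@kernel_val_inj _ _ _ _) kx) linear0.
by exists h => x; rewrite -j1P hP h1P.
Qed.

(** The pullback [X] of [p] and [l] is an extension of [F] by [Y], which splits by a retraction [h].
    A point of [X] over [f] is unique up to [Y]; subtracting [i (h z)] from its component in [J]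
    removes the ambiguity and defines the lift. *)
Lemma ext_zero_lift (F Y J Z : lmodType R) (i : {linear Y -> J}) (p : {linear J -> Z})
    (l : {linear F -> Z}) : short_exact i p -> ext_zero F Y ->
  exists m : {linear F -> J}, forall x, p (m x) = l x.
Proof.
move=> [ii ip ps] e.
pose d : {linear (F * J)%type -> Z} := (l \o fst) \- (p \o snd).
pose X := kernel d; pose k := kernel_val d.
have kE x : l (k x).1 = p (k x).2.
  by apply/eqP; rewrite -subr_eq0; apply/eqP; exact: (kernel_valP x).
have kex f x : l f = p x -> exists z, k z = (f, x).
  by move=> fx; apply/kernel_exact; rewrite /= fx subrr.
have jL : linear (fun y => (0, i y) : (F * J)%type).
  by move=> a x y; rewrite linearP -[RHS]/(a *: 0 + 0, _) scaler0 addr0.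
have [j jP] : exists h : {linear Y -> X}, forall y, k (h y) = (0, i y).
  apply: (@factor_inj _ _ _ _ k (linear_pack jL)); first exact: kernel_val_inj.
  by move=> y; apply: kex; rewrite linear0 (exact_comp0 _ ip).
have [z|z|y jy|h hP] := e _ _ j (fst \o k) idfun.
- by have [x px] := ps (l z); have [w wE] := kex z x (esym px); exists w; rewrite /= wE.
- split=> [z0|[y <-]]; last by rewrite /= jP.
  have {}z0 : (k z).1 = 0 by exact: z0.
  have /ip[y iy] : p (k z).2 = 0 by rewrite -kE z0 linear0.
  exists y; apply: (@kernel_val_inj _ _ _ d); rewrite -/k jP iy.
  by move: z0; case: (k z) => u v /= ->.
- by apply: (inj_eq0 ii); have := jP y; rewrite jy linear0 => -[].
have [|m|f|m mP] := @linear_of_rel R F J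
  (fun f x => exists z, f = (k z).1 /\ x = (k z).2 - i (h z)).
- move=> a _ _ _ _ [z [-> ->]] [z' [-> ->]]; exists (a *: z + z').
  by rewrite (linearP k) (linearP h) (linearP i) /= scalerBr opprD addrACA.
- move=> [z [/esym z0 ->]]; have /ip[y iy] : p (k z).2 = 0 by rewrite -kE z0 linear0.
  have -> : z = j y.
    apply: (@kernel_val_inj _ _ _ d); rewrite -/k jP iy.
  by move: z0; case: (k z) => u v /= ->.
  by rewrite jP hP subrr.
- have [x px] := ps (l f); have [z zE] := kex f x (esym px).
  by exists (x - i (h z)), z; rewrite zE.
exists m => f; have [z [-> ->]] := mP f.
by rewrite linearB (exact_comp0 _ ip) subr0 -kE.
Qed.

(* Ext^1(C, Z) -> Ext^2(C, Y) = Ext^1(K, Y) is onto *)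
Lemma ext_zero_syzygy (K F C Y J Z : lmodType R) (k : {linear K -> F})
    (q : {linear F -> C}) (i : {linear Y -> J}) (p : {linear J -> Z}) :
    short_exact k q -> short_exact i p -> injective_module J ->
  ext_zero F Y -> ext_zero C Z -> ext_zero K Y.
Proof.
move=> [ki kq qs] ip injJ eF eC A B j q' g q's jq' jg.
have [ii ie ps] := ip.
(* Injectivity of [J] extends [i \o g] to [b], whose values need not lie in [Y]. The obstruction is
   the map [l] from [K] to [Z]; it extends to [F], lifts to [J] there, and is subtracted from
   [b]. *)
have [|b bP] := injective_extend (i := j) (g := i \o g) injJ.
  by move=> x /jg /= ->; rewrite linear0.
have [|l lP] := @factor_surj _ _ _ _ q' (p \o b) q's.
  by move=> _ /jq'[x <-]; rewrite /= bP (exact_comp0 _ ie).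
have [|m mP] := eC _ _ k q l qs kq.
  by move=> x /(inj_eq0 ki) ->; rewrite linear0.
have [n nP] := ext_zero_lift m ip eF.
have [|h hP] := @factor_inj _ _ _ _ i (b \- (n \o (k \o q'))) ii.
  by move=> x; apply/ie; rewrite linearB /= nP mP lP subrr.
exists h => x; apply: ii.
by rewrite hP /= bP (exact_comp0 _ jq') !linear0 addr0.
Qed.

(** From the exact sequence Hom(F, Y) -> Hom(M', Y) -> Ext^1(M, Y) -> Ext^1(F, Y). The pullback [X]
    of [q] and [p] contains the image of [A] with quotient [F], and contains [M'] with quotient
    [B]. *)
Lemma ext_zero_quotient (M' F M Y : lmodType R) (i : {linear M' -> F})
    (p : {linear F -> M}) : short_exact i p -> ext_zero F Y ->
    (forall h : {linear M' -> Y}, exists h' : {linear F -> Y}, forall x, h' (i x) = h x) ->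
  ext_zero M Y.
Proof.
move=> [ii ip ps] eF ext A B j q g qs jq jg.
pose d : {linear (B * F)%type -> M} := (q \o fst) \- (p \o snd).
pose X := kernel d; pose k := kernel_val d.
have kE x : q (k x).1 = p (k x).2.
  by apply/eqP; rewrite -subr_eq0; apply/eqP; exact: (kernel_valP x).
have kex f x : q f = p x -> exists z, k z = (f, x).
  by move=> fx; apply/kernel_exact; rewrite /= fx subrr.
have jL : linear (fun y => (j y, 0) : (B * F)%type).
  by move=> a x y; rewrite linearP -[RHS]/(_, a *: 0 + 0) scaler0 addr0.
have [jX jXP] : exists h : {linear A -> X}, forall y, k (h y) = (j y, 0).
  apply: (@factor_inj _ _ _ _ k (linear_pack jL)); first exact: kernel_val_inj.
  by move=> y; apply: kex; rewrite linear0 (exact_comp0 _ jq).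
have iL : linear (fun y => (0, i y) : (B * F)%type).
  by move=> a x y; rewrite linearP -[RHS]/(a *: 0 + 0, _) scaler0 addr0.
have [iX iXP] : exists h : {linear M' -> X}, forall y, k (h y) = (0, i y).
  apply: (@factor_inj _ _ _ _ k (linear_pack iL)); first exact: kernel_val_inj.
  by move=> y; apply: kex; rewrite linear0 (exact_comp0 _ ip).
have [f|z|x jx|g1 g1P] := eF _ _ jX (snd \o k) g.
- by have [b qb] := qs (p f); have [z zE] := kex b f qb; exists z; rewrite /= zE.
- split=> [z0|[y <-]]; last by rewrite /= jXP.
  have {}z0 : (k z).2 = 0 by exact: z0.
  have /jq[y jy] : q (k z).1 = 0 by rewrite kE z0 linear0.
  exists y; apply: (@kernel_val_inj _ _ _ d); rewrite -/k jXP jy.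
  by move: z0; case: (k z) => u v /= ->.
- by apply: jg; have := jXP x; rewrite jx linear0 => -[].
(* The extension [g1] of [g] to [X] is corrected by a map coming from [F], so that it vanishes on
   [M'] and descends to [B]. *)
have [h hP] := ext (g1 \o iX).
have [||g' g'P] := @factor_surj _ _ _ _ (fst \o k) (g1 \- (h \o (snd \o k))).
- by move=> b; have [f pf] := ps (q b); have [z zE] := kex b f (esym pf);
    exists z; rewrite /= zE.
- move=> z z0; have {}z0 : (k z).1 = 0 by exact: z0.
  have /ip[y iy] : p (k z).2 = 0 by rewrite -kE z0 linear0.
  have -> : z = iX y.
    apply: (@kernel_val_inj _ _ _ d); rewrite -/k iXP iy; by move: z0; case: (k z) => u v /= ->.
  by rewrite -[LHS]/(g1 (iX y) - h (k (iX y)).2) iXP hP subrr.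
exists g' => x; have := g'P (jX x).
rewrite -[LHS]/(g' (k (jX x)).1) -[RHS]/(g1 (jX x) - h (k (jX x)).2) jXP /=.
by rewrite linear0 subr0 g1P.
Qed.

(** Transposed, the problem is to lift a map from [N] to [A^+] along [B^+ -> A^+], whose kernel is
    the injective module [C^+]. With a retraction [r] onto this kernel, the lift killed by [r] is
    unique, hence linear. *)
Lemma ext_zero_dual (S : pzRingType) (c : antihom S R) (c' : antihom R S)
    (C : lmodType R) (N : lmodType S) : cancel c c' -> cancel c' c ->
  injective_module (cdual c C) -> ext_zero C (cdual c' N).
Proof.
move=> cK c'K injC A B j q g qs jq jg.
have [r rP] := injective_retract injC (cdual_map_inj (c := c) qs).
have jqD := cdual_exact (c := c) jq.
have [|t|n|h hP] := @linear_of_rel S N (cdual c B)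
  (fun n t => cdual_map c j t = swap cK g n /\ r t = 0).
- move=> a x x' y y' [e1 e2] [e1' e2']; rewrite !linearP e1 e1' e2 e2'.
  by rewrite scaler0 addr0.
- by move=> [+ rt]; rewrite linear0 => /jqD[u ut]; move: rt; rewrite -ut rP => ->;
    rewrite linear0.
- have [t tP] : exists t, cdual_map c j t = swap cK g n.
    by apply: cdual_extend => x /jg e; rewrite swapE e.
  exists (t - cdual_map c q (r t)); rewrite !linearB rP subrr; split=> //.
  by rewrite (exact_comp0 _ jqD) subr0.
exists (swap c'K h) => x; apply: cdualP => n; rewrite swapE.
by have [e _] := hP n; rewrite -(cdual_mapE j) e.
Qed.

Lemma ext_zero_flat (F : lmodType R) (N : lmodType R^c) :
  flat_module F -> ext_zero F (cdual (opc R) N).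
Proof. by move=> /flat_dual; exact: ext_zero_dual (@opvK R) (@opcK R). Qed.

End ExtZero.

(** * Noetherian rings *)

Definition noetherian_module (S : pzRingType) (V : lmodType S) : Prop :=
  forall P : V -> Prop, P 0 -> (forall a u v, P u -> P v -> P (a *: u + v)) ->
  exists s : seq V, (forall x, x \in s -> P x) /\
    forall x, P x -> submod_gen (fun y => y \in s) x.

Lemma left_noetherian_regular (S : pzRingType) :
  left_noetherian S -> noetherian_module (S^o : lmodType S).
Proof.
move=> noeth P P0 PD; apply: contrapT => nfg.
pose span (s : seq S^o) := submod_gen (fun y : S^o => y \in s).
have nextP (s : seq S^o) : exists x, (forall y, y \in s -> P y) -> P x /\ ~ span s x.
  have [sP|] := pselect (forall y, y \in s -> P y); last by exists 0.
  have [[x [Px sx]]|none] := pselect (exists x, P x /\ ~ span s x); first by exists x.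
  exfalso; apply: nfg; exists s; split=> // x Px; apply: contrapT => sx.
  by apply: none; exists x.
have [next nxt] := choice nextP.
pose s := fix s n := if n is m.+1 then next (s m) :: s m else [::].
have sP n : forall y, y \in s n -> P y.
  elim: n => [|n IH] y //=; rewrite inE => /orP[/eqP ->|]; last exact: IH.
  by have [] := nxt _ IH.
have [n|n x|n nP] := noeth (fun n x => span (s n) x).
- split; first by left.
    by move=> x y hx hy; exact: submod_genD.
  by move=> r x hx; exact: (submod_genZ r hx).
- by apply: submod_gen_mono => y ys; apply: submod_gen1; rewrite inE ys orbT.
have [_] := nxt _ (sP n); apply.
move/(congr1 (fun I : set S => I (next (s n)))): (nP n.+1 (leqnSn n)) => /= <-.
by apply: submod_gen1; rewrite inE eqxx.
Qed.

Lemma submod_gen_linear (S : pzRingType) (V W : lmodType S) (f : {linear V -> W})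
    (P : V -> Prop) (P' : W -> Prop) x :
  (forall y, P y -> P' (f y)) -> submod_gen P x -> submod_gen P' (f x).
Proof.
move=> PP'; elim=> [|a u v Pu _ IH]; first by rewrite linear0; left.
by rewrite linearP; apply: submod_gen_lin => //; exact: PP'.
Qed.

Lemma noetherian_module_surj (S : pzRingType) (V W : lmodType S) (f : {linear V -> W}) :
  (forall y, exists x, f x = y) -> noetherian_module V -> noetherian_module W.
Proof.
move=> fs nV P P0 PD; have [||s [sP sV]] := nV (fun x => P (f x)).
- by rewrite linear0.
- by move=> a u v Pu Pv; rewrite linearP; exact: PD.
exists (map f s); split=> [_ /mapP[x xs ->]|y]; first exact: sP.
have [x <-] := fs y; move=> /sV; apply: submod_gen_linear => z zs.
exact: map_f.
Qed.

(** [P] is generated by generators of its intersection with [V] together with lifts, chosen by [l],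
    of generators of its image in [W]. *)
Lemma noetherian_module_prod (S : pzRingType) (V W : lmodType S) :
  noetherian_module V -> noetherian_module W -> noetherian_module (V * W)%type.
Proof.
move=> nV nW P P0 PD.
have PB x y : P x -> P y -> P (x - y).
  by move=> Px Py; rewrite addrC -scaleN1r; exact: PD.
have PZ a x : P x -> P (a *: x) by move=> Px; rewrite -[_ *: _]addr0; exact: PD.
have [|s1 [s1P s1V]] := nV (fun x => P (x, 0)) P0.
  move=> a u v Pu Pv; have := PD a _ _ Pu Pv.
  by rewrite -[a *: _ + _]/(a *: u + v, a *: 0 + 0) scaler0 addr0.
have [||s2 [s2P s2V]] := nW (fun y => exists x, P (x, y)).
- by exists 0.
- by move=> a u v [x xP] [y yP]; exists (a *: x + y); exact: PD xP yP.
have lex y : exists x, (exists x', P (x', y)) -> P (x, y).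
  by have [[x xP]|none] := pselect (exists x, P (x, y)); [exists x|exists 0].
have [l lP] := choice lex.
exists ([seq (x, 0) | x <- s1] ++ [seq (l y, y) | y <- s2]); split.
  move=> z; rewrite mem_cat => /orP[/mapP[x xs ->]|/mapP[y ys ->]]; first exact: s1P.
  exact/lP/s2P.
move=> [x y] Pxy; set T := fun z => _.
have [u [uP uT]] : exists u, P (u, y) /\ submod_gen T (u, y).
  have /s2V : exists x, P (x, y) by exists x.
  elim=> [|a w v ws _ [u [uP uT]]]; first by exists 0; split=> //; left.
  exists (a *: l w + u); split.
    by rewrite -[(_, _)]/(a *: (l w, w) + (u, v)); apply: PD => //; exact/lP/s2P.
  rewrite -[(_, _)]/(a *: (l w, w) + (u, v)); apply: submod_gen_lin => //.
  by rewrite /T mem_cat map_f ?orbT.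
have d0 : P (x - u, 0).
  by have := PB _ _ Pxy uP; rewrite -[_ - (u, y)]/(x - u, y - y) subrr.
rewrite -[(x, y)](subrK (u, y)); apply: submod_genD => //.
rewrite -[_ - (u, y)]/(x - u, y - y) subrr; have {d0} := s1V _ d0.
elim=> [|a w v ws _ IH]; first by left.
have -> : (a *: w + v, 0) = a *: (w, 0) + (v, 0) :> (V * W)%type.
  by rewrite -[RHS]/(a *: w + v, a *: 0 + 0) scaler0 addr0.
by apply: submod_gen_lin => //; rewrite /T mem_cat map_f.
Qed.

Lemma noetherian_module_row (S : pzRingType) n :
  left_noetherian S -> noetherian_module 'rV[S]_n.
Proof.
move=> noeth; elim: n => [|n IH].
  move=> P P0 _; exists [::]; split=> // x _; rewrite (_ : x = 0); first by left.
  by apply/rowP => -[].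
have L : linear (fun z : (S^o * 'rV[S]_n)%type => row_mx z.1%:M z.2 : 'rV[S]_(1 + n)).
  move=> a x y; rewrite /= scale_row_mx add_row_mx; congr row_mx.
  by apply/matrixP => i j; rewrite !mxE mulrnDl; congr (_ + _); rewrite -mulrnAr.
apply: (@noetherian_module_surj _ _ _ (linear_pack L)).
  move=> r; exists (lsubmx (r : 'rV_(1 + n)) 0 0, rsubmx (r : 'rV_(1 + n))).
  by rewrite /= -mx11_scalar hsubmxK.
by apply: noetherian_module_prod => //; exact: left_noetherian_regular.
Qed.

Lemma tensor_sum (R : pzRingType) (E : lmodType R^c) (M : lmodType R) (t : tensor E M) :
  exists s : seq (E * M), t = \sum_(z <- s) pure z.1 z.2.
Proof.
have pureMz (x : E) (y : M) k : pure (x *~ k) y = pure x y *~ k.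
  have pB : zmod_morphism (fun x : E => pure x y).
    move=> u v; apply/eqP; rewrite -subr_eq opprK -pureDl.
    by rewrite subrK.
  exact: (raddfMz (additive_pack pB)).
have [D <-] := quotmod_surj t; rewrite -(freeg_sumE D).
exists [seq (z.1 *~ coeff z D, z.2) | z <- dom D].
rewrite (raddf_sum (quotmod_proj _)) [RHS]big_map; apply: eq_bigr => -[x y] _.
by rewrite -[coeff _ _]intz -freegU_mulz raddfMz pureMz intz.
Qed.

(* For [x = \sum_k a_k (x) f_k] in [A (x) E^+] vanishing in [B (x) E^+], extending maps
   from [A] to [E] to [B] shows that [\sum_k f_k] kills all [e : E^n] that satisfy the
   finitely many relations between the [a_k]; so it is a combination of these relations. *)
Lemma injective_dual_flat (R : pzRingType) (E : lmodType R^c) :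
  left_noetherian R^c -> injective_module E -> flat_module (cdual (opc R) E).
Proof.
move=> noeth injE A B i ii; apply: linear_inj => t.
have [s ->] := tensor_sum t; set n := size s.
rewrite (big_nth (0, 0)) big_mkord => t0.
pose a (k : 'I_n) := (nth (0, 0) s k).1; pose f (k : 'I_n) := (nth (0, 0) s k).2.
have combL (X : lmodType R^c) (x : 'I_n -> X) :
    linear (fun r : 'rV[R^c]_n => \sum_k r 0 k *: x k).
  move=> c r r'; rewrite scaler_sumr -big_split; apply: eq_bigr => k _ /=.
  by rewrite !mxE scalerDl scalerA.
have comb_delta (X : lmodType R^c) (x : 'I_n -> X) k :
    linear_pack (combL X x) (delta_mx 0 k) = x k.
  rewrite /= (bigD1 k) //= big1 ?addr0 => [|l lk].
    by rewrite mxE !eqxx scale1r.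
  by rewrite mxE (negPf lk) andbF scale0r.
pose alpha := linear_pack (combL A a).
have [||ks [ks0 ksP]] := @noetherian_module_row R^c n noeth (fun r => alpha r = 0).
- exact: linear0.
- by move=> c u v u0 v0; rewrite linearP u0 v0 scaler0 addr0.
set m := size ks; pose ka (j : 'I_m) := nth 0 ks j.
have kaP j : ka j \in ks by apply: mem_nth.
pose Phi (e : {ffun 'I_n -> E}) : circ := \sum_k cdual_fun (f k) (e k).
have PhiB : zmod_morphism Phi.
  by move=> e e'; rewrite -sumrB; apply: eq_bigr => k _; rewrite !ffunE raddfB.
pose G (e : {ffun 'I_n -> E}) : {ffun 'I_m -> E} :=
  [ffun j => \sum_k (ka j) 0 k *: e k].
have GB : zmod_morphism G.
  move=> e e'; apply/ffunP => j; rewrite !ffunE -sumrB; apply: eq_bigr => k _.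
  by rewrite !ffunE scalerBr.
have [e /ffunP Ge|Psi PsiP] := @circ_injective _ _ (additive_pack GB) (additive_pack PhiB).
  pose beta := linear_pack (combL E e).
  have [r|h hP] := injective_extend (i := i \o alpha) (g := beta) injE.
    move=> /(inj_eq0 ii)/ksP; elim=> [|c u v uks _ IH]; first exact: linear0.
    rewrite linearP IH addr0 (_ : beta u = 0) ?scaler0 //.
    have uj : (index u ks < m)%N by rewrite index_mem.
    have e0 := Ge (Ordinal uj); rewrite !ffunE /ka /= in e0.
    by rewrite -[RHS]e0; apply: eq_bigr => k _; rewrite nth_index.
  have [ev evP] := tensor_uncurry (cdual_map (opc R) h).
  rewrite -[RHS](raddf0 ev) -t0 (raddf_sum (tensor_map _ _)) (raddf_sum ev).
  apply: eq_bigr => k _.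
  rewrite -[RHS]/(ev (tensor_map i idfun (pure (a k) (f k)))) tensor_mapE evP cdual_mapE.
  congr (cdual_fun _ _).
  have := hP (delta_mx 0 k); rewrite comb_delta => <-.
  by rewrite -[LHS]/(h (i (alpha (delta_mx 0 k)))) comb_delta.
pose single j (x : E) : {ffun 'I_m -> E} := [ffun l => if l == j then x else 0].
have singleB j : zmod_morphism (single j).
  by move=> x y; apply/ffunP => l; rewrite !ffunE; case: eqP => _ //; rewrite subr0.
pose psi j : cdual (opc R) E :=
  to_cdual (opc R) (Psi \o additive_pack (singleB j)).
(* Evaluating [Psi \o G = Phi] on tuples with one nonzero entry expresses each [f k] through the
   coordinates [psi j] of [Psi]. Moving the coefficients across the tensor sign leaves the sum over
   [j] of [alpha (ka j)] tensored with [psi j], and [alpha (ka j)] is [0]. *)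
have fE k : f k = \sum_j ((ka j) 0 k : R) *: psi j.
  apply: cdualP => x.
  pose e : {ffun 'I_n -> E} := [ffun l => if l == k then x else 0].
  have -> : cdual_fun (f k) x = Phi e.
    rewrite /Phi (bigD1 k) //= big1 ?addr0 => [|l lk]; rewrite ffunE ?eqxx //.
    by rewrite (negPf lk) raddf0.
  rewrite -[LHS]PsiP -[additive_pack GB e]/(G e).
  have -> : G e = \sum_j single j ((ka j) 0 k *: x).
    apply/ffunP => j; rewrite ffunE sum_ffunE (bigD1 k) //= big1 ?addr0 => [|l lk].
      rewrite (bigD1 j) //= big1 ?addr0 => [|l lj]; rewrite !ffunE ?eqxx //.
      by rewrite eq_sym (negPf lj).
    by rewrite ffunE (negPf lk) scaler0.
  have evB : zmod_morphism (fun g : cdual (opc R) E => cdual_fun g x) by [].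
  rewrite raddf_sum -[RHS]/(additive_pack evB _) (raddf_sum (additive_pack evB)).
  by [].
have pB (x : A) : zmod_morphism (fun g : cdual (opc R) E => pure x g).
  by move=> u v; apply/eqP; rewrite -subr_eq opprK -pureDr subrK.
have pBl (g : cdual (opc R) E) : zmod_morphism (fun x : A => pure x g).
  by move=> u v; apply/eqP; rewrite -subr_eq opprK -pureDl subrK.
transitivity (\sum_k \sum_j pure ((ka j) 0 k *: a k) (psi j)).
  apply: eq_bigr => k _; rewrite -/(a k) -/(f k) fE.
  rewrite -[LHS]/(additive_pack (pB (a k)) _) raddf_sum.
  by apply: eq_bigr => j _; rewrite pureZ.
rewrite exchange_big big1 // => j _.
rewrite -[LHS]/(\sum_i additive_pack (pBl (psi j)) (ka j 0 i *: a i)) -raddf_sum.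
by rewrite -[\sum_i _]/(alpha (ka j)) ks0 // raddf0.
Qed.

(** * Complete flat resolutions of modules *)

(* The characters [N^+], for [N] in this class, compute by dimension shifting all
   the groups [Ext^i(C, E^+)], [i > 0], [E] injective. *)
Inductive injective_syzygy (R : pzRingType) : lmodType R^c -> Prop :=
| injective_syzygy0 (E : lmodType R^c) : injective_module E -> injective_syzygy E
| injective_syzygyS (N : lmodType R^c) :
    injective_syzygy N -> injective_syzygy (kernel (free_cover N)).

Definition ext_free (R : pzRingType) (C : lmodType R) : Prop :=
  forall N : lmodType R^c, injective_syzygy N -> ext_zero C (cdual (opc R) N).

(** One link of a complete flat resolution. The last clause says in terms of characters that E (x) M
    -> E (x) F is injective for every injective E. *)
Definition flat_step (R : pzRingType) (M M' : lmodType R) : Prop :=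
  exists (F : lmodType R) (i : {linear M -> F}) (p : {linear F -> M'}),
    [/\ flat_module F, short_exact i p
      & forall E : lmodType R^c, injective_module E ->
        forall h : {linear M -> cdual (opc R) E},
        exists h' : {linear F -> cdual (opc R) E}, forall x, h' (i x) = h x].

(** Since the kernel may sit at any position [n], neighbouring cycles stay in the class without
    reindexing the complex. *)
Definition flat_cycle (R : pzRingType) (M : lmodType R) : Prop :=
  exists (F : int -> lmodType R) (d : forall n, {linear F n -> F (n + 1)}),
    [/\ forall n, flat_module (F n),
        forall n, exact_at (d n) (d (n + 1)),
        forall E : lmodType R^c, injective_module E -> forall n,
          exact_at (tensor_map (@idfun E) (d n)) (tensor_map (@idfun E) (d (n + 1)))
      & exists n (k : {linear M -> F n}), injective k /\ exact_at k (d n)].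

Section ModuleClasses.
Variable R : pzRingType.
Implicit Types C M F : lmodType R.

Lemma flat_module_free (X : choiceType) : flat_module (free_module R X).
Proof.
by apply/flat_dual/(projective_dual (@opvK R) (@opcK R)); exact: free_projective.
Qed.

Lemma flat_extension (A B C : lmodType R) (i : {linear A -> B}) (p : {linear B -> C}) :
  short_exact i p -> flat_module A -> flat_module C -> flat_module B.
Proof.
move=> [ii ip ps] /flat_dual fA /flat_dual fC; apply/flat_dual.
apply: (injective_extension (cdual_map_inj (c := opv R) ps)
  (cdual_exact (c := opv R) ip)) => // z.
exact: cdual_map_surj.
Qed.

Lemma gorenstein_flat_cycle M : gorenstein_flat_module M -> flat_cycle M.
Proof.
move=> [F [d [k [Fflat dex kP Eex]]]]; exists F, d; split=> //.
by exists 0, k.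
Qed.

Lemma cycle_step (F : int -> lmodType R) (d : forall n, {linear F n -> F (n + 1)})
    (n : int) (M M' : lmodType R) (k : {linear M -> F n}) (k' : {linear M' -> F (n + 1)}) :
    (forall n, flat_module (F n)) -> (forall n, exact_at (d n) (d (n + 1))) ->
    (forall E : lmodType R^c, injective_module E -> forall n,
       exact_at (tensor_map (@idfun E) (d n)) (tensor_map (@idfun E) (d (n + 1)))) ->
    injective k -> exact_at k (d n) -> injective k' -> exact_at k' (d (n + 1)) ->
  flat_step M M'.
Proof.
move=> Fflat dex Eex ki kd k'i k'd.
have [p pP] : exists h : {linear F n -> M'}, forall x, k' (h x) = d n x.
  apply: factor_inj => // x; apply/k'd; exact: exact_comp0 (dex n).
exists (F n), k, p; split=> //.
  split=> // [x|z].
    split=> [px|[m <-]]; first by apply/kd; rewrite -pP px linear0.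
    by apply: k'i; rewrite pP linear0 (exact_comp0 _ kd).
  have /dex[x dx] : d (n + 1) (k' z) = 0 by exact: exact_comp0 k'd.
  by exists x; apply: k'i; rewrite pP.
(* Pulled back along [q], the map [h] becomes a cocycle on [F (l + 1)]; exactness of the tensored
   complex there factors it through [d (l + 1)], whose codomain is [F n]. *)
have [l nl] : exists l, n = l + 1 + 1 by exists (n - 1 - 1); rewrite !subrK.
subst n => E injE h.
have dd m x : d (m + 1) (d m x) = 0 by exact: exact_comp0 (dex m).
have [q qP] : exists q : {linear F (l + 1) -> M}, forall x, k (q x) = d (l + 1) x.
  by apply: factor_inj => // x; apply/kd; exact: dd.
have [|h' h'P] := iffLR (tensor_exact E (dd l)) (Eex E injE l) (h \o q).
  move=> x; rewrite /= (_ : q (d l x) = 0) ?linear0 //.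
  by apply: ki; rewrite qP dd linear0.
exists h' => x; have /dex[y yx] : d (l + 1 + 1) (k x) = 0 by exact: exact_comp0 kd.
have qy : q y = x by apply: ki; rewrite qP.
by rewrite -yx h'P /= qy.
Qed.

Lemma flat_cycle_succ M : flat_cycle M -> exists M', flat_cycle M' /\ flat_step M M'.
Proof.
move=> [F [d [Fflat dex Eex [n [k [ki kd]]]]]].
exists (kernel (d (n + 1))); split.
  exists F, d; split=> //; exists (n + 1), (kernel_val (d (n + 1))).
  by split; [exact: kernel_val_inj|exact: kernel_exact].
apply: (cycle_step Fflat dex Eex ki kd (@kernel_val_inj _ _ _ _)).
exact: kernel_exact.
Qed.

Lemma flat_cycle_pred M : flat_cycle M -> exists M', flat_cycle M' /\ flat_step M' M.
Proof.
move=> [F [d [Fflat dex Eex [n [k [ki kd]]]]]].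
have [l nl] : exists l, n = l + 1 by exists (n - 1); rewrite subrK.
subst n; exists (kernel (d l)); split.
  exists F, d; split=> //; exists l, (kernel_val (d l)).
  by split; [exact: kernel_val_inj|exact: kernel_exact].
exact: (cycle_step Fflat dex Eex (@kernel_val_inj _ _ _ (d l)) (@kernel_exact _ _ _ (d l)) ki kd).
Qed.

Lemma free_cover_dual_exact (N : lmodType R^c) :
  short_exact (cdual_map (opc R) (free_cover N))
              (cdual_map (opc R) (kernel_val (free_cover N))).
Proof.
split; first by apply: cdual_map_inj; exact: free_cover_surj.
  by apply: cdual_exact; exact: kernel_exact.
by move=> z; apply: cdual_map_surj; exact: kernel_val_inj.
Qed.

Lemma free_dual_injective (X : choiceType) :
  injective_module (cdual (opc R) (free_module R^c X)).
Proof. exact: (projective_dual (@opcK R) (@opvK R) (@free_projective _ _)). Qed.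

(** Dimension shifting along the syzygies. For the kernel K of a free cover P -> N, a map from the
    preceding cycle [M'] to K^+ lifts to P^+ by induction, and then extends to the flat module
    because P^+ is injective. *)
Lemma ext_free_cycle M : flat_cycle M -> ext_free M.
Proof.
move=> cM N sN; elim: sN M cM => {N} [E injE|N sN IH] M cM.
  have [M' [_ [F [i [p [Fflat ip ext]]]]]] := flat_cycle_pred cM.
  by apply: (ext_zero_quotient ip (ext_zero_flat Fflat)); exact: ext.
have [M' [cM' [F [i [p [Fflat ip _]]]]]] := flat_cycle_pred cM.
apply: (ext_zero_quotient ip (ext_zero_flat Fflat)) => h.
have [m mP] := ext_zero_lift h (free_cover_dual_exact N) (IH M' cM').
have [ii _ _] := ip.
have [m' m'P] := free_dual_injective m ii.
exists (cdual_map (opc R) (kernel_val (free_cover N)) \o m') => x.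
by rewrite -[LHS]/(cdual_map (opc R) (kernel_val (free_cover N)) (m' (i x))) m'P mP.
Qed.

Lemma ext_free_flat F : flat_module F -> ext_free F.
Proof. by move=> flatF N _; exact: ext_zero_flat. Qed.

Lemma ext_free_extension (C1 C C2 : lmodType R) (u : {linear C1 -> C})
    (p : {linear C -> C2}) :
  short_exact u p -> ext_free C1 -> ext_free C2 -> ext_free C.
Proof.
by move=> up e1 e2 N sN; apply: ext_zero_extension up (e1 N sN) (e2 N sN).
Qed.

(** Vanishing for [K] at [N] follows from vanishing for [C] at the next syzygy of [N]. This is what
    forces [injective_syzygy] to be closed under kernels of free covers. *)
Lemma ext_free_syzygy (K F C : lmodType R) (k : {linear K -> F}) (q : {linear F -> C}) :
  short_exact k q -> flat_module F -> ext_free C -> ext_free K.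
Proof.
move=> kq flatF eC N sN.
apply: (ext_zero_syzygy kq (free_cover_dual_exact N)).
- exact: free_dual_injective.
- exact: ext_zero_flat.
- by apply: eC; right.
Qed.

Definition bidual_fun M (x : M) : cdual (opc R) (cdual (opv R) M) :=
  to_cdual (opc R) (additive_pack (fun f g : cdual (opv R) M =>
     erefl : cdual_fun (f - g) x = cdual_fun f x - cdual_fun g x)).

Lemma bidual_linear M : linear (@bidual_fun M).
Proof.
by move=> a x y; apply: cdualP => f; rewrite cdualPE -[LHS]/(cdual_fun f (a *: x + y)) raddfD.
Qed.
Definition bidual M : {linear M -> cdual (opc R) (cdual (opv R) M)} :=
  linear_pack (@bidual_linear M).

Lemma bidualE M (x : M) f : cdual_fun (bidual M x) f = cdual_fun f x. Proof. by []. Qed.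

Lemma bidual_inj M : injective (bidual M).
Proof.
apply: linear_inj => x ex; apply: (cdual_eq0 (c := opv R)) => f.
by rewrite -bidualE ex.
Qed.

(* the dual of [bidual M] is split by the [bidual] of the dual of [M] *)
Lemma flat_bidual_coker M (L : lmodType R) (q : {linear cdual (opc R) (cdual (opv R) M) -> L}) :
    flat_module (cdual (opc R) (cdual (opv R) M)) -> short_exact (bidual M) q ->
  flat_module L.
Proof.
move=> /flat_dual injD [_ eq qs]; apply/flat_dual.
pose D := cdual (opc R) (cdual (opv R) M).
pose s := swap (@opvK R) (idfun : {linear D -> D}); pose e' := cdual_map (opv R) (bidual M).
have e's f : e' (s f) = f by apply: cdualP => x.
have qi := cdual_map_inj (c := opv R) qs.
have [r rP] : exists h : {linear cdual (opv R) (cdual (opc R) (cdual (opv R) M)) ->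
    cdual (opv R) L}, forall x, cdual_map (opv R) q (h x) = x - s (e' x).
  apply: (@factor_inj _ _ _ _ _ (idfun \- (s \o e'))) => // x.
  by apply/(cdual_exact (c := opv R) eq); rewrite -[LHS]/(e' (x - s (e' x))) linearB e's subrr.
apply: (injective_retractW (i := cdual_map (opv R) q) (r := r) injD) => x.
apply: qi; rewrite rP -/e' (_ : e' _ = 0) ?linear0 ?addr0 //.
exact: (exact_comp0 x (cdual_exact (c := opv R) eq)).
Qed.

(* Replacing a flat module by its bidual in a coresolution adds a flat quotient to the
   cokernel, which this class absorbs. *)
Definition flat_by_cycle C : Prop :=
  exists (G L : lmodType R) (u : {linear G -> C}) (p : {linear C -> L}),
    [/\ flat_cycle G, flat_module L & short_exact u p].

Lemma ext_free_flat_by_cycle C : flat_by_cycle C -> ext_free C.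
Proof.
move=> [G [L [u [p [cG fL up]]]]].
by apply: (ext_free_extension up); [exact: ext_free_cycle|exact: ext_free_flat].
Qed.

Lemma cycle_flat_by_cycle C : flat_cycle C -> flat_by_cycle C.
Proof.
move=> cC; exists C, (coker (@idfun C)), idfun, (coker_proj idfun).
have z0 (z : coker (@idfun C)) : z = 0.
  have [x <-] := quotmod_surj z.
  by apply/quotmod_proj0/(submod_gen_range (idfun : {linear C -> C})); exists x.
split=> //; first by move=> A B i _; apply: linear_inj => t _; have [s ->] := tensor_sum t;
  rewrite big1 // => w _; rewrite (z0 w.2) pure0r.
split=> //; first exact: (coker_exact (idfun : {linear C -> C})).
by move=> z; exact: quotmod_surj.
Qed.

End ModuleClasses.

Section FlatByCycleStep.
Variable R : pzRingType.

(** [Y] is the pushout of [u] and [i], so it inherits both cokernels. For [F] and [L] flat it is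
    flat, and it contains [C] with quotient [G1]. *)
Lemma pushout_short_exact (G C L F G1 : lmodType R) (u : {linear G -> C})
    (p : {linear C -> L}) (i : {linear G -> F}) (p1 : {linear F -> G1}) :
    short_exact u p -> short_exact i p1 ->
  exists (Y : lmodType R) (a : {linear C -> Y}) (a' : {linear Y -> G1})
         (b : {linear F -> Y}) (b' : {linear Y -> L}),
    short_exact a a' /\ short_exact b b'.
Proof.
move=> [ui up ps] [ii ip p1s].
have dL : linear (fun g => (u g, - i g) : (C * F)%type).
  by move=> k x y; rewrite (linearP u) (linearP i) opprD -scalerN.
pose d := linear_pack dL; pose Y := coker d; pose y := coker_proj d.
have y0 c f : y (c, f) = 0 -> exists g, c = u g /\ f = - i g.
  by move=> /coker_exact[g [<- <-]]; exists g.
have yd g : y (u g, - i g) = 0 by apply/coker_exact; exists g.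
have aL : linear (fun c => y (c, 0)).
  move=> k c c'; rewrite -linearP; congr (y _).
  by rewrite -[RHS]/(_, k *: 0 + 0) scaler0 addr0.
have bL : linear (fun f => y (0, f)).
  move=> k f f'; rewrite -linearP; congr (y _).
  by rewrite -[RHS]/(k *: 0 + 0, _) scaler0 addr0.
have ys : forall z, exists x, y x = z by exact: quotmod_surj.
have [|a' a'P] := @factor_surj _ _ _ _ y (p1 \o snd) ys.
  by move=> [c f] /y0[g [_ ->]] /=; rewrite linearN (exact_comp0 _ ip) oppr0.
have [|b' b'P] := @factor_surj _ _ _ _ y (p \o fst) ys.
  by move=> [c f] /y0[g [-> _]] /=; rewrite (exact_comp0 _ up).
exists Y, (linear_pack aL), a', (linear_pack bL), b'; split; split.
- by apply: linear_inj => c /y0[g [-> /esym/eqP]]; rewrite oppr_eq0 => /eqP/(inj_eq0 ii) ->;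
    rewrite linear0.
- move=> z; split=> [|[c <-]]; last by rewrite a'P /= linear0.
  have [[c f] <-] := ys z; rewrite a'P /= => /ip[g <-]; exists (c + u g).
  rewrite /= -[LHS]subr0 -(yd g) -linearB; congr (y _).
  by rewrite -[LHS]/(c + u g - u g, 0 - - i g) addrK opprK add0r.
- by move=> z; have [f <-] := p1s z; exists (y (0, f)); rewrite a'P.
- by apply: linear_inj => f /y0[g [/esym/(inj_eq0 ui) -> ->]]; rewrite linear0 oppr0.
- move=> z; split=> [|[c <-]]; last by rewrite b'P /= linear0.
  have [[c f] <-] := ys z; rewrite b'P /= => /up[g <-]; exists (f + i g).
  rewrite /= -[LHS]addr0 -(yd g) -linearD; congr (y _).
  by rewrite -[LHS]/(0 + u g, f + i g - i g) addrK add0r.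
- by move=> z; have [f <-] := ps z; exists (y (f, 0)); rewrite b'P.
Qed.

(** Embed [G] in a flat [F] with a cycle [G1] as quotient; the pushout [Y] is flat and contains [C].
    Take [E = Y^+]. The quotient of [Y^++] by [C] is an extension of the flat module [Y^++/Y] by
    [Y/C], which is [G1], so the class is preserved. *)
Lemma flat_by_cycle_step (C : lmodType R) : left_noetherian R^c -> flat_by_cycle C ->
  exists (E : lmodType R^c) (j : {linear C -> cdual (opc R) E}),
    [/\ injective_module E, flat_module (cdual (opc R) E), injective j
      & forall (C' : lmodType R) (q : {linear cdual (opc R) E -> C'}),
          short_exact j q -> flat_by_cycle C'].
Proof.
move=> noeth [G [L [u [p [cG fL up]]]]].
have [G1 [cG1 [F [i [p1 [fF ip _]]]]]] := flat_cycle_succ cG.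
have [Y [a [a' [b [b' [[ai aa' a's] bb']]]]]] := pushout_short_exact up ip.
have /flat_dual injE := flat_extension bb' fF fL.
have fE := injective_dual_flat noeth injE.
pose j : {linear C -> cdual (opc R) (cdual (opv R) Y)} := bidual Y \o a.
exists (cdual (opv R) Y), j; split=> //.
  by move=> x x' /bidual_inj/ai.
move=> C' q [_ jq qs]; exists G1, (coker (bidual Y)).
have [|u' u'P] := @factor_surj _ _ _ _ a' (q \o bidual Y) a's.
  by move=> x /aa'[c <-]; exact: (exact_comp0 c jq).
have [|p' p'P] := @factor_surj _ _ _ _ q (coker_proj (bidual Y)) qs.
  by move=> _ /jq[c <-]; exact: exact_comp0 (@coker_exact _ _ _ (bidual Y)).
have cs : forall z, exists x, coker_proj (bidual Y) x = z by exact: quotmod_surj.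
exists u', p'; split=> //.
  by apply: flat_bidual_coker fE _; split; [exact: bidual_inj|exact: coker_exact|exact: cs].
split.
- apply: linear_inj => z; have [y <-] := a's z; rewrite u'P => /jq[c /bidual_inj <-].
  exact: exact_comp0 aa'.
- move=> z; have [e <-] := qs z; rewrite p'P; split=> [/coker_exact[y <-]|[w we]].
    by exists (a' y); rewrite u'P.
  rewrite -p'P -we; have [y <-] := a's w; rewrite u'P /= p'P.
  exact: exact_comp0 (@coker_exact _ _ _ (bidual Y)).
- by move=> z; have [e <-] := cs z; exists (q e); rewrite p'P.
Qed.

End FlatByCycleStep.

(** * Forests *)

Definition last_arrow (T : quiver) (v w : vertex T) (p : qpath v w) : option (arrow T) :=
  if p is qpath_snoc a _ then Some a else None.

(** Paths to [w] and to [w'] have different types, but their last arrows can be compared. Uniqueness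
    of paths will thus show that no two arrows share a target, and that none ends at the root. *)
Lemma root_last_arrow (T : quiver) (v0 w w' : vertex T) (p : qpath v0 w)
    (p' : qpath v0 w') : is_root v0 -> w = w' -> last_arrow p = last_arrow p'.
Proof.
move=> r e; case: _ / e p' => p'.
by have [q qP] := r w; rewrite (qP p) (qP p').
Qed.

(** The graph of a function defined by recursion along arrows. A relation is used because [target a]
    is not a constructor on which a dependent function could be defined by matching. *)
Inductive rec_graph (Q : quiver) (T : vertex Q -> Type) (b : forall v, T v)
    (s : forall a : arrow Q, T (source a) -> T (target a)) :
    forall v : vertex Q, T v -> Prop :=
| rec_graph0 v : (forall a : arrow Q, target a <> v) -> rec_graph b s (b v)
| rec_graphS (a : arrow Q) x : rec_graph b s x -> rec_graph b s (s a x).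

Definition anc (Q : quiver) (v w : vertex Q) : Prop := inhabited (qpath v w).

Section Forest.
Variable Q : quiver.
Hypothesis hforest : is_forest Q.

Lemma forest_target_inj (a b : arrow Q) : target a = target b -> a = b.
Proof.
move=> e; have [v0 r] := hforest (source a).
have la : `[< linked (source a) (source a) >] by apply/asboolP; exact: rst_refl.
have lb : `[< linked (source a) (source b) >].
  apply/asboolP; apply: (@rst_trans _ _ _ (target b)).
    by apply: rst_step; exists a.
  by apply: rst_sym; apply: rst_step; exists b.
pose a' : arrow (component (source a)) := exist _ a la.
pose b' : arrow (component (source a)) := exist _ b lb.
have [p _] := r (source a'); have [q _] := r (source b').
have : last_arrow (qpath_snoc p) = last_arrow (qpath_snoc q).
  by apply: root_last_arrow => //; exact: val_inj.
by move=> -[].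
Qed.

(** Induction on the path from the root of the component. An arrow ending at the root would give a
    second, nontrivial path from the root to itself. *)
Lemma forest_ind (P : vertex Q -> Prop) :
    (forall v, (forall a : arrow Q, target a <> v) -> P v) ->
    (forall a : arrow Q, P (source a) -> P (target a)) ->
  forall v, P v.
Proof.
move=> P0 PS v; have [v0 r] := hforest v.
have lv : `[< linked v v >] by apply/asboolP; exact: rst_refl.
suff h (w : vertex (component v)) : qpath v0 w -> P (val w).
  by have [p _] := r (exist _ v lv : vertex (component v)); exact: h p.
elim=> [|a q IH]; last exact: PS.
apply: P0 => a e.
have la : `[< linked v (source a) >].
  apply/asboolP; apply: (@rst_trans _ _ _ (target a)).
    by rewrite e; apply/asboolP; exact: valP v0.
  by apply: rst_sym; apply: rst_step; exists a.
pose a' : arrow (component v) := exist _ a la.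
have [p _] := r (source a').
have : last_arrow (qpath_snoc p) = last_arrow (qpath_nil v0).
  by apply: root_last_arrow => //; exact: val_inj.
by [].
Qed.

Section Recursion.
Variables (T : vertex Q -> Type) (good : forall v, T v -> Prop)
  (rel : forall a : arrow Q, T (source a) -> T (target a) -> Prop).

(** Successive choices down the trees: [good] is the invariant that makes the next choice possible,
    and [rel] the compatibility along an arrow. Families of maps commuting with the structure maps
    are built in this way. *)
Lemma forest_rec :
    (forall v, (forall a : arrow Q, target a <> v) -> exists x : T v, good x) ->
    (forall (a : arrow Q) (x : T (source a)), good x ->
       exists y : T (target a), good y /\ rel x y) ->
  exists h : forall v, T v, (forall v, good (h v)) /\
    forall a : arrow Q, rel (h (source a)) (h (target a)).
Proof.
move=> base step.
have inhT v : inhabited (T v).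
  have : exists x : T v, good x; last by move=> [x _].
  elim/forest_ind: v => [v /base //|a [x /step[y [gy _]]]]; by exists y.
have [b bP] : exists b : forall v, T v,
    forall v, (forall a : arrow Q, target a <> v) -> good (b v).
  suff bP v : exists x : T v, (forall a : arrow Q, target a <> v) -> good x.
    by exists (fun v => projT1 (cid (bP v))) => v; exact: projT2 (cid (bP v)).
  have [[x gx]|none] := pselect (exists x : T v, good x); first by exists x.
  by have [x] := inhT v; exists x => /base.
have [s sP] : exists s : forall a : arrow Q, T (source a) -> T (target a),
    forall a x, good x -> good (s a x) /\ rel x (s a x).
  suff sP a (x : T (source a)) : exists y, good x -> good y /\ rel x y.
    exists (fun a x => projT1 (cid (sP a x))) => a x.
    exact: projT2 (cid (sP a x)).
  have [gx|nx] := pselect (good x); first by have [y yP] := step a x gx; exists y.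
  by have [y] := inhT (target a); exists y.
have gE v : exists x : T v, rec_graph b s x.
  elim/forest_ind: v => [v h|a [x gx]]; first by exists (b v); left.
  by exists (s a x); right.
(* Inversion of the graph goes through a propositional equality of targets; as the arrow is
   determined by its target, the cast is trivial. *)
have ginvS v (y : T v) : rec_graph b s y -> forall a (e : target a = v),
    exists x, rec_graph b s x /\ y = ecast w (T w) e (s a x).
  case=> [w h a e|a x gx a' e]; first by case: (h a e).
  have aa := forest_target_inj e; case: _ / aa e x gx => e x gx.
  by exists x; rewrite (eq_axiomK e).
have ginv0 v (y : T v) : rec_graph b s y -> (forall a : arrow Q, target a <> v) -> y = b v.
  by case=> // a x _ /(_ a).
have guniq v : forall x y : T v, rec_graph b s x -> rec_graph b s y -> x = y.
  elim/forest_ind: v => [v h x y gx gy|a IH x y gx gy].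
    by rewrite (ginv0 _ _ gx h) (ginv0 _ _ gy h).
  have [x' [gx' ->]] := ginvS _ _ gx a erefl.
  have [y' [gy' ->]] := ginvS _ _ gy a erefl.
  by rewrite (IH _ _ gx' gy').
have ggood v (x : T v) : rec_graph b s x -> good x.
  by elim=> [w|a y _ gx]; [exact: bP|have [] := sP a y gx].
exists (fun v => projT1 (cid (gE v))); split=> [v|a].
  exact: ggood (projT2 (cid (gE v))).
have g1 := projT2 (cid (gE (source a))); have g2 := projT2 (cid (gE (target a))).
rewrite (guniq _ _ _ g2 (rec_graphS (a := a) g1)).
by have [] := sP a _ (ggood _ _ g1).
Qed.
End Recursion.

Lemma anc_refl (v : vertex Q) : anc v v. Proof. by split; left. Qed.

Lemma anc_snoc (v : vertex Q) (a : arrow Q) : anc v (source a) -> anc v (target a).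
Proof. by move=> [p]; split; right. Qed.

Lemma anc_trans (u v w : vertex Q) : anc u v -> anc v w -> anc u w.
Proof. by move=> uv [p]; elim: p => // a q; exact: anc_snoc. Qed.

Lemma anc_cons (a : arrow Q) (v : vertex Q) : anc (target a) v -> anc (source a) v.
Proof. by apply: anc_trans; apply: anc_snoc; exact: anc_refl. Qed.

Lemma anc_inv (v w : vertex Q) :
  anc v w -> v = w \/ exists a : arrow Q, target a = w /\ anc v (source a).
Proof. by case; case=> [|a p]; [left|right; exists a; split]. Qed.

Lemma anc_target (v : vertex Q) (a : arrow Q) :
  anc v (target a) -> v = target a \/ anc v (source a).
Proof.
by move=> /anc_inv[->|[b [/forest_target_inj -> h]]]; [left|right].
Qed.

Lemma forest_depth : exists d : vertex Q -> nat, forall a, d (target a) = (d (source a)).+1.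
Proof.
have [v _|a x _|h [_ hP]] := @forest_rec (fun _ => nat) (fun _ _ => True)
  (fun a m n => n = m.+1).
- by exists 0%N.
- by exists x.+1.
by exists h.
Qed.

Lemma anc_depth (d : vertex Q -> nat) v w :
  (forall a, d (target a) = (d (source a)).+1) -> anc v w -> (d v <= d w)%N.
Proof. by move=> dP [p]; elim: p => // a q /leq_trans; apply; rewrite dP. Qed.

Lemma anc_acyclic (a : arrow Q) : ~ anc (target a) (source a).
Proof.
by have [d dP] := forest_depth => /(anc_depth dP); rewrite dP ltnn.
Qed.

Lemma source_neq_target (a : arrow Q) : source a <> target a.
Proof. by move=> e; apply: (@anc_acyclic a); rewrite e; exact: anc_refl. Qed.

Lemma anc_finite (v : vertex Q) : finite_set (fun w => anc w v).
Proof.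
elim/forest_ind: v => [v h|a IH].
  apply: sub_finite_set (finite_set1 v) => w /anc_inv[->//|[a [e _]]].
  by case: (h a).
apply: (@sub_finite_set _ _ ((fun w => anc w (source a)) `|` [set target a])%classic).
  by move=> w /anc_target[->|]; [right|left].
by rewrite finite_setU.
Qed.
End Forest.

(** * Injective representations *)

Section Restriction.
Variables (R : pzRingType) (P : Prop) (A : lmodType R).

(** [A] if [P] holds and [0] otherwise. Being a submodule of [A] in both cases, it avoids a case
    distinction between types, and copies for different [P] are compared inside [A]. *)
Definition restr : lmodType R := submod (fun x : A => P \/ x = 0).
Definition rval : {linear restr -> A} := @submod_val _ _ _.

Lemma rval_inj : injective rval. Proof. exact: val_inj. Qed.

Lemma rval_out x : ~ P -> rval x = 0.
Proof.
move=> nP; have h : forall y : A, submod_gen (fun x : A => P \/ x = 0) y -> y = 0.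
  by move=> y; elim=> [//|a u v [//|->] _ ->]; rewrite scaler0 addr0.
exact: h (submod_valP x).
Qed.

Lemma rmk_ex : exists h : {linear A -> restr}, forall x, rval (h x) = if `[< P >] then x else 0.
Proof.
have [p|nP] := asboolP P.
  apply: (@factor_inj _ _ _ _ rval idfun) => [|x]; first exact: rval_inj.
  by apply: submod_ex; apply: submod_gen1; left.
by exists \0 => x; rewrite linear0.
Qed.

Definition rmk : {linear A -> restr} := projT1 (cid rmk_ex).

Lemma rmk_in x : P -> rval (rmk x) = x.
Proof. by move=> p; rewrite (projT2 (cid rmk_ex)); case: asboolP. Qed.

Lemma rmk_out x : ~ P -> rmk x = 0.
Proof.
by move=> nP; apply: rval_inj; rewrite (projT2 (cid rmk_ex)) (linear0 rval); case: asboolP.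
Qed.

Lemma rvalK x : rmk (rval x) = x.
Proof.
have [p|nP] := pselect P; first by apply: rval_inj; rewrite rmk_in.
by apply: rval_inj; rewrite !(rval_out _ nP).
Qed.
End Restriction.

Section Onset.
Variables (Q : quiver) (S : pzRingType).
Local Notation rrep := (rep (opposite Q) S).
Implicit Types (X : rrep) (U W : vertex Q -> Prop) (A B : lmodType S).

Definition omap X (a : arrow Q) : {linear X (target a) -> X (source a)} :=
  @rep_map (opposite Q) S X a.

Lemma omap_natural X Y (f : rep_hom X Y) (a : arrow Q) x :
  f (source a) (omap X a x) = omap Y a (f (target a) x).
Proof. exact: (@rep_natural _ _ _ _ f a). Qed.

(* [A] at the vertices of [U], with identity maps between them *)
Definition onset U A : rrep :=
  @Rep (opposite Q) S (fun v => restr (U v) A) (fun a => rmk _ _ \o rval _ _).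

Lemma onset_omap U A a x : omap (onset U A) a x = rmk (U (source a)) A (rval _ _ x).
Proof. by []. Qed.

Lemma onset_map_natural U A B (f : {linear A -> B}) (a : arrow Q)
    (x : onset U A (target a)) :
  rmk (U (source a)) B (f (rval _ _ (omap (onset U A) a x))) =
  omap (onset U B) a (rmk (U (target a)) B (f (rval _ _ x))).
Proof.
rewrite !onset_omap; have [Us|Us] := pselect (U (source a)); last by rewrite !rmk_out.
rewrite rmk_in //; have [Ut|Ut] := pselect (U (target a)); first by rewrite rmk_in.
by rewrite (rval_out _ Ut) !linear0.
Qed.

Definition onset_map U A B (f : {linear A -> B}) : rep_hom (onset U A) (onset U B) :=
  @RepHom (opposite Q) S (onset U A) (onset U B) (fun v => rmk _ _ \o (f \o rval _ _))
    (@onset_map_natural U A B f).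

Lemma onset_map_mono U A B (f : {linear A -> B}) :
  injective f -> rep_mono (onset_map U f).
Proof.
move=> fi v; apply: linear_inj => x /= e; apply: rval_inj; rewrite linear0.
have [Uv|Uv] := pselect (U v); last exact: rval_out.
by apply: (inj_eq0 fi); rewrite -(rmk_in (f _) Uv) e linear0.
Qed.

Section Inclusion.
Variables (U W : vertex Q -> Prop) (A : lmodType S).
Hypothesis WU : forall v, W v -> U v.
Hypothesis Wclosed : forall a : arrow Q, W (target a) -> U (source a) -> W (source a).

(** The structure maps run from target to source, so a part of [U] that is closed under predecessors
    within [U] carries a subrepresentation. *)
Lemma onset_incl_natural (a : arrow Q) (x : onset W A (target a)) :
  rmk (U (source a)) A (rval _ _ (omap (onset W A) a x)) =
  omap (onset U A) a (rmk (U (target a)) A (rval _ _ x)).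
Proof.
rewrite !onset_omap; have [Wt|Wt] := pselect (W (target a)); last first.
  by rewrite (rval_out _ Wt) !linear0.
rewrite (rmk_in _ (WU Wt)); have [Us|Us] := pselect (U (source a)).
  by rewrite rmk_in //; exact: Wclosed.
by rewrite !rmk_out.
Qed.

Definition onset_incl : rep_hom (onset W A) (onset U A) :=
  @RepHom (opposite Q) S (onset W A) (onset U A) (fun v => rmk _ _ \o rval _ _)
    onset_incl_natural.

Lemma onset_incl_mono : rep_mono onset_incl.
Proof.
move=> v; apply: linear_inj => x /= e; apply: rval_inj; rewrite linear0.
have [Wv|Wv] := pselect (W v); last exact: rval_out.
by rewrite -(rmk_in (rval _ _ x) (WU Wv)) e linear0.
Qed.
End Inclusion.

(* the families of maps underlying the morphisms [onset U A -> X] *)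
Definition cofam U A X (g : forall v : vertex Q, {linear A -> X v}) : Prop :=
  (forall v, ~ U v -> forall x, g v x = 0) /\
  (forall a : arrow Q, U (target a) -> forall x,
     omap X a (g (target a) x) = g (source a) x).

Lemma cofam_hom U A X g : @cofam U A X g ->
  exists h : rep_hom (onset U A) X, forall v x, h v x = g v (rval _ _ x).
Proof.
move=> [g0 gE].
have nat (a : arrow Q) (x : onset U A (target a)) :
    g (source a) (rval _ _ (omap (onset U A) a x)) =
    omap X a (g (target a) (rval _ _ x)).
  rewrite onset_omap; have [Ut|Ut] := pselect (U (target a)); last first.
    by rewrite (rval_out _ Ut) !linear0.
  rewrite gE //; have [Us|Us] := pselect (U (source a)); first by rewrite rmk_in.
  by rewrite !g0.
by exists (@RepHom (opposite Q) S (onset U A) X (fun v => g v \o rval _ _) nat).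
Qed.

Lemma hom_cofam U A X (h : rep_hom (onset U A) X) :
  @cofam U A X (fun v => h v \o rmk _ _).
Proof.
split=> [v Uv x|a Ut x]; first by rewrite /= rmk_out // linear0.
rewrite -[LHS]/(omap X a (h (target a) (rmk _ _ x))) -omap_natural onset_omap.
by rewrite rmk_in.
Qed.

Lemma cofam_extend U W A X g : injective_rep X ->
    (forall v, W v -> U v) ->
    (forall a : arrow Q, W (target a) -> U (source a) -> W (source a)) ->
    @cofam W A X g ->
  exists g', @cofam U A X g' /\ forall v, W v -> forall x, g' v x = g v x.
Proof.
move=> injX WU Wc /cofam_hom[h hP].
have [h' h'P] := injX _ _ (onset_incl A WU Wc) h (@onset_incl_mono _ _ A WU Wc).
exists (fun v => h' v \o rmk _ _); split; first exact: hom_cofam.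
move=> v Wv x /=; have := h'P v (rmk _ _ x); rewrite hP rmk_in // => <-.
by rewrite /= rmk_in.
Qed.

Lemma cofam_extend_mono U A B X g (i : {linear A -> B}) :
    injective_rep X -> injective i -> @cofam U A X g ->
  exists g', @cofam U B X g' /\ forall v x, g' v (i x) = g v x.
Proof.
move=> injX ii gc; have [h hP] := cofam_hom gc.
have [h' h'P] := injX _ _ (onset_map U i) h (onset_map_mono (U := U) ii).
exists (fun v => h' v \o rmk _ _); split; first exact: hom_cofam.
move=> v x /=; have [Uv|Uv] := pselect (U v); last first.
  by rewrite rmk_out // linear0; have [-> //] := gc.
by have := h'P v (rmk _ _ x); rewrite hP rmk_in //= rmk_in.
Qed.

Lemma update_family A (X : vertex Q -> lmodType S) (g : forall v, {linear A -> X v}) v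
    (f : {linear A -> X v}) :
  exists g' : forall v, {linear A -> X v}, g' v = f /\ forall w, w <> v -> g' w = g w.
Proof.
exists (fun w => if pselect (v = w) is left e then ecast u {linear A -> X u} e f else g w).
split; first by case: pselect => // e; rewrite (eq_axiomK e).
by move=> w wv; case: pselect => // e; case: wv.
Qed.

Hypothesis hforest : is_forest Q.

(** In a forest the representation that is constant on the ancestors of [v] is induced from [A] at
    [v]: a morphism out of it is a map from [A] to [X v], transported up to the root by the
    structure maps. *)
Lemma anc_cofam A X v (f : {linear A -> X v}) :
  exists g, @cofam (fun w => anc w v) A X g /\ g v = f.
Proof.
elim/(forest_ind hforest): v f => [v root f|a IH f].
  have [g [gv g0]] := update_family (fun w => \0 : {linear A -> X w}) f.
  exists g; split=> //; split=> [w wv x|a /anc_inv[e|[b [e _]]] x].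
  - by rewrite g0 // => e; apply: wv; rewrite e; exact: anc_refl.
  - by case: (root a).
  - by case: (root b).
have [g [[g0 gE] ga]] := IH (omap X a \o f).
have [g' [g't g'E]] := update_family g f.
exists g'; split=> //.
split=> [w wv x|b /(anc_target hforest)[/(forest_target_inj hforest) ->|bs] x].
- rewrite g'E ?g0 // => [ws|e]; first by apply: wv; exact: anc_snoc.
  by apply: wv; rewrite e; exact: anc_refl.
- rewrite g't g'E ?ga //; exact: source_neq_target.
rewrite !g'E ?gE // => e.
  by apply: (anc_acyclic hforest (a := a)); rewrite -e; exact: anc_cons.
by apply: (anc_acyclic hforest (a := a)); rewrite -e.
Qed.

Section InjectiveRep.
Variables (X : rrep).
Hypothesis injX : injective_rep X.

(** Evaluation at [v] is right adjoint to induction from [v], which preserves monomorphisms. *)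
Lemma injective_rep_at v : injective_module (X v).
Proof.
move=> A B i f ii; have [g [gc gv]] := anc_cofam f.
have [g' [_ g'P]] := cofam_extend_mono injX ii gc.
by exists (g' v) => x; rewrite g'P gv.
Qed.

(** The element [y] is a morphism from the free representation at [source a], which embeds in the
    one at [target a]. The image of [1] under an extension is a preimage of [y]. *)
Lemma injective_rep_surj (a : arrow Q) y : exists x, omap X a x = y.
Proof.
have [g [gc gs]] := anc_cofam (smul y).
have [v|b bs _|g' [[_ g'E] g'g]] := cofam_extend (U := fun w => anc w (target a)) injX _ _ gc.
- exact: anc_snoc.
- exact: anc_cons.
exists (g' (target a) 1); rewrite g'E; last exact: anc_refl.
by rewrite g'g ?gs /= ?scale1r //; exact: anc_refl.
Qed.

(** Maps into this kernel are the morphisms from representations concentrated at [target a], since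
    [a] is the only arrow ending there. *)
Lemma injective_rep_kernel (a : arrow Q) : injective_module (kernel (omap X a)).
Proof.
move=> A B i f ii; pose k := kernel_val (omap X a).
have [g [gt g0]] := update_family (fun w => \0 : {linear A -> X w}) (k \o f).
have gc : cofam (fun w => w = target a) g.
  split=> [w wt x|b /(forest_target_inj hforest) -> x]; first by rewrite g0.
  rewrite gt g0; last exact: source_neq_target.
  exact: kernel_valP.
have [g' [[g'0 g'E] g'P]] := cofam_extend_mono injX ii gc.
have [|h hP] := @factor_inj _ _ _ _ k (g' (target a)) (@kernel_val_inj _ _ _ _).
  move=> x; apply/kernel_exact; rewrite g'E // g'0 //; exact: source_neq_target.
exists h => x; apply: (@kernel_val_inj _ _ _ (omap X a)).
by rewrite -/k hP g'P gt.
Qed.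
End InjectiveRep.

(** The extension is built downwards. Where an arrow starts in [U], the next value is forced by
    composition with the structure map, and it still extends [g]; elsewhere it is chosen by
    injectivity of [A]. *)
Lemma onset_injective U A : injective_module A ->
  (forall a : arrow Q, U (source a) -> U (target a)) -> injective_rep (onset U A).
Proof.
move=> injA Uc X Y i g im.
pose good v (h : {linear Y v -> A}) := U v -> forall x, h (i v x) = rval _ _ (g v x).
have [v _|a h gh|h [hgood hrel]] := @forest_rec Q hforest (fun v => {linear Y v -> A}) good
  (fun a h h' => U (source a) -> forall y, h' y = h (omap Y a y)).
- by have [h hP] := injA _ _ (i v) (rval _ _ \o g v) (im v); exists h => _ x; rewrite hP.
- have [Us|Us] := pselect (U (source a)).
    exists (h \o omap Y a); split=> // Ut x /=; rewrite -omap_natural gh //.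
    by rewrite omap_natural onset_omap rmk_in.
  have [h' h'P] := injA _ _ (i (target a)) (rval _ _ \o g _) (im _).
  by exists h'; split=> // _ x; rewrite h'P.
have nat (a : arrow Q) (y : Y (target a)) :
    rmk (U (source a)) A (h (source a) (omap Y a y)) =
    omap (onset U A) a (rmk (U (target a)) A (h (target a) y)).
  rewrite onset_omap; have [Us|Us] := pselect (U (source a)); last by rewrite !rmk_out.
  by rewrite rmk_in ?hrel //; exact: Uc.
exists (@RepHom (opposite Q) S Y (onset U A) (fun v => rmk _ _ \o h v) nat) => v x /=.
have [Uv|Uv] := pselect (U v); first by rewrite hgood // rvalK.
by apply: rval_inj; rewrite !(rval_out _ Uv).
Qed.

End Onset.

(** * Representations with injective structure maps *)

Lemma bij_short_exact (R : pzRingType) (Z M C : lmodType R) (f : {linear Z -> M})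
    (q : {linear M -> C}) : (forall z : Z, z = 0) ->
  short_exact f q <-> injective q /\ forall z, exists y, q y = z.
Proof.
move=> Z0; split=> [[_ fq qs]|[qi qs]]; split=> //.
- by apply: linear_inj => y /fq[x <-]; rewrite (Z0 x) linear0.
- by apply: linear_inj => x _; exact: Z0.
- move=> y; split=> [/(inj_eq0 qi) ->|[x <-]]; first by exists 0; rewrite linear0.
  by rewrite (Z0 x) !linear0.
Qed.

Section Incoming.
Variables (Q : quiver) (R : pzRingType).
Hypothesis hforest : is_forest Q.
Implicit Types (M : rep Q R).

Lemma incoming_root M v :
  (forall a : arrow Q, target a <> v) -> forall z : incoming_sum M v, z = 0.
Proof. by move=> root z; apply: dsumP => -[a e]; case: (root a); exact/eqP. Qed.

Definition incoming_arrow (a : arrow Q) : incoming (target a) := exist _ a (eqxx _).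

Lemma incoming_arrowE (a : arrow Q) (b : incoming (target a)) : b = incoming_arrow a.
Proof.
by apply: val_inj; case: b => b e /=; apply: (forest_target_inj hforest); exact/eqP.
Qed.

(** Only one arrow ends at [target a], so the incoming sum has a single summand and f_v is a
    structure map; at a root the sum is zero. *)
Lemma rep_f_target M (a : arrow Q) (z : incoming_sum M (target a)) :
  rep_f M (target a) z = rep_map M a (dsum_coef z (incoming_arrow a)).
Proof.
rewrite -[LHS]/(dsum_desc (@incoming_map Q R M (target a)) z).
rewrite (@dsum_descE _ _ _ _ _ [:: incoming_arrow a]) // => [|b _].
  rewrite big_seq1 /incoming_map.
  by rewrite (eq_axiomK (eqP (valP (incoming_arrow a)))).
by rewrite inE (incoming_arrowE b).
Qed.

Lemma rep_f_short_exact M (a : arrow Q) (C : lmodType R) (q : {linear M (target a) -> C}) :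
  short_exact (rep_f M (target a)) q <-> short_exact (rep_map M a) q.
Proof.
have coefP (x : M (source a)) : exists z : incoming_sum M (target a),
    dsum_coef z (incoming_arrow a) = x.
  pose F (b : incoming (target a)) := M (source (val b)).
  by exists (@single R _ F (incoming_arrow a) x); exact: (@single_coefE R _ F).
have ex y : (exists z, rep_f M (target a) z = y) <-> exists x, rep_map M a x = y.
  split=> [[z <-]|[x <-]]; first by rewrite rep_f_target; eexists.
  by have [z zx] := coefP x; exists z; rewrite rep_f_target zx.
split=> -[fi fq qs]; split=> //.
- apply: linear_inj => x; have [z <-] := coefP x; rewrite -rep_f_target => /(inj_eq0 fi) ->.
  by [].
- by move=> y; rewrite -ex.
- move=> x y; rewrite !rep_f_target => /fi e; apply: dsumP => b.
  by rewrite (incoming_arrowE b).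
- by move=> y; rewrite ex.
Qed.

(* the condition of the theorem, for cokernels in [Phi] *)
Definition good (Phi : lmodType R -> Prop) M : Prop :=
  forall v, exists (C : lmodType R) (q : {linear M v -> C}),
    short_exact (rep_f M v) q /\ Phi C.

Lemma good_target Phi M (a : arrow Q) : good Phi M ->
  exists (C : lmodType R) (q : {linear M (target a) -> C}),
    short_exact (rep_map M a) q /\ Phi C.
Proof. by move=> /(_ (target a))[C [q [/rep_f_short_exact h ?]]]; exists C, q. Qed.

Lemma good_root Phi M v : good Phi M -> (forall a : arrow Q, target a <> v) ->
  exists (C : lmodType R) (q : {linear M v -> C}),
    [/\ injective q, forall z, exists y, q y = z & Phi C].
Proof.
move=> /(_ v)[C [q [h ?]]] root; exists C, q.
by have [] := iffLR (bij_short_exact _ _ (incoming_root root)) h.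
Qed.

Lemma goodP Phi M :
    (forall v, (forall a : arrow Q, target a <> v) ->
       exists (C : lmodType R) (q : {linear M v -> C}),
       [/\ injective q, forall z, exists y, q y = z & Phi C]) ->
    (forall a : arrow Q, exists (C : lmodType R) (q : {linear M (target a) -> C}),
       short_exact (rep_map M a) q /\ Phi C) ->
  good Phi M.
Proof.
move=> base step; elim/(forest_ind hforest) => [v root|a _].
  have [C [q [qi qs PC]]] := base v root; exists C, q; split=> //.
  exact/(bij_short_exact _ _ (incoming_root root)).
have [C [q [h PC]]] := step a; exists C, q; split=> //.
exact/rep_f_short_exact.
Qed.

Lemma flat_iso (M C : lmodType R) (q : {linear M -> C}) :
  injective q -> (forall z, exists y, q y = z) -> flat_module C -> flat_module M.
Proof.
move=> qi qs /flat_dual injC; apply/flat_dual.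
have [r rP] := @factor_surj _ _ _ _ q idfun qs (fun x => inj_eq0 qi (x := x)).
apply: (injective_retractW (i := cdual_map (opv R) r) (r := cdual_map (opv R) q) injC) => x.
by apply: cdualP => y; rewrite !cdual_mapE rP.
Qed.

(** Extending a morphism [A -> M^+] to [B] means finding pairings [M v -> (B v)^+] compatible along
    arrows. At [target a], flatness of the cokernel [C] extends the pairing from [source a] to some
    [y1]. Its defect [d] on [A] vanishes on the image of [M (source a)], so it is a map to [C^+],
    which extends to [B] because [C^+] is injective. *)
Lemma good_flat_rep M : good (@flat_module R) M -> flat_rep M.
Proof.
move=> gM; apply/flat_rep_dual => A B i g im.
pose gd v (h : {linear M v -> cdual (opc R) (B v)}) :=
  forall y e, cdual_fun (h y) (i v e) = cdual_fun (g v e) y.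
have [v root|a h gh|h [hgood hrel]] := @forest_rec Q hforest
  (fun v => {linear M v -> cdual (opc R) (B v)}) gd
  (fun a h h' => forall y, h' (rep_map M a y) = cdual_map (opc R) (omap B a) (h y)).
- have [C [q [qi qs fC]]] := good_root gM root.
  have /flat_dual injM := flat_iso qi qs fC.
  have [h hP] := injM _ _ (i v) (g v) (im v).
  by exists (swap (@opcK R) h) => y e; rewrite swapE hP.
- have [C [q [[fi fq qs] fC]]] := good_target a gM.
  have [|y1 y1P] := ext_zero_flat fC (N := B (target a))
    (j := rep_map M a) (q := q) (g := cdual_map (opc R) (omap B a) \o h) qs fq.
    by move=> x /(inj_eq0 fi) ->; rewrite linear0.
  pose d := swap (@opcK R) (g (target a)) \- (cdual_map (opc R) (i (target a)) \o y1).
  have gnat e z : cdual_fun (g (target a) e) (rep_map M a z) =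
      cdual_fun (g (source a) (omap A a e)) z by rewrite omap_natural.
  have [|d' d'P] := @factor_surj _ _ _ _ q d qs.
    move=> _ /fq[z <-]; apply: cdualP => e.
    rewrite -[LHS]/(cdual_fun (g (target a) e) (rep_map M a z) -
      cdual_fun (y1 (rep_map M a z)) (i (target a) e)).
    rewrite y1P gnat -gh omap_natural.
    exact: subrr.
  have /flat_dual injC := fC.
  have [k kP] := injC _ _ (i (target a)) (swap (@opvK R) d') (im (target a)).
  exists (y1 \+ (swap (@opcK R) k \o q)); split=> [y e|y].
    rewrite -[LHS]/(cdual_fun (y1 y) (i _ e) + cdual_fun (k (i _ e)) (q y)) kP swapE d'P.
    rewrite -[X in _ + X]/(cdual_fun (g (target a) e) y - cdual_fun (y1 y) (i (target a) e)).
    by rewrite addrC subrK.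
  rewrite -[LHS]/(y1 (rep_map M a y) + swap (@opcK R) k (q (rep_map M a y))).
  by rewrite (exact_comp0 _ fq) linear0 addr0 y1P.
pose hh : rep_hom M (drepc B) := @RepHom _ _ M (drepc B) h hrel.
exists (rep_swap hh) => v e; apply: cdualP => y.
exact: hgood.
Qed.

(** Ext^1(M, E^+) = 0 follows from the same vanishing for the cokernels. At [target a] the new map
    must extend both [h] on [K (target a)] and the map already chosen on [P (source a)]. The sum of
    these two modules maps to [P (target a)] with cokernel [C], but not injectively, whence the form
    of [ext_zero]. *)
Lemma rep_ext_free (K P M : rep Q R) (i : rep_hom K P) (q : rep_hom P M)
    (E : rep (opposite Q) R^c) (h : rep_hom K (drepc E)) :
    (forall v, short_exact (i v) (q v)) -> good (@ext_free R) M -> injective_rep E ->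
  exists h' : rep_hom P (drepc E), forall v x, h' v (i v x) = h v x.
Proof.
move=> iq gM injE.
have sE v : injective_syzygy (E v) by left; exact: injective_rep_at.
pose gd v (g : {linear P v -> cdual (opc R) (E v)}) := forall x, g (i v x) = h v x.
have [v root|a g gg|g [ggood grel]] := @forest_rec Q hforest
  (fun v => {linear P v -> cdual (opc R) (E v)}) gd
  (fun a g g' => forall y, g' (rep_map P a y) = cdual_map (opc R) (omap E a) (g y)).
- have [C [r [ri rs eC]]] := good_root gM root; have [ii ex qs] := iq v.
  have [z|y|x /(inj_eq0 ii) ->|g gP] := eC _ (sE v) _ _ (i v) (r \o q v) (h v).
  + by have [y <-] := rs z; have [x <-] := qs y; exists x.
  + by split=> [/(inj_eq0 ri)/ex//|/ex e] /=; rewrite e linear0.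
  + exact: linear0.
  by exists g.
- have [C [r [[fi fr rs] eC]]] := good_target a gM.
  have [ii ex qs] := iq (target a); have [ii' ex' qs'] := iq (source a).
  have jL : linear (fun z : (K (target a) * P (source a))%type =>
      i (target a) z.1 + rep_map P a z.2).
    by move=> c z z' /=; rewrite !linearP scalerDr addrACA.
  have gL : linear (fun z : (K (target a) * P (source a))%type =>
      h (target a) z.1 + cdual_map (opc R) (omap E a) (g z.2)).
    move=> c z z'; rewrite -[LHS]/(h (target a) (c *: z.1 + z'.1) +
      cdual_map (opc R) (omap E a) (g (c *: z.2 + z'.2))).
    by rewrite !linearP scalerDr addrACA.
  have [z|y|[k x] e|g' g'P] := eC _ (sE (target a)) _ _ (linear_pack jL) (r \o q _)
    (linear_pack gL).
  + by have [y <-] := rs z; have [x <-] := qs y; exists x.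
  + split=> [/fr[m mq]|[[k x] <-]].
      have [x xm] := qs' m.
      have /ex[k kP] : q (target a) (y - rep_map P a x) = 0.
        by rewrite linearB rep_natural xm mq subrr.
      by exists (k, x); rewrite /= kP subrK.
    by rewrite /= linearD rep_natural (exact_comp0 _ ex) add0r (exact_comp0 _ fr).
  (* The kernel of the sum map is [K (source a)], embedded with opposite signs; on it the two
     prescriptions cancel by naturality of [h]. *)
  + have /eqP := e; rewrite /= addr_eq0 => /eqP e'.
    have /ex'[k' k'P] : q (source a) x = 0.
      apply: (inj_eq0 fi); rewrite -rep_natural -[rep_map P a x]opprK -e' linearN.
      by rewrite (exact_comp0 _ ex) oppr0.
    have kk : k = - rep_map K a k'.
      by apply: ii; rewrite e' linearN rep_natural k'P.
    rewrite kk -k'P gg linearN rep_natural.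
    exact: addNr.
  exists g'; split=> [x|y].
    have e : g' (i (target a) x + rep_map P a 0) =
        h (target a) x + cdual_map (opc R) (omap E a) (g 0) := g'P (x, 0).
    by move: e; rewrite !linear0 !addr0.
  have e : g' (i (target a) 0 + rep_map P a y) =
      h (target a) 0 + cdual_map (opc R) (omap E a) (g y) := g'P (0, y).
  by move: e; rewrite !linear0 !add0r.
by exists (@RepHom _ _ P (drepc E) g grel).
Qed.

End Incoming.

(** * Sums of induced representations *)

Section DirectSumMap.
Variables (R : pzRingType) (I : choiceType) (F G : I -> lmodType R).
Variable f : forall i, {linear F i -> G i}.

Lemma dsum_map_finite (x : dsum F) :
  `[< finite_set [set i | f i (dsum_coef x i) <> 0] >].
Proof.
apply/asboolP; apply: sub_finite_set (dsum_fin x) => i /= h e.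
by apply: h; rewrite e linear0.
Qed.

Definition dsum_map_fun (x : dsum F) : dsum G :=
  exist _ (fun i => f i (dsum_coef x i)) (dsum_map_finite x).

Lemma dsum_map_linear : linear dsum_map_fun.
Proof. by move=> a x y; apply: dsumP => i; exact: linearP. Qed.

Definition dsum_map : {linear dsum F -> dsum G} := linear_pack dsum_map_linear.

Lemma dsum_mapE x i : dsum_coef (dsum_map x) i = f i (dsum_coef x i).
Proof. by []. Qed.

Lemma dsum_map_single i (y : F i) : dsum_map (single y) = single (f i y).
Proof.
apply: dsumP => j; rewrite dsum_mapE /= /single_coef.
by case: pselect => [e|_]; [case: _ / e|exact: linear0].
Qed.
End DirectSumMap.

Section TreeSum.
Variables (Q : quiver) (R : pzRingType).
Hypothesis hforest : is_forest Q.

Section Def.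
Variable X : vertex Q -> lmodType R.

(* the sum over [w] of [X w], placed at the descendants of [w] *)
Definition treesum : rep Q R :=
  @Rep Q R (fun v => dsum (fun w => restr (anc w v) (X w)))
    (fun a => dsum_map (fun w => rmk (anc w (target a)) (X w) \o rval _ _)).

(** The component belonging to [v] itself. All other summands come from proper ancestors, hence
    through the incoming arrow, so this projection is the cokernel of f_v. *)
Definition treepi v : {linear treesum v -> X v} :=
  rval (anc v v) (X v) \o coef (fun w => restr (anc w v) (X w)) v.

Lemma treepiE v x : treepi v x = rval _ _ (dsum_coef x v). Proof. by []. Qed.

Lemma treesum_coef (a : arrow Q) x w :
  dsum_coef (rep_map treesum a x) w = rmk _ _ (rval _ _ (dsum_coef x w)).
Proof. by []. Qed.

Lemma treesumP v (x y : treesum v) :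
  (forall w, rval _ _ (dsum_coef x w) = rval _ _ (dsum_coef y w)) -> x = y.
Proof. by move=> e; apply: dsumP => w; apply: rval_inj. Qed.

Definition treein v (x : X v) : treesum v :=
  @single R _ (fun w => restr (anc w v) (X w)) v (rmk _ _ x).

Lemma treeinK v x : treepi v (treein x) = x.
Proof. by rewrite treepiE /= single_coefE rmk_in //; exact: anc_refl. Qed.

Lemma treesum_short_exact (a : arrow Q) :
  short_exact (rep_map treesum a) (treepi (target a)).
Proof.
split.
- apply: linear_inj => x x0; apply: treesumP => w; rewrite linear0.
  have [ws|ws] := pselect (anc w (source a)); last exact: rval_out.
  have := congr1 (fun z : treesum (target a) => rval _ _ (dsum_coef z w)) x0.
  by rewrite treesum_coef rmk_in ?linear0 //; exact: anc_snoc.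
- move=> y; rewrite treepiE; split=> [y0|[x <-]]; last first.
    rewrite treesum_coef rmk_in ?rval_out //; last exact: anc_refl.
    exact: anc_acyclic.
  exists (dsum_map (fun w => rmk (anc w (source a)) (X w) \o rval _ _) y).
  apply: treesumP => w; rewrite treesum_coef dsum_mapE /=.
  have [wt|wt] := pselect (anc w (target a)); last by rewrite !(rval_out _ wt).
  rewrite rmk_in //; have [e|ws] := anc_target hforest wt; last by rewrite rmk_in.
  by subst w; rewrite y0 linear0 linear0.
- by move=> x; exists (treein x); exact: treeinK.
Qed.

Lemma treepi_root v : (forall a : arrow Q, target a <> v) -> injective (treepi v).
Proof.
move=> root; apply: linear_inj => x x0; apply: treesumP => w; rewrite linear0.
have [/anc_inv[e|[a [/root//]]]|wv] := pselect (anc w v); last exact: rval_out.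
by subst w.
Qed.

Lemma treesum_good Phi : (forall v, Phi (X v)) -> good Phi treesum.
Proof.
move=> PX; apply: (goodP hforest) => [v root|a].
  exists (X v), (treepi v); split=> //; first exact: treepi_root.
  by move=> x; exists (treein x); exact: treeinK.
by exists (X (target a)), (treepi (target a)); split=> //; exact: treesum_short_exact.
Qed.

(** A vertex has finitely many ancestors, so the sum at [v] is also a product, and a compatible
    family of maps into the [X w] gives a morphism. *)
Lemma treesum_hom_in (M : rep Q R) (g : forall w v, {linear M v -> X w}) :
    (forall w v, ~ anc w v -> forall x, g w v x = 0) ->
    (forall w (a : arrow Q), anc w (target a) ->
       forall x, g w (target a) (rep_map M a x) = g w (source a) x) ->
  exists h : rep_hom M treesum, forall v x w, rval _ _ (dsum_coef (h v x) w) = g w v x.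
Proof.
move=> g0 gE.
have fin v (x : M v) : `[< finite_set [set w | rmk (anc w v) (X w) (g w v x) <> 0] >].
  apply/asboolP; apply: sub_finite_set (anc_finite hforest v) => w /= h.
  by apply: contrapT => wv; apply: h; exact: rmk_out.
pose hf v (x : M v) : treesum v :=
    exist _ (fun w => rmk (anc w v) (X w) (g w v x)) (fin v x).
have hL v : linear (hf v).
  by move=> k x y; apply: dsumP => w; rewrite [LHS]/= !linearP.
have nat (a : arrow Q) (x : M (source a)) : linear_pack (hL (target a)) (rep_map M a x) =
    rep_map treesum a (linear_pack (hL (source a)) x).
  apply: dsumP => w; rewrite treesum_coef /=.
  have [wt|wt] := pselect (anc w (target a)); last by rewrite !rmk_out.
  rewrite gE //; have [ws|ws] := pselect (anc w (source a)); first by rewrite (rmk_in _ ws).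
  by rewrite g0 // !linear0.
exists (@RepHom _ _ M treesum (fun v => linear_pack (hL v)) nat) => v x w /=.
have [wv|wv] := pselect (anc w v); first by rewrite rmk_in.
by rewrite rmk_out // linear0 g0.
Qed.

(** The summand belonging to [X w] is the representation induced from the module [X w] at [w]; [e w]
    propagates along the arrows to all descendants. *)
Lemma treesum_hom_out (M : rep Q R) (e : forall v, {linear X v -> M v}) :
  exists h : rep_hom treesum M, forall v x, h v (treein x) = e v x.
Proof.
have Tw w : exists T : forall v, {linear X w -> M v}, (forall x, T w x = e w x) /\
    forall a : arrow Q, anc w (source a) ->
      forall x, T (target a) x = rep_map M a (T (source a) x).
  have single v : exists t : {linear X w -> M v},
      forall E : w = v, t = ecast u {linear X w -> M u} E (e w).
    have [E|nE] := pselect (w = v); last by exists \0 => E; case: nE.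
    by exists (ecast u {linear X w -> M u} E (e w)) => E'; rewrite (eq_irrelevance E' E).
  have [v _|a x xg|T [Tg TE]] := @forest_rec Q hforest (fun v => {linear X w -> M v})
    (fun v t => forall E : w = v, t = ecast u {linear X w -> M u} E (e w))
    (fun a t t' => anc w (source a) -> forall x, t' x = rep_map M a (t x)).
  - exact: single.
  - have [ws|ws] := pselect (anc w (source a)); last by have [t tP] := single (target a); exists t.
    exists (rep_map M a \o x); split=> // E.
    by case: (anc_acyclic hforest (a := a)); rewrite -E.
  exists T; split=> [x|a]; last exact: TE.
  by rewrite (Tg w erefl).
have [T TP] : exists T : forall w v, {linear X w -> M v}, forall w,
    (forall x, T w w x = e w x) /\
    forall a : arrow Q, anc w (source a) ->
      forall x, T w (target a) x = rep_map M a (T w (source a) x).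
  by exists (fun w => projT1 (cid (Tw w))) => w; exact: projT2 (cid (Tw w)).
pose h v : {linear treesum v -> M v} :=
  dsum_desc (fun w => (T w v \o rval (anc w v) (X w) : {linear _ -> M v})).
have hE v w (y : restr (anc w v) (X w)) :
    h v (@single R _ (fun w => restr (anc w v) (X w)) w y) = T w v (rval _ _ y).
  exact: (dsum_desc_single (fun w => (T w v \o rval (anc w v) (X w) : {linear _ -> M v}))).
have nat (a : arrow Q) (x : treesum (source a)) :
    h (target a) (rep_map treesum a x) = rep_map M a (h (source a) x).
  apply: (@dsum_linear_ext _ _ _ _ (h (target a) \o rep_map treesum a)
    (rep_map M a \o h (source a))) => w y.
  pose Fs w := restr (anc w (source a)) (X w); pose Ft w := restr (anc w (target a)) (X w).
  have sE : rep_map treesum a (@single R _ Fs w y) =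
      @single R _ Ft w (rmk (anc w (target a)) (X w) (rval _ _ y)).
    exact: dsum_map_single.
  rewrite -[LHS]/(h (target a) (rep_map treesum a (@single R _ Fs w y))) sE.
  rewrite -[RHS]/(rep_map M a (h (source a) (@single R _ Fs w y))) !hE.
  have [ws|ws] := pselect (anc w (source a)); last by rewrite (rval_out _ ws) !linear0.
  by rewrite rmk_in ?(TP w).2 //; exact: anc_snoc.
exists (@RepHom _ _ treesum M h nat) => v x /=.
rewrite -[LHS]/(h v (treein x)) hE rmk_in ?(TP v).1 //.
exact: anc_refl.
Qed.
End Def.

End TreeSum.

(** * From modules to representations *)

Section RepKernel.
Variables (Q : quiver) (R : pzRingType).

Lemma rep_kernel_ex (P M : rep Q R) (f : rep_hom P M) :
  exists (K : rep Q R) (k : rep_hom K P), forall v, injective (k v) /\ exact_at (k v) (f v).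
Proof.
have nat (a : arrow Q) : exists h : {linear kernel (f (source a)) -> kernel (f (target a))},
    forall x, kernel_val (f (target a)) (h x) = rep_map P a (kernel_val (f (source a)) x).
  apply: (@factor_inj _ _ _ _ _ (rep_map P a \o kernel_val _)).
    exact: kernel_val_inj.
  by move=> x; apply/kernel_exact; rewrite /= rep_natural kernel_valP linear0.
pose K := @Rep Q R (fun v => kernel (f v)) (fun a => projT1 (cid (nat a))).
exists K, (@RepHom _ _ K P (fun v => kernel_val (f v)) (fun a => projT2 (cid (nat a)))).
by move=> v; split; [exact: kernel_val_inj|exact: kernel_exact].
Qed.

Lemma rep_coker_ex (M F : rep Q R) (f : rep_hom M F) :
  exists (N : rep Q R) (p : rep_hom F N),
    forall v, exact_at (f v) (p v) /\ forall z, exists y, p v y = z.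
Proof.
have cs v (z : coker (f v)) : exists y, coker_proj (f v) y = z by exact: quotmod_surj.
have nat (a : arrow Q) : exists h : {linear coker (f (source a)) -> coker (f (target a))},
    forall x, h (coker_proj (f (source a)) x) = coker_proj (f (target a)) (rep_map F a x).
  apply: (@factor_surj _ _ _ _ _ (coker_proj (f (target a)) \o rep_map F a) (cs _)).
  move=> _ /coker_exact[x <-].
  by apply/coker_exact; exists (rep_map M a x); rewrite rep_natural.
pose N := @Rep Q R (fun v => coker (f v)) (fun a => projT1 (cid (nat a))).
exists N, (@RepHom _ _ F N (fun v => coker_proj (f v))
  (fun a x => esym (projT2 (cid (nat a)) x))).
by move=> v; split; [exact: coker_exact|exact: cs].
Qed.

Definition rep_step (M M' : rep Q R) : Prop :=
  exists (F : rep Q R) (i : rep_hom M F) (p : rep_hom F M'),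
    [/\ flat_rep F, forall v, short_exact (i v) (p v)
      & forall E : rep (opposite Q) R^c, injective_rep E ->
        forall h : rep_hom M (drepc E),
        exists h' : rep_hom F (drepc E), forall v x, h' v (i v x) = h v x].

End RepKernel.

(** Dependent choice in both directions. The invariants on the two sides differ, and only the
    starting point has to satisfy both. *)
Lemma int_chain (T : Type) (step : T -> T -> Prop) (Lc Rc : T -> Prop) (x : T) :
    (forall y, Rc y -> exists z, Rc z /\ step y z) ->
    (forall y, Lc y -> exists z, Lc z /\ step z y) -> Lc x -> Rc x ->
  exists X : int -> T, X 0 = x /\ forall n, step (X n) (X (n + 1)).
Proof.
have chain (C : T -> Prop) (st : T -> T -> Prop) : (forall y, C y -> exists z, C z /\ st y z) ->
    C x -> exists f : nat -> T, f 0%N = x /\ forall n, st (f n) (f n.+1).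
  move=> stP Cx.
  have nextP (y : T) : exists z, C y -> C z /\ st y z.
    by have [/stP[z zP]|nC] := pselect (C y); [exists z|exists y].
  have [next nP] := choice nextP.
  exists (fun n => iter n next x); split=> // n.
  have Cn m : C (iter m next x) by elim: m => //= m IH; have [] := nP _ IH.
  by have [] := nP _ (Cn n).
move=> Rs Ls Lx Rx; have [f [f0 fS]] := chain Rc step Rs Rx.
have [g [g0 gS]] := chain Lc (fun y z => step z y) Ls Lx.
exists (fun n => match n with Posz k => f k | Negz k => g k.+1 end).
split=> //; case=> [k|[|k]].
- by have -> : Posz k + 1 = Posz k.+1 by rewrite -addn1.
- by have -> : Negz 0 + 1 = 0 by []; rewrite -[X in step _ X]/(f 0%N) f0 -g0.
- by have -> : Negz k.+1 + 1 = Negz k by rewrite !NegzE -[k.+2]addn1 PoszD opprD subrK.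
Qed.

Section Backward.
Variables (Q : quiver) (R : pzRingType).

Definition rep_hom_comp (X Y Z : rep Q R) (g : rep_hom Y Z) (f : rep_hom X Y) :
    rep_hom X Z.
Proof.
exists (fun v => g v \o f v) => a x /=; by rewrite !rep_natural.
Defined.

(** The short exact sequences are spliced. A morphism to E^+ that kills the image of [d n] factors
    through the next cycle, and extends to the next term by the last clause of [rep_step]. *)
Lemma chain_gorenstein_flat (X : int -> rep Q R) :
  (forall n, rep_step (X n) (X (n + 1))) -> gorenstein_flat_rep (X 0).
Proof.
move=> st.
have [F FP] : exists F : int -> rep Q R, forall n,
    exists (i : rep_hom (X n) (F n)) (p : rep_hom (F n) (X (n + 1))),
    [/\ flat_rep (F n), forall v, short_exact (i v) (p v)
      & forall E : rep (opposite Q) R^c, injective_rep E ->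
        forall h : rep_hom (X n) (drepc E),
        exists h' : rep_hom (F n) (drepc E), forall v x, h' v (i v x) = h v x].
  by exists (fun n => projT1 (cid (st n))) => n; exact: projT2 (cid (st n)).
pose i n := projT1 (cid (FP n)).
pose p n := projT1 (cid (projT2 (cid (FP n)))).
have ipP n : [/\ flat_rep (F n), forall v, short_exact (i n v) (p n v)
      & forall E : rep (opposite Q) R^c, injective_rep E ->
        forall h : rep_hom (X n) (drepc E),
        exists h' : rep_hom (F n) (drepc E), forall v x, h' v (i n v x) = h v x].
  exact: projT2 (cid (projT2 (cid (FP n)))).
pose d n := rep_hom_comp (i (n + 1)) (p n).
have dE n v x : d n v x = i (n + 1) v (p n v x) by [].
have iinj n v : injective (i n v) by have [_ /(_ v)[]] := ipP n.
have ip n v : exact_at (i n v) (p n v) by have [_ /(_ v)[]] := ipP n.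
have ps n v z : exists y, p n v y = z by have [_ /(_ v)[_ _ h] _] := ipP n; exact: h.
have idex n v : exact_at (i n v) (d n v).
  move=> y; rewrite dE; split=> [/(inj_eq0 (@iinj _ _))/ip//|/ip ->].
  exact: linear0.
have dex n : rep_exact_at (d n) (d (n + 1)).
  move=> v y; split=> [/idex[x <-]|[x <-]].
    by have [z <-] := ps _ _ x; exists z.
  by apply/idex; exists (p n v x).
exists F, d, (i 0); split=> // [n||E injE n]; first by have [] := ipP n.
  by split=> v; [exact: iinj|exact: idex].
have dd v x : d (n + 1) v (d n v x) = 0 by exact: exact_comp0 (dex n v).
apply/(path_tensor_exact E dd) => h hd.
have [g gP] : exists g : rep_hom (X (n + 1 + 1)) (drepc E),
    forall v y, g v (p (n + 1) v y) = h v y.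
  have gv v : exists g : {linear X (n + 1 + 1) v -> drepc E v},
      forall y, g (p (n + 1) v y) = h v y.
    apply: factor_surj; first exact: ps.
    move=> _ /ip[x <-]; have [z <-] := ps n v x.
    exact: hd.
  have nat (a : arrow Q) x : projT1 (cid (gv (target a))) (rep_map _ a x) =
      rep_map (drepc E) a (projT1 (cid (gv (source a))) x).
    have [y <-] := ps (n + 1) (source a) x; rewrite -rep_natural.
    rewrite (projT2 (cid (gv (target a)))) (projT2 (cid (gv (source a)))).
    exact: rep_natural.
  exists (@RepHom _ _ (X (n + 1 + 1)) (drepc E) (fun v => projT1 (cid (gv v))) nat) => v y.
  exact: projT2 (cid (gv v)) y.
have [_ _ /(_ E injE g)[h' h'P]] := ipP (n + 1 + 1).
by exists h' => v y; rewrite dE h'P gP.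
Qed.

Hypothesis hforest : is_forest Q.

Lemma good_mono (Phi Psi : lmodType R -> Prop) (M : rep Q R) :
  (forall C, Phi C -> Psi C) -> good Phi M -> good Psi M.
Proof.
by move=> PP gM v; have [C [q [h /PP PC]]] := gM v; exists C, q.
Qed.

(** [M] is covered by the representation induced from free covers of the modules [M v]. By a snake
    argument the kernel [K] again has injective structure maps, and its cokernel at [v] is the
    kernel of [X v -> C], a syzygy of [C]. *)
Lemma ext_free_rep_step (M : rep Q R) : good (@ext_free R) M ->
  exists K, good (@ext_free R) K /\ rep_step K M.
Proof.
move=> gM; pose X v := free_module R (M v); pose P := treesum X.
have [q qP] := treesum_hom_out hforest (fun v => free_cover (M v)).
have qs v z : exists y, q v y = z.
  by have [x <-] := free_cover_surj z; exists (treein x); rewrite qP.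
have [K [k kP]] := rep_kernel_ex q.
have kq v : short_exact (k v) (q v) by split; [exact: (kP v).1|exact: (kP v).2|exact: qs].
have ki v : injective (k v) by have [] := kP v.
have kex v : exact_at (k v) (q v) by have [] := kP v.
have Xflat v : flat_module (X v) by exact: flat_module_free.
exists K; split; last first.
  exists P, k, q; split=> //; first exact/(good_flat_rep hforest)/treesum_good.
  by move=> E injE h; exact: rep_ext_free kq gM injE.
(* [c] is the map induced by [q] on the cokernels at [v], and [r'] will turn out to be the cokernel
   map for [K]. *)
have key v (C : lmodType R) (r : {linear M v -> C}) : (forall z, exists y, r y = z) ->
    ext_free C -> (forall x, treepi X v x = 0 -> r (q v x) = 0) ->
    exists (c : {linear X v -> C}) (r' : {linear K v -> kernel c}), [/\ ext_free (kernel c),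
      forall x, c (treepi X v x) = r (q v x)
      & forall x, kernel_val c (r' x) = treepi X v (k v x)].
  move=> rs eC pr.
  have [|c cP] := @factor_surj _ _ _ _ (treepi X v) (r \o q v) _ pr.
    by move=> x; exists (treein x); exact: treeinK.
  have [|r' r'P] := @factor_inj _ _ _ _ (kernel_val c) (treepi X v \o k v)
    (@kernel_val_inj _ _ _ c).
    by move=> x; apply/kernel_exact; rewrite /= cP /= (exact_comp0 _ (kex v)) linear0.
  exists c, r'; split=> //; apply: (@ext_free_syzygy _ _ _ _ (kernel_val c) c) => //.
  split; [exact: kernel_val_inj|exact: kernel_exact|move=> z].
  have [y <-] := rs z; have [x <-] := qs _ y.
  by exists (treepi X v x); rewrite cP.
apply: (goodP hforest) => [v root|a].
  have [C [r [ri rs eC]]] := good_root gM root; have pi := treepi_root (X := X) root.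
  have [|c [r' [ec cP r'P]]] := key v C r rs eC.
    by move=> x /(inj_eq0 pi) ->; rewrite !linear0.
  exists (kernel c), r'; split=> // [x y /(congr1 (kernel_val c))|z].
    by rewrite !r'P => /pi/ki.
  have pz : treepi X v (treein (kernel_val c z)) = kernel_val c z by exact: treeinK.
  have /kex[x xP] : q v (treein (kernel_val c z)) = 0.
    by apply: (inj_eq0 ri); rewrite -cP pz kernel_valP.
  by exists x; apply: (@kernel_val_inj _ _ _ c); rewrite r'P xP.
have [C [r [[fi fr rs] eC]]] := good_target hforest a gM.
have [tfi tfp _] := treesum_short_exact hforest X a.
have [|c [r' [ec cP r'P]]] := key (target a) C r rs eC.
  by move=> _ /tfp[x <-]; rewrite rep_natural (exact_comp0 _ fr).
exists (kernel c), r'; split=> //; split.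
- apply: linear_inj => x x0; apply: (inj_eq0 (@ki _)); apply: (inj_eq0 tfi).
  by rewrite -rep_natural x0 linear0.
- move=> y; split=> [y0|[x <-]].
    have /tfp[x xP] : treepi X _ (k _ y) = 0 by rewrite -r'P y0 linear0.
    have /kex[x' x'P] : q (source a) x = 0.
      by apply: (inj_eq0 fi); rewrite -rep_natural xP (exact_comp0 _ (kex _)).
    by exists x'; apply: ki; rewrite rep_natural x'P.
  apply: (@kernel_val_inj _ _ _ c).
  by rewrite r'P rep_natural (exact_comp0 _ tfp) linear0.
- move=> z; have pz : treepi X _ (treein (kernel_val c z)) = kernel_val c z.
    exact: treeinK.
  have /fr[m mP] : r (q _ (treein (kernel_val c z))) = 0 by rewrite -cP pz kernel_valP.
  have [x xm] := qs _ m.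
  have /kex[y yP] : q _ (treein (kernel_val c z) - rep_map P a x) = 0.
    by rewrite linearB rep_natural xm mP subrr.
  exists y; apply: (@kernel_val_inj _ _ _ c).
  by rewrite r'P yP linearB pz (exact_comp0 _ tfp) subr0.
Qed.

(* [j] induces an embedding of the cokernel of [f] in [E^+] *)
Definition dual_embedding (Z M : lmodType R) (f : {linear Z -> M}) (E : lmodType R^c)
    (j : {linear M -> cdual (opc R) E}) : Prop :=
  exists (C C' : lmodType R) (q : {linear M -> C}) (p : {linear cdual (opc R) E -> C'}),
    [/\ short_exact f q, ext_free C, forall x, j x = 0 <-> q x = 0, exact_at j p
      & (forall z, exists y, p y = z) /\ flat_by_cycle C'].

Lemma dual_embedding_ex (Z M C : lmodType R) (f : {linear Z -> M}) (q : {linear M -> C}) :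
    left_noetherian R^c -> short_exact f q -> flat_by_cycle C ->
  exists E : lmodType R^c, [/\ injective_module E, flat_module (cdual (opc R) E)
    & exists j, @dual_embedding Z M f E j].
Proof.
move=> noeth fq cC.
have [E [j [injE fE ji jC]]] := flat_by_cycle_step noeth cC.
have [_ _ qs] := fq; have cs : forall z, exists y, coker_proj j y = z by exact: quotmod_surj.
exists E; split=> //; exists (j \o q), C, (coker j), q, (coker_proj j); split=> //.
- exact: ext_free_flat_by_cycle.
- by move=> x; split=> [/(inj_eq0 ji)|/= ->] //; exact: linear0.
- move=> y; rewrite coker_exact; split=> [[z <-]|[x <-]]; last by eexists.
  by have [x <-] := qs z; exists x.
by split=> //; apply: (jC _ (coker_proj j)); split=> //; exact: coker_exact.
Qed.

(** Each [j w] vanishes on the image of the incoming arrow and is extended to all descendants of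
    [w]. Together these maps embed [M] in [treesum X], and the cokernel of [N] at [v] is [X v]
    modulo the image of [j v], which lies in the class by construction. *)
Lemma flat_by_cycle_rep_step (M : rep Q R) : left_noetherian R^c ->
    good (@flat_by_cycle R) M ->
  exists N, good (@flat_by_cycle R) N /\ rep_step M N.
Proof.
move=> noeth gM.
have [E EP] : exists E : vertex Q -> lmodType R^c, forall v,
    [/\ injective_module (E v), flat_module (cdual (opc R) (E v))
      & exists j, @dual_embedding _ _ (rep_f M v) (E v) j].
  suff ex v : exists E : lmodType R^c, [/\ injective_module E,
      flat_module (cdual (opc R) E) & exists j, @dual_embedding _ _ (rep_f M v) E j].
    by exists (fun v => projT1 (cid (ex v))) => v; exact: projT2 (cid (ex v)).
  by have [C [q [fq cC]]] := gM v; exact: dual_embedding_ex fq cC.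
pose X v : lmodType R := cdual (opc R) (E v).
have injE v : injective_module (E v) by have [] := EP v.
have Xflat v : flat_module (X v) by have [] := EP v.
have [j jP] : exists j : forall v, {linear M v -> X v}, forall v,
    dual_embedding (rep_f M v) (j v).
  have ex v : exists j, @dual_embedding _ _ (rep_f M v) (E v) j by have [] := EP v.
  by exists (fun v => projT1 (cid (ex v))) => v; exact: projT2 (cid (ex v)).
have gx w : exists g : forall v, {linear M v -> X w}, [/\ g w = j w,
    forall v, ~ anc w v -> forall x, g v x = 0
    & forall a : arrow Q, anc w (target a) ->
       forall x, g (target a) (rep_map M a x) = g (source a) x].
  have jw v : exists t : {linear M v -> X w},
      (forall e : w = v, t = ecast u {linear M u -> X w} e (j w)) /\ (w <> v -> t = \0).
    have [e|ne] := pselect (w = v); last by exists \0; split=> // e; case: ne.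
    exists (ecast u {linear M u -> X w} e (j w)); split=> // e'.
    by rewrite (eq_irrelevance e' e).
  (* Since [j w] kills what arrives along the arrow into [w], it is compatible with the zero maps
     outside the descendants of [w]. *)
  have jker (a : arrow Q) (t : {linear M (target a) -> X w}) x :
      (forall e : w = target a, t = ecast u {linear M u -> X w} e (j w)) ->
      (w <> target a -> t = \0) -> t (rep_map M a x) = 0.
    move=> t1 t0; have [e|/t0 -> //] := pselect (w = target a).
    rewrite (t1 e); move: (jP w); clear t1 t0; subst w.
    move=> [C [_ [q [_ [/(rep_f_short_exact hforest)[_ fq _] _ jq _ _]]]]].
    by apply/jq; exact: exact_comp0 fq.
  have [v root|a t [t1 t0]|g [gg gE]] := @forest_rec Q hforest (fun v => {linear M v -> X w})
    (fun v t => (forall e : w = v, t = ecast u {linear M u -> X w} e (j w)) /\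
                (~ anc w v -> t = \0))
    (fun a t t' => forall x, anc w (target a) -> t' (rep_map M a x) = t x).
  - have [t [t1 t0]] := jw v; exists t; split=> // wv; apply: t0 => e; apply: wv.
    by rewrite e; exact: anc_refl.
  - have [ws|ws] := pselect (anc w (source a)).
      have [C [_ [q [_ [/(rep_f_short_exact hforest)[fi fq qs] eC _ _ _]]]]] := jP (target a).
      have sE : injective_syzygy (E w) by left.
      have [x /(inj_eq0 fi) ->|t' t'P] := eC _ sE _ _ (rep_map M a) q t qs fq.
        exact: linear0.
      exists t'; split=> [|x _]; last exact: t'P.
      split=> [e|wt]; last by case: wt; exact: anc_snoc.
      by case: (anc_acyclic hforest (a := a)); rewrite -e.
    have [t' [t1' t0']] := jw (target a); exists t'; split.
      by split=> // wt; apply: t0' => e; apply: wt; rewrite e; exact: anc_refl.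
    by move=> x _; rewrite (jker _ _ _ t1' t0') t0.
  exists g; split=> [|v wv x|a wt x]; last exact: gE.
  - by have [/(_ erefl)] := gg w.
  - by have [_ ->] := gg v.
have [g gP] : exists g : forall w v, {linear M v -> X w}, forall w, [/\ g w w = j w,
    forall v, ~ anc w v -> forall x, g w v x = 0
    & forall a : arrow Q, anc w (target a) ->
       forall x, g w (target a) (rep_map M a x) = g w (source a) x].
  by exists (fun w => projT1 (cid (gx w))) => w; exact: projT2 (cid (gx w)).
have g0 w v : ~ anc w v -> forall x, g w v x = 0 by have [_ h _] := gP w; exact: h.
have gE w (a : arrow Q) : anc w (target a) ->
    forall x, g w (target a) (rep_map M a x) = g w (source a) x.
  by have [_ _ h] := gP w; exact: h.
have gj w : g w w = j w by have [] := gP w.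
have [h hP] := treesum_hom_in hforest g0 gE.
have hj v x : treepi X v (h v x) = j v x by rewrite treepiE hP gj.
(* If [h v x = 0], then [j v x = 0] and [x] comes from the source of the incoming arrow; injectivity
   of the structure maps of [treesum X] passes the equation up the tree. *)
have h_inj v : injective (h v).
  apply: linear_inj; elim/(forest_ind hforest): v => [v root|a IH] x hx.
    have [C [_ [q [_ [/(bij_short_exact _ _ (incoming_root root))[qi _] _ jq _ _]]]]] := jP v.
    by apply: (inj_eq0 qi); apply/jq; rewrite -hj hx linear0.
  have [C [_ [q [_ [/(rep_f_short_exact hforest)[fi fq qs] _ jq _ _]]]]] := jP (target a).
  have /fq[y yx] : q x = 0 by apply/jq; rewrite -hj hx linear0.
  have [tfi _ _] := treesum_short_exact hforest X a.
  rewrite -yx (IH y) ?linear0 //; apply: (inj_eq0 tfi).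
  by rewrite -rep_natural yx.
have [N [p pP]] := rep_coker_ex h.
have hp v : exact_at (h v) (p v) by have [] := pP v.
have ps v z : exists y, p v y = z by have [] := pP v.
have tps v z : exists y, treepi X v y = z by exists (treein z); exact: treeinK.
have gN : good (@flat_by_cycle R) N.
  have key v (C' : lmodType R) (r : {linear X v -> C'}) : exact_at (j v) r ->
      exists r' : {linear N v -> C'}, forall y, r' (p v y) = r (treepi X v y).
    move=> jr; apply: (@factor_surj _ _ _ _ (p v) (r \o treepi X v)); first exact: ps.
    by move=> _ /hp[x <-]; rewrite -[LHS]/(r (treepi X v (h v x))) hj (exact_comp0 _ jr).
  apply: (goodP hforest) => [v root|a].
    have [C [C' [q [r [_ _ _ jr [rs cC']]]]]] := jP v.
    have [r' r'P] := key v C' r jr; exists C', r'; split=> //; last first.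
      by move=> z; have [y <-] := rs z; have [x <-] := tps _ y; exists (p v x); rewrite r'P.
    apply: linear_inj => z; have [y <-] := ps v z; rewrite r'P => /jr[x xy].
    apply/hp; exists x; apply: (treepi_root root).
    by rewrite hj.
  have [C [C' [q [r [/(rep_f_short_exact hforest)[fi fq qs] _ jq jr [rs cC']]]]]] :=
    jP (target a).
  have [tfi tfp _] := treesum_short_exact hforest X a.
  have [r' r'P] := key (target a) C' r jr; exists C', r'; split=> //; split.
  - apply: linear_inj => z; have [y <-] := ps _ z; rewrite -rep_natural => /hp[m my].
    have /fq[m' m'm] : q m = 0 by apply/jq; rewrite -hj my (exact_comp0 _ tfp).
    apply/hp; exists m'; apply: tfi.
    by rewrite -rep_natural m'm my.
  - move=> z; split=> [z0|[n <-]]; last first.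
      have [y <-] := ps _ n.
      by rewrite -rep_natural r'P (exact_comp0 _ tfp) linear0.
    have [y yz] := ps _ z; move: z0; rewrite -yz r'P => /jr[m my].
    have /tfp[x xP] : treepi X _ (y - h _ m) = 0 by rewrite linearB hj my subrr.
    exists (p _ x); rewrite -rep_natural xP linearB (exact_comp0 _ (hp _)) subr0.
    by [].
  - by move=> z; have [y <-] := rs z; have [x <-] := tps _ y; exists (p _ x); rewrite r'P.
exists N; split=> //; exists (treesum X), h, p.
have hps v : short_exact (h v) (p v) by split; [exact: h_inj|exact: hp|exact: ps].
split=> //; first exact/(good_flat_rep hforest)/treesum_good.
move=> E' injE' f; apply: (rep_ext_free hforest f hps) => //.
by apply: good_mono gN => C; exact: ext_free_flat_by_cycle.
Qed.

Lemma good_gorenstein_flat (M : rep Q R) : left_noetherian R^c ->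
  good (@gorenstein_flat_module R) M -> gorenstein_flat_rep M.
Proof.
move=> noeth gM.
have [X [<- Xst]] := @int_chain _ (@rep_step Q R) (good (@ext_free R))
  (good (@flat_by_cycle R)) M (fun N => @flat_by_cycle_rep_step N noeth)
  ext_free_rep_step
  (good_mono (fun C h => ext_free_cycle (gorenstein_flat_cycle h)) gM)
  (good_mono (fun C h => cycle_flat_by_cycle (gorenstein_flat_cycle h)) gM).
exact: chain_gorenstein_flat.
Qed.

End Backward.

(** * From representations to modules *)

Section Forward.
Variables (Q : quiver) (R : pzRingType).
Hypothesis hforest : is_forest Q.

Lemma rep_f_inj (M : rep Q R) :
  (forall a : arrow Q, injective (rep_map M a)) -> forall v, injective (rep_f M v).
Proof.
move=> Mi; elim/(forest_ind hforest) => [v root|a _]; apply: linear_inj => z z0.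
  exact: incoming_root.
have := inj_eq0 (@Mi a) (etrans (esym (rep_f_target hforest z)) z0) => {}z0.
by apply: dsumP => b; rewrite (incoming_arrowE hforest b).
Qed.

Lemma short_exact_coker (A B : lmodType R) (f : {linear A -> B}) :
  injective f -> short_exact f (coker_proj f).
Proof.
by move=> fi; split=> //; [exact: coker_exact|move=> z; exact: quotmod_surj].
Qed.

Definition incoming_image (M : rep Q R) v (y : M v) : Prop :=
  exists z, rep_f M v z = y.

Lemma incoming_image_root (M : rep Q R) v (y : M v) :
  (forall a : arrow Q, target a <> v) -> incoming_image y <-> y = 0.
Proof.
move=> root; split=> [[z <-]|->]; last by exists 0; rewrite linear0.
by rewrite (incoming_root root z) linear0.
Qed.

Lemma incoming_image_target (M : rep Q R) (a : arrow Q) (y : M (target a)) :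
  incoming_image y <-> exists x, rep_map M a x = y.
Proof.
split=> [[z <-]|[x <-]]; first by rewrite (rep_f_target hforest); eexists.
pose F (b : incoming (target a)) := M (source (val b)).
exists (@single R _ F (incoming_arrow a) x); rewrite (rep_f_target hforest).
exact: (congr1 (rep_map M a) (@single_coefE R _ F (incoming_arrow a) x)).
Qed.

Lemma incoming_image_hom (X Y : rep Q R) (f : rep_hom X Y) v (x : X v) :
  incoming_image x -> incoming_image (f v x).
Proof.
elim/(forest_ind hforest): v x => [v root|a _] x.
  by move=> /(incoming_image_root _ root) ->; apply/(incoming_image_root _ root); exact: linear0.
move=> /incoming_image_target[z <-]; apply/incoming_image_target.
by exists (f _ z); rewrite rep_natural.
Qed.

Lemma incoming_image_exact (X Y Z : rep Q R) (f : rep_hom X Y) (g : rep_hom Y Z) v (y : Y v) :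
    rep_exact_at f g -> (forall a : arrow Q, injective (rep_map Z a)) ->
    incoming_image y -> g v y = 0 ->
  exists x, incoming_image x /\ f v x = y.
Proof.
move=> fg Zi; elim/(forest_ind hforest): v y => [v root|a _] y.
  move=> /(incoming_image_root _ root) -> _; exists 0; rewrite linear0; split=> //.
  exact/(incoming_image_root _ root).
move=> /incoming_image_target[z <-]; rewrite rep_natural => /(inj_eq0 (@Zi a))/fg[x <-].
exists (rep_map X a x); rewrite rep_natural; split=> //.
by apply/incoming_image_target; exists x.
Qed.

Lemma rep_C_proj0 (M : rep Q R) v (y : M v) :
  coker_proj (rep_f M v) y = 0 <-> incoming_image y.
Proof. exact: coker_exact. Qed.

Lemma rep_C_surj (M : rep Q R) v (z : rep_C M v) : exists y, coker_proj (rep_f M v) y = z.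
Proof. exact: quotmod_surj. Qed.

Lemma rep_C_map_ex (X Y : rep Q R) (f : rep_hom X Y) v :
  exists c : {linear rep_C X v -> rep_C Y v},
    forall x, c (coker_proj (rep_f X v) x) = coker_proj (rep_f Y v) (f v x).
Proof.
apply: (@factor_surj _ _ _ _ _ (coker_proj (rep_f Y v) \o f v)); first exact: rep_C_surj.
by move=> x /rep_C_proj0 h; apply/rep_C_proj0; exact: incoming_image_hom.
Qed.

Definition rep_C_map (X Y : rep Q R) (f : rep_hom X Y) v := projT1 (cid (rep_C_map_ex f v)).

Lemma rep_C_mapE (X Y : rep Q R) (f : rep_hom X Y) v x :
  rep_C_map f v (coker_proj (rep_f X v) x) = coker_proj (rep_f Y v) (f v x).
Proof. exact: projT2 (cid (rep_C_map_ex f v)) x. Qed.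

(** If [g y] comes from the preceding vertex, the element there is killed by [h] because the
    structure maps of [T] are injective; it therefore lifts along [g], and [y] can be corrected to a
    cycle. This is why exactness at two consecutive places is assumed. *)
Lemma rep_C_exact (X Y Z T : rep Q R) (f : rep_hom X Y) (g : rep_hom Y Z)
    (h : rep_hom Z T) v :
    rep_exact_at f g -> rep_exact_at g h ->
    (forall a : arrow Q, injective (rep_map T a)) ->
  exact_at (rep_C_map f v) (rep_C_map g v).
Proof.
move=> fg gh Ti z; split=> [|[w <-]]; last first.
  have [x <-] := rep_C_surj w; rewrite !rep_C_mapE (exact_comp0 x (fg v)).
  exact: linear0.
have [y <-] := rep_C_surj z; rewrite rep_C_mapE => /rep_C_proj0 gy.
have [|x [xi gx]] := incoming_image_exact gh Ti gy; first exact: exact_comp0 (gh v).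
have /fg[w wE] : g v (y - x) = 0 by rewrite linearB gx subrr.
exists (coker_proj (rep_f X v) w); rewrite rep_C_mapE wE linearB.
by rewrite (iffRL (rep_C_proj0 x) xi) subr0.
Qed.

Lemma rep_C_mono (X Y Z : rep Q R) (f : rep_hom X Y) (g : rep_hom Y Z) v :
    rep_mono f -> rep_exact_at f g ->
    (forall a : arrow Q, injective (rep_map Z a)) ->
  injective (rep_C_map f v).
Proof.
move=> fi fg Zi; apply: linear_inj => z; have [x <-] := rep_C_surj z.
rewrite rep_C_mapE => /rep_C_proj0 fx; apply/rep_C_proj0.
have [|x' [x'i /fi <-] //] := incoming_image_exact fg Zi fx.
exact: exact_comp0 (fg v).
Qed.

Section FlatRep.
Variable F : rep Q R.
Hypothesis flatF : flat_rep F.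

Let injF : injective_rep (drepv F) := iffLR (flat_rep_dual F) flatF.

Lemma flat_rep_at v : flat_module (F v).
Proof. by apply/flat_dual; exact: (@injective_rep_at _ _ hforest (drepv F) injF v). Qed.

Lemma flat_rep_inj (a : arrow Q) : injective (rep_map F a).
Proof.
apply: linear_inj => y y0; apply: (cdual_eq0 (c := opv R)) => f.
have [g <-] := injective_rep_surj hforest injF f.
by rewrite -[LHS]/(cdual_fun g (rep_map F a y)) y0 raddf0.
Qed.

Lemma injective_of_kernel (S : pzRingType) (I A B : lmodType S) (i : {linear I -> A})
    (p : {linear A -> B}) :
  injective i -> exact_at i p -> injective_module (kernel p) -> injective_module I.
Proof.
move=> ii ip injK.
have [s sP] : exists s : {linear I -> kernel p}, forall x, kernel_val p (s x) = i x.
  apply: factor_inj; first exact: kernel_val_inj.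
  by move=> x; apply/kernel_exact; exact: exact_comp0 ip.
have [r rP] : exists r : {linear kernel p -> I}, forall x, i (r x) = kernel_val p x.
  by apply: factor_inj => // x; apply/ip; exact: kernel_valP.
by apply: (injective_retractW (i := s) (r := r) injK) => x; apply: ii; rewrite rP sP.
Qed.

(** The dual of the cokernel at [target a] is the kernel of the structure map of the injective
    representation [F^+], hence injective. *)
Lemma flat_rep_C v : flat_module (rep_C F v).
Proof.
have ci := short_exact_coker (rep_f_inj flat_rep_inj (v := v)).
elim/(forest_ind hforest): v ci => [v root|a _] ci.
  have [qi qs] := iffLR (bij_short_exact _ _ (incoming_root root)) ci.
  have [r rP] := @factor_surj _ _ _ _ _ idfun qs (fun x => inj_eq0 qi (x := x)).
  apply: (flat_iso (q := r)) => [|x|]; [|by eexists; exact: rP|exact: flat_rep_at].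
  by apply: linear_inj => z; have [y <-] := qs z; rewrite rP /= => ->; exact: linear0.
have [fi fq qs] := iffLR (rep_f_short_exact hforest _) ci.
apply/flat_dual; apply: (injective_of_kernel (p := omap (drepv F) a)).
- exact: cdual_map_inj qs.
- exact: cdual_exact fq.
- exact: injective_rep_kernel.
Qed.
End FlatRep.
End Forward.

(** * Cocycles on sets of vertices *)

Section CycleResolution.
Variables (Q : quiver) (R : pzRingType).
Hypothesis hforest : is_forest Q.
Variables (F : int -> rep Q R) (d : forall n, rep_hom (F n) (F (n + 1))).
Hypothesis Fflat : forall n, flat_rep (F n).
Hypothesis dex : forall n, rep_exact_at (d n) (d (n + 1)).
Hypothesis Eex : forall E : rep (opposite Q) R^c, injective_rep E -> forall n,
  exact_at (path_tensor_map (rep_id E) (d n)) (path_tensor_map (rep_id E) (d (n + 1))).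

Let injF (n : int) : injective_rep (drepv (F n)) := iffLR (flat_rep_dual (F n)) (@Fflat n).

Let dd (n : int) v x : d (n + 1) v (d n v x) = 0. Proof. exact: exact_comp0 (@dex n v). Qed.

Let dual (n : int) v : {linear cdual (opv R) (F (n + 1) v) -> cdual (opv R) (F n v)} :=
  cdual_map (opv R) (d n v).

Let dualE (n : int) v f x : cdual_fun (dual n v f) x = cdual_fun f (d n v x). Proof. by []. Qed.

Let dual_omap n (a : arrow Q) f :
  omap (drepv (F n)) a (dual n (target a) f) =
  dual n (source a) (omap (drepv (F (n + 1))) a f).
Proof.
apply: cdualP => x; rewrite dualE.
rewrite -[LHS]/(cdual_fun f (d n (target a) (rep_map (F n) a x))).
by rewrite -[RHS]/(cdual_fun f (rep_map (F (n + 1)) a (d n (source a) x))) rep_natural.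
Qed.

(** For [U] closed under descendants, [onset U E] is injective, so tensoring with it keeps the
    complex exact. This is that exactness, transposed to morphisms from [onset U E] into the duals
    of the [F n]. *)
Lemma onset_cocycle (U : vertex Q -> Prop) (E : lmodType R^c) (n : int)
    (g : forall v, {linear E -> drepv (F (n + 1)) v}) :
    (forall a : arrow Q, U (source a) -> U (target a)) -> injective_module E ->
    cofam U g -> (forall v e, dual n v (g v e) = 0) ->
  exists g' : forall v, {linear E -> drepv (F (n + 1 + 1)) v},
    cofam U g' /\ forall v e, dual (n + 1) v (g' v e) = g v e.
Proof.
move=> Uc injE gc g0; have injU := onset_injective hforest injE Uc.
have [h hP] := cofam_hom gc.
have [|h' h'P] := iffLR (path_tensor_exact (onset U E) (@dd n))
  (@Eex (onset U E) injU n) (rep_unswap h).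
  move=> v x; apply: cdualP => e.
  by rewrite -[LHS]/(cdual_fun (dual n v (h v e)) x) hP g0.
exists (fun v => rep_swap h' v \o rmk _ _); split; first exact: hom_cofam.
move=> v e; apply: cdualP => y.
rewrite dualE -[LHS]/(cdual_fun (h' v (d (n + 1) v y)) (rmk _ _ e)) h'P.
rewrite -[LHS]/(cdual_fun (h v (rmk _ _ e)) y) hP.
have [Uv|Uv] := pselect (U v); first by rewrite rmk_in.
by rewrite rmk_out // !linear0; have [-> //] := gc.
Qed.

(* the long exact sequence of [0 -> onset W E -> onset U E -> onset U' E -> 0] *)
Lemma onset_cocycle_diff (U U' W : vertex Q -> Prop) (E : lmodType R^c) (n : int)
    (g : forall v, {linear E -> drepv (F (n + 1)) v}) :
    (forall v, U' v -> U v) -> (forall v, W v <-> U v /\ ~ U' v) ->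
    (forall a : arrow Q, U (source a) -> U (target a)) ->
    (forall a : arrow Q, U' (source a) -> U' (target a)) -> injective_module E ->
    cofam W g -> (forall v e, dual n v (g v e) = 0) ->
  exists g' : forall v, {linear E -> drepv (F (n + 1 + 1)) v},
    cofam W g' /\ forall v e, dual (n + 1) v (g' v e) = g v e.
Proof.
have [m nm] : exists m, n = m + 1 by exists (n - 1); rewrite subrK.
subst n => U'U WP Uc U'c injE [g0 gE] gd.
(* [onset W E] is a subrepresentation of [onset U E], and the dual of a flat representation is
   injective, so [g] extends to a family [t] on [U]. *)
have [||t [[t0 tE] tg]] := cofam_extend (U := U) (@injF _) _ _ (conj g0 gE).
- by move=> v /WP[].
- by move=> a /WP[_ Ut'] Us; apply/WP; split=> // /U'c.
(* The connecting map: [dual t] vanishes on [W], so it is a cocycle on [U']. It is the image of some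
   [s] on [U'], and [t - s] is then a cocycle on [U] that agrees with [g] on [W]. *)
have [||s [[s0 sE] sP]] := @onset_cocycle U' E m (fun v => dual (m + 1) v \o t v) U'c injE.
- split=> [v Uv x|a Ut x].
    rewrite -[LHS]/(dual (m + 1) v (t v x)).
    have [Uv'|nU] := pselect (U v); last by rewrite t0 // linear0.
    by rewrite tg ?gd //; apply/WP.
  rewrite -[LHS]/(omap (drepv (F (m + 1))) a (dual (m + 1) (target a) (t (target a) x))).
  by rewrite dual_omap tE //; exact: U'U.
- move=> v e; apply: cdualP => x.
  by rewrite -[LHS]/(cdual_fun (t v e) (d (m + 1) v (d m v x))) dd raddf0.
have [||c [[c0 cE] cP]] := @onset_cocycle U E (m + 1) (fun v => t v \- s v) Uc injE.
- split=> [v Uv x|a Ut x].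
    by rewrite /= t0 // s0 ?subrr // => /U'U.
  rewrite -[LHS]/(omap (drepv (F (m + 1 + 1))) a (t (target a) x - s (target a) x)).
  rewrite -[RHS]/(t (source a) x - s (source a) x) linearB tE //; congr (_ - _).
  have [Ut'|Ut'] := pselect (U' (target a)); first exact: sE.
  by rewrite !s0 ?linear0 // => /U'c.
- by move=> v e; rewrite -[LHS]/(dual (m + 1) v (t v e - s v e)) linearB sP subrr.
(* Restriction of [c] to [W]; it is still compatible along arrows, because [W] is closed under
   predecessors within [U]. *)
pose c' v : {linear E -> drepv (F (m + 1 + 1 + 1)) v} :=
  if pselect (W v) then c v else \0.
have c'W v : W v -> c' v = c v by rewrite /c'; case: pselect.
have c'0 v x : ~ W v -> c' v x = 0 by rewrite /c'; case: pselect.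
exists c'; split; first split=> [v|a Wt x].
- by move=> Wv x; exact: c'0.
- have [Ut Ut'] := iffLR (WP _) Wt; rewrite c'W // cE //.
  have [Ws|Ws] := pselect (W (source a)); first by rewrite c'W.
  by rewrite c'0 // c0 // => Us; apply: Ws; apply/WP; split=> // /U'c.
- move=> v e; have [Wv|Wv] := pselect (W v); last by rewrite c'0 // g0 // linear0.
  have [_ Uv'] := iffLR (WP _) Wv.
  by rewrite c'W // cP /= tg // s0 // subr0.
Qed.

Lemma cofam_anc_eq0 (X : rep (opposite Q) R^c) (E : lmodType R^c) v
    (g : forall w : vertex Q, {linear E -> X w}) :
  cofam (fun w => anc w v) g -> (forall x, g v x = 0) -> forall w x, g w x = 0.
Proof.
move=> [g0 gE] gv w x; have [wv|] := pselect (anc w v); last by move=> /g0.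
suff h u : qpath w u -> anc u v -> g u x = 0 -> g w x = 0.
  by case: wv => p; exact: h p (anc_refl v) (gv x).
elim=> // a q IH av ga; apply: IH; first exact: anc_cons.
by rewrite -gE // ga linear0.
Qed.

(** A map from [F v] to [E^+] is a family on the ancestors of [v]. These form the complement of a
    set closed under descendants, namely the vertices that are not ancestors of [v]. *)
Lemma anc_cocycle v (E : lmodType R^c) (n : int)
    (h : {linear F (n + 1) v -> cdual (opc R) E}) : injective_module E ->
    (forall x, h (d n v x) = 0) ->
  exists h' : {linear F (n + 1 + 1) v -> cdual (opc R) E},
    forall y, h' (d (n + 1) v y) = h y.
Proof.
move=> injE hd; have [g [gc gv]] := anc_cofam hforest (X := drepv (F (n + 1))) (swap (@opvK R) h).
have gd w e : dual n w (g w e) = 0.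
  move: w e; apply: (@cofam_anc_eq0 (drepv (F n)) E v (fun w => dual n w \o g w)).
    move: gc => [g0 gE]; split=> [w wv x|a av x].
      by rewrite -[LHS]/(dual n w (g w x)) g0 // linear0.
    by rewrite -[LHS]/(omap (drepv (F n)) a (dual n (target a) (g (target a) x))) dual_omap gE.
  by move=> e; apply: cdualP => x; rewrite -[LHS]/(cdual_fun (g v e) _) gv swapE hd.
have [||||g' [_ g'P]] := onset_cocycle_diff (U := fun _ => True)
    (U' := fun w => ~ anc w v) _ _ _ _ injE gc gd.
- by [].
- by move=> w; split=> [wv|[_ /contrapT//]]; split=> // /(_ wv).
- by [].
- by move=> a sv /anc_cons.
exists (swap (@opcK R) (g' v)) => y; apply: cdualP => e.
by rewrite swapE -dualE g'P gv swapE.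
Qed.

(** A map from the cokernel at [v] to [E^+] is a map from [F v] that kills the image of the incoming
    arrow, that is, a family concentrated at [v]. Here [{v}] is the set of descendants of [v] minus
    the proper ones. *)
Lemma rep_C_cocycle v (E : lmodType R^c) (n : int)
    (h : {linear rep_C (F (n + 1)) v -> cdual (opc R) E}) : injective_module E ->
    (forall x, h (rep_C_map hforest (d n) v x) = 0) ->
  exists h' : {linear rep_C (F (n + 1 + 1)) v -> cdual (opc R) E},
    forall y, h' (rep_C_map hforest (d (n + 1)) v y) = h y.
Proof.
move=> injE hd; pose p m := coker_proj (rep_f (F m) v).
pose hp : {linear F (n + 1) v -> cdual (opc R) E} := h \o p (n + 1).
have [g [gv g0]] := update_family
  (fun w => \0 : {linear E -> drepv (F (n + 1)) w})
  (swap (@opvK R) hp : {linear E -> drepv (F (n + 1)) v}).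
have gc : cofam (fun w => w = v) g.
  split=> [w wv x|a av x]; first by rewrite g0.
  subst v; rewrite gv g0; last exact: (@source_neq_target _ hforest a).
  apply: cdualP => y; rewrite -[LHS]/(cdual_fun (h (p (n + 1) (rep_map _ a y))) x).
  rewrite (_ : p (n + 1) _ = 0) ?linear0 //; apply/rep_C_proj0.
  by apply/(incoming_image_target hforest); exists y.
have gd w e : dual n w (g w e) = 0.
  have [wv|wv] := pselect (w = v); last by rewrite g0 // linear0.
  subst w; rewrite gv; apply: cdualP => x.
  by rewrite -[LHS]/(cdual_fun (h (p (n + 1) (d n v x))) e) -rep_C_mapE hd.
have [||||g' [[g'0 g'E] g'P]] := onset_cocycle_diff (U := fun w => anc v w)
    (U' := fun w => anc v w /\ w <> v) _ _ _ _ injE gc gd.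
- by move=> w [].
- move=> w; split=> [->|[vw nw]]; first by split; [exact: anc_refl|case].
  by apply: contrapT => wv; apply: nw.
- by move=> a; exact: anc_snoc.
- move=> a [va av]; split; first exact: anc_snoc.
  by move=> e; apply: (anc_acyclic hforest (a := a)); rewrite e.
(* The lifted map descends to the cokernel: the family [g'] is compatible along the incoming arrow
   and zero at its source. *)
have [|h' h'P] := @factor_surj _ _ _ _ (p (n + 1 + 1)) (swap (@opcK R) (g' v))
  (@rep_C_surj _ _ _ _).
  move=> x /rep_C_proj0 xi; apply: cdualP => e; rewrite swapE.
  have [[a av]|root] := pselect (exists a : arrow Q, target a = v); last first.
    have /(incoming_image_root _ (fun a av => root (ex_intro _ a av))) -> := xi.
    by rewrite !raddf0.
  subst v; have /(incoming_image_target hforest)[y <-] := xi.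
  rewrite -[LHS]/(cdual_fun (omap _ a (g' (target a) e)) y) g'E // g'0 //.
  exact: (@source_neq_target _ hforest a).
exists h' => z; have [y <-] := rep_C_surj z; apply: cdualP => e.
rewrite rep_C_mapE h'P swapE -dualE g'P gv.
by [].
Qed.
End CycleResolution.

Lemma gorenstein_flat_rep_good (Q : quiver) (R : pzRingType) (M : rep Q R) v :
    is_forest Q -> gorenstein_flat_rep M ->
  [/\ gorenstein_flat_module (M v), short_exact (rep_f M v) (coker_proj (rep_f M v))
    & gorenstein_flat_module (rep_C M v)].
Proof.
move=> hforest [F [d [k [Fflat dex [ki kd] Eex]]]].
have Fi n (a : arrow Q) : injective (rep_map (F n) a).
  exact: (@flat_rep_inj _ _ hforest (F n) (Fflat n) a).
have Mi (a : arrow Q) : injective (rep_map M a).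
  apply: linear_inj => x x0; apply: (inj_eq0 (@ki _)); apply: (inj_eq0 (@Fi 0 a)).
  by rewrite -rep_natural x0 linear0.
have dd n w x : d (n + 1) w (d n w x) = 0 by exact: exact_comp0 (dex n w).
split; last 2 first.
- by apply: short_exact_coker; exact: (rep_f_inj hforest).
- exists (fun n => rep_C (F n) v), (fun n => rep_C_map hforest (d n) v), (rep_C_map hforest k v).
  have cex n : exact_at (rep_C_map hforest (d n) v) (rep_C_map hforest (d (n + 1)) v).
    exact: rep_C_exact (dex n) (dex (n + 1)) (Fi _).
  split=> [n|n||E injE n].
  + exact: flat_rep_C.
  + exact: cex.
  + split; first exact: rep_C_mono ki kd (Fi _).
    exact: rep_C_exact kd (dex 0) (Fi _).
  + have cc x : rep_C_map hforest (d (n + 1)) v (rep_C_map hforest (d n) v x) = 0.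
      exact: exact_comp0 (cex n).
    by apply/(tensor_exact E cc) => h hd; exact: rep_C_cocycle hd.
- exists (fun n => F n v), (fun n => d n v), (k v).
  split=> [n|n||E injE n].
  + exact: flat_rep_at.
  + exact: dex.
  + by split; [exact: ki|exact: kd].
  + by apply/(tensor_exact E (dd n v)) => h hd; exact: anc_cocycle hd.
Qed.

Theorem proposition6p11 (Q : quiver) (R : pzRingType)
    (hforest : is_forest Q)
    (hbarren : forall v : vertex Q, barren_tree (component v))
    (hR : gorenstein_ring R) (M : rep Q R) :
  gorenstein_flat_rep M <->
  (forall v : vertex Q,
     [/\ gorenstein_flat_module (M v),
         short_exact (rep_f M v) (coker_proj (rep_f M v))
       & gorenstein_flat_module (rep_C M v)]).
Proof.
split=> [gM v|gM]; first exact: gorenstein_flat_rep_good.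
have [_ noeth _ _] := hR; apply: good_gorenstein_flat => // v.
by have [_ fC cC] := gM v; exists (rep_C M v), (coker_proj (rep_f M v)).
Qed.
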